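(* Let $n\ge1$ be an integer, $k\ge\frac{n-1}{2n}$, $a,b,C>0$ and $p,q\in[1,+\infty]$. Let $f$ be a measurable function on $\mathbb{R}$ such that $x\mapsto e^{na|x|^{2/n}}f(x)$ belongs to $L^p_{k,n}+L^q_{k,n}$ and $$\int_{\mathbb{R}}\log^+\left|\frac{e^{nb|x|^{2/n}}\mathcal{F}_{k,n}f(x)}{C}\right|\,d\mu_{k,n}(x)<+\infty.$$ Then: 1. If $ab>\frac14$, then $f=0$ almost everywhere. 2. If $ab=\frac14$, then $f(x)=\lambda e^{-na|x|^{2/n}}$ almost everywhere for some $\lambda\in\mathbb{C}$ with $|\lambda|\le(2a)^{kn-\frac n2+1}C$. 3. If $ab<\frac14$, there exist multiple (nonzero) functions satisfying these conditions.
   Context: Here $\log^+r=\log r$ if $r>1$ and $\log^+r=0$ otherwise. Notation: $\alpha=kn-\frac n2$; $j_\beta(z)=\Gamma(\beta+1)\sum_{m\ge0}\frac{(-1)^m}{m!\,\Gamma(\beta+m+1)}(z/2)^{2m}$; $d\mu_{k,n}(x)=\frac{1}{2\Gamma(kn-\frac n2+1)}(\frac n2)^{kn-\frac n2}|x|^{2k+\frac2n-2}dx$, $L^p_{k,n}=L^p(\mathbb{R},d\mu_{k,n})$. The $(k,\frac2n)$-generalized Fourier transform is $\mathcal{F}_{k,n}f(\lambda)=\int_{\mathbb{R}}f(x)B_{k,n}(x,\lambda)\,d\mu_{k,n}(x)$ with kernel $B_{k,n}(x,\lambda)=j_\alpha(n|\lambda x|^{1/n})+(-i)^n(\frac n2)^n\frac{\Gamma(\alpha+1)}{\Gamma(\alpha+n+1)}\lambda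 x\,j_{\alpha+n}(n|\lambda x|^{1/n})$. *)

(* Defs.v *)
From HB Require Import structures.
From mathcomp Require Import all_boot all_order all_algebra.
From mathcomp Require Import all_classical all_reals all_analysis.
From mathcomp Require Import measurable_realfun.
From mathcomp Require Import complex.

Set Implicit Arguments.
Unset Strict Implicit.
Unset Printing Implicit Defensive.

Import Order.TTheory GRing.Theory Num.Theory.
Import numFieldNormedType.Exports.

Local Open Scope classical_set_scope.
Local Open Scope ring_scope.

Section Defs.
Context {R : realType}.

Definition Gamma (s : R) : R :=
  Rintegral (@lebesgue_measure R) [set t : R | 0 < t]
    (fun t => t `^ (s - 1) * expR (- t)).

Definition jbessel (beta z : R) : R :=
  Gamma (beta + 1) *
  limn (fun N => \sum_(0 <= m < N)
            ((-1) ^+ m / ((m`!)%:R * Gamma (beta + m%:R + 1))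
             * (z / 2) ^+ (2 * m))).

Definition alpha (k : R) (n : nat) : R := k * n%:R - n%:R / 2.

Definition weight_kn (k : R) (n : nat) (x : R) : R :=
  (2 * Gamma (alpha k n + 1))^-1 * (n%:R / 2) `^ (alpha k n)
  * `|x| `^ (2 * k + 2 / n%:R - 2).

Definition logp (r : R) : R := if 1 < r then ln r else 0.

End Defs.

Section mukn.
Context {R : realType} (k : R) (n : nat).
Local Open Scope ereal_scope.

Definition mu_kn (A : set R) : \bar R :=
  \int[@lebesgue_measure R]_(x in A) (Num.max (weight_kn k n x) 0)%:E.

Let mu_kn0 : mu_kn set0 = 0.
Proof. by rewrite /mu_kn integral_set0. Qed.

Let mu_kn_ge0 A : 0 <= mu_kn A.
Proof. by apply: integral_ge0 => x _; rewrite lee_fin le_max lexx orbT. Qed.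

Let mu_kn_sigma_additive : semi_sigma_additive mu_kn.
Proof.
have mw : measurable_fun setT (fun x : R => (Num.max (weight_kn k n x) 0)%:E).
  apply/measurable_EFinP.
  apply: measurable_maxr => //.
  apply: measurable_funM => //.
  apply: (measurableT_comp (measurable_powR _)).
  exact: normr_measurable.
have w0 : forall x : R, 0 <= (Num.max (weight_kn k n x) 0)%:E.
  by move=> x; rewrite lee_fin le_max lexx orbT.
exact: (@semi_sigma_additive_nng_induced _ _ R (@lebesgue_measure R) _ mw w0).
Qed.

HB.instance Definition _ := isMeasure.Build _ _ _ mu_kn
  mu_kn0 mu_kn_ge0 mu_kn_sigma_additive.

End mukn.

Section Fourier.
Context {R : realType}.
Local Open Scope complex_scope.

Definition Bkn (k : R) (n : nat) (x l : R) : R[i] :=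
  (jbessel (alpha k n) (n%:R * `|l * x| `^ (n%:R^-1)))%:C
  + (- 'i) ^+ n
    * ((n%:R / 2) ^+ n * Gamma (alpha k n + 1) / Gamma (alpha k n + n%:R + 1))%:C
    * (l * x)%:C
    * (jbessel (alpha k n + n%:R) (n%:R * `|l * x| `^ (n%:R^-1)))%:C.

Definition Fkn (k : R) (n : nat) (f : R -> R[i]) (l : R) : R[i] :=
  Rintegral (mu_kn k n) setT (fun x => complex.Re (f x * Bkn k n x l))
  +i* Rintegral (mu_kn k n) setT (fun x => complex.Im (f x * Bkn k n x l)).

Definition cmeasurable (f : R -> R[i]) : Prop :=
  measurable_fun setT (fun x => complex.Re (f x)) /\ measurable_fun setT (fun x => complex.Im (f x)).

Definition inLp (k : R) (n : nat) (p : \bar R) (g : R -> R[i]) : Prop :=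
  cmeasurable g /\
  (Lnorm (mu_kn k n) p (fun x => (ComplexField.Normc.normc (g x))%:E) < +oo)%E.

Definition inLpLq (k : R) (n : nat) (p q : \bar R) (h : R -> R[i]) : Prop :=
  exists g1 g2, inLp k n p g1 /\ inLp k n q g2 /\ forall x, h x = g1 x + g2 x.

Definition hyp53 (k : R) (n : nat) (a b C : R) (p q : \bar R) (f : R -> R[i]) :=
  [/\ cmeasurable f,
      inLpLq k n p q (fun x => (expR (n%:R * a * `|x| `^ (2 / n%:R)))%:C * f x) &
      (\int[mu_kn k n]_x
         (logp (expR (n%:R * b * `|x| `^ (2 / n%:R))
                * ComplexField.Normc.normc (Fkn k n f x) / C))%:E < +oo)%E].

End Fourier.

(* Main.v *)
(** Write [U x = |x|^(1/n)] and [B = n/(4a)].  The even and odd parts of the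
    transform of [f] extend to entire functions [E] and [O] of [t] such that
    [F f (± t^n) = E t ± κ t^n O t].  The integrability hypothesis on [f] and the
    Bessel bound [|j_β(z)| <= exp |Im z|], which comes from an energy estimate on
    the Bessel equation, show that [g±(z) = exp (B z^2) (E z ± κ z^n O z)] is
    bounded by a polynomial times [exp (B (Re z)^2)].  The logarithmic hypothesis
    controls [g±] on the real axis, and the Phragmén-Lindelöf principle then makes
    [g±] of polynomial growth, hence a polynomial, hence constant.  So [E] is a
    Gaussian and [O = 0], which says that [f] has the moments of a multiple of
    [exp (- n a U^2)].  Exponential integrability makes the moment problem
    determinate, and the log condition bounds the constant.  When [ab < 1/4]
    Gaussians of intermediate width are examples.

    No complex analysis is used.  Entire functions are represented as locally
    uniform limits of polynomials, for which [log (1 + |p|^2)] has nonnegative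
    Laplacian, and Phragmén-Lindelöf is obtained from the maximum principle for
    the Laplacian; Cauchy's coefficient estimates come from averaging a
    polynomial over roots of unity. *)
Require Import Defs.
From HB Require Import structures.
From mathcomp Require Import all_boot all_order all_algebra.
From mathcomp Require Import all_classical all_reals all_analysis.
From mathcomp Require Import measurable_realfun.
From mathcomp Require Import complex.
From mathcomp Require Import ring lra.
From mathcomp Require Import ess_sup_inf.
From mathcomp Require cyclic cyclotomic.
From mathcomp Require Import separable zify.
Import Order.TTheory GRing.Theory Num.Theory.
Import numFieldNormedType.Exports.
Local Open Scope classical_set_scope.
Local Open Scope ring_scope.
Local Open Scope complex_scope.
Set Implicit Arguments.
Unset Strict Implicit.
Unset Printing Implicit Defensive.

(** The exponent [B] is the conjugate of the Gaussian weight: [n U y - n a U^2] is at most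
    [n y^2 / (4 a)], and the factor [exp (B z^2)] trades this growth in [Im z] for growth in [Re z];
    on the real axis that factor is covered by the log hypothesis exactly when [B <= n b], that is
    [1/4 <= a b]. Two obstacles shape the Phragmén-Lindelöf step. Order two is critical for a
    quadrant, so the proof must exploit that [exp (B x^2)] is trivial on the imaginary axis: it
    works in sectors [k y <= x] whose slanted side tends to that axis. And the control on the real
    axis is an integral, not a pointwise bound, so boundary values are dominated by sums of Poisson
    kernels; the resulting bound [K0 / y] degenerates at the axis and is repaired by a second
    argument in the strip [|y| <= 1]. The hypothesis on [k] says [alpha >= -1/2]. It gives the sign
    of the damping term in the Bessel equation, and in the variable [t = |x|^(1/n)] the measure has
    density proportional to [t^(2 alpha + 1)], which is then bounded below for [t >= 1]. *)

Section Calculus.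
Context {R : realType}.
Implicit Types (f g : R -> R) (x a b : R).

(* A wrapper that keeps type class resolution from instantiating the value. *)
Definition der f x a : Prop := is_derive x (1 : R) f a.

Lemma derE f x a b : der f x a -> a = b -> der f x b.
Proof. by move=> ? <-. Qed.
Lemma derC (c : R) x : der (fun=> c) x 0.
Proof. exact: is_derive_cst. Qed.
Lemma derI x : der (fun s => s) x 1.
Proof. exact: is_derive_id. Qed.
Lemma derD f g x a b : der f x a -> der g x b ->
  der (fun s => f s + g s) x (a + b).
Proof. by move=> ? ?; exact: is_deriveD. Qed.
Lemma derN f x a : der f x a -> der (fun s => - f s) x (- a).
Proof. by move=> ?; exact: is_deriveN. Qed.
Lemma derB f g x a b : der f x a -> der g x b ->
  der (fun s => f s - g s) x (a - b).
Proof. by move=> ? ?; exact: is_deriveB. Qed.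
Lemma derM f g x a b : der f x a -> der g x b ->
  der (fun s => f s * g s) x (f x * b + g x * a).
Proof. by move=> ? ?; exact: is_deriveM. Qed.
Lemma derMc c f x a : der f x a -> der (fun s => c * f s) x (c * a).
Proof.
move=> fa; apply: derE; first exact: derM (derC c x) fa.
by rewrite mulr0 addr0.
Qed.
Lemma derX f n x a : der f x a ->
  der (fun s => f s ^+ n) x (n%:R * f x ^+ n.-1 * a).
Proof.
move=> fa; elim: n => [|n IH]; first by rewrite !mul0r; exact: (derC 1 x).
rewrite (_ : (fun s => _) = fun s => f s * f s ^+ n); last first.
  by apply/funext => s; rewrite exprS.
apply: derE; first exact: derM fa IH.
case: n {IH} => [|n] /=; rewrite ?mul0r ?mulr0 ?add0r ?expr0 ?mul1r //.
by rewrite !exprS; ring.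
Qed.
Lemma derV f x a : f x != 0 -> der f x a ->
  der (fun s => (f s)^-1) x (- a / f x ^+ 2).
Proof.
move=> f0 fa; apply: derE; first exact: (@is_deriveV _ f x a 1 f0 fa).
by rewrite /GRing.scale/= mulrC mulrN mulNr.
Qed.
Lemma der_comp f g x a b : der g x a -> der f (g x) b ->
  der (fun s => f (g s)) x (b * a).
Proof.
move=> ga fb; apply: derE; first exact: (@is_derive1_comp _ f g x _ _ fb ga).
by rewrite mulrC.
Qed.
Lemma derln f x a : 0 < f x -> der f x a -> der (fun s => ln (f s)) x (a / f x).
Proof.
move=> f0 fa; apply: derE.
  by apply: (der_comp fa); exact: is_derive1_ln.
by rewrite mulrC.
Qed.
Lemma derexp f x a : der f x a -> der (fun s => expR (f s)) x (a * expR (f x)).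
Proof.
move=> fa; apply: derE.
  by apply: (der_comp fa); exact: is_derive_expR.
by rewrite mulrC.
Qed.

Lemma der_continuous f x a : der f x a -> {for x, continuous f}.
Proof.
by move=> [h _]; apply: differentiable_continuous; exact/derivable1_diffP.
Qed.

(** * Second derivatives and the Laplacian, as relations between a point and a value *)

Definition lap2 f x l := exists f', (\forall z \near x, der f z (f' z))
  /\ der f' x l.

Definition lap (w : R -> R -> R) x y l :=
  exists a b, [/\ lap2 (w^~ y) x a, lap2 (w x) y b & l = a + b].

Lemma lap2D f g x a b : lap2 f x a -> lap2 g x b ->
  lap2 (fun s => f s + g s) x (a + b).
Proof.
move=> [f' [f1 f2]] [g' [g1 g2]]; exists (fun s => f' s + g' s); split.
  by apply: filterS2 f1 g1 => z; exact: derD.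
exact: derD.
Qed.

Lemma lap2Z c f x a : lap2 f x a -> lap2 (fun s => c * f s) x (c * a).
Proof.
move=> [f' [f1 f2]]; exists (fun s => c * f' s); split.
  by apply: filterS f1 => z; exact: derMc.
exact: derMc.
Qed.

Lemma lap2C c x : lap2 (fun=> c) x 0.
Proof. by exists (fun=> 0); split; [apply: filterE => z|]; exact: derC. Qed.

Lemma lap2_comp_opp f x a : lap2 f (- x) a -> lap2 (fun s => f (- s)) x a.
Proof.
have dO z : der (fun s => - s) z (-1) by apply: derN; exact: derI.
move=> [f' [f1 f2]]; exists (fun s => - f' (- s)); split; last first.
  by apply: derE; [apply: derN; exact: der_comp (dO x) f2|rewrite mulrN1 opprK].
have : \forall z \near x, der f (- z) (f' (- z)).
  exact: (@opp_continuous R x _ f1).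
apply: filterS => z h.
by apply: derE; [exact: der_comp (dO z) h|rewrite mulrN1].
Qed.

Lemma lapD w1 w2 x y a b : lap w1 x y a -> lap w2 x y b ->
  lap (fun x y => w1 x y + w2 x y) x y (a + b).
Proof.
move=> [a1 [a2 [h1 h2 ->]]] [b1 [b2 [k1 k2 ->]]].
exists (a1 + b1), (a2 + b2); split; [exact: lap2D h1 k1|exact: lap2D h2 k2|].
by rewrite addrACA.
Qed.

Lemma lapZ c w x y a : lap w x y a -> lap (fun x y => c * w x y) x y (c * a).
Proof.
move=> [a1 [a2 [h1 h2 ->]]]; exists (c * a1), (c * a2); split.
- exact: lap2Z h1.
- exact: lap2Z h2.
- by rewrite mulrDr.
Qed.

Lemma lapC c x y : lap (fun _ _ => c) x y 0.
Proof. by exists 0, 0; split; [exact: lap2C..|rewrite addr0]. Qed.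

Lemma lap_sum (I : Type) (s : seq I) (w : I -> R -> R -> R) x y :
  (forall i, lap (w i) x y 0) ->
  lap (fun x y => \sum_(i <- s) w i x y) x y 0.
Proof.
move=> h; elim: s => [|i s IH].
  rewrite (_ : (fun _ _ => _) = (fun _ _ => 0)); first exact: lapC.
  by apply/funext => ?; apply/funext => ?; rewrite big_nil.
rewrite (_ : (fun _ _ => _) =
    fun x y => w i x y + \sum_(j <- s) w j x y); last first.
  by apply/funext => ?; apply/funext => ?; rewrite big_cons.
by rewrite -[X in lap _ _ _ X]addr0; exact: lapD (h i) IH.
Qed.

(** If [l > 0], the vanishing of [f' x] at the maximum makes [f'] positive just to the right of [x],
    and the mean value theorem then produces a value above [f x]. *)
Lemma lap2_local_max f x l : lap2 f x l -> (\forall z \near x, f z <= f x) ->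
  l <= 0.
Proof.
move=> [f' [f1 f2]] fmax; rewrite leNgt; apply/negP => l0.
have [e /= e0 he] : exists2 e : R, 0 < e & forall z, `|x - z| < e ->
    der f z (f' z) /\ f z <= f x.
  by have [e /= e0 h] := filterI f1 fmax; exists e => // z /h [].
have e20 : 0 < e / 2 by lra.
have f'x : f' x = 0.
  have [_ <-] : der f x (f' x) by have [] := he x; rewrite ?subrr ?normr0.
  have : der f x 0; last by case.
  apply: (@derive1_at_max _ f (x - e / 2) (x + e / 2)); first lra.
  - move=> t; rewrite in_itv/= => /andP[t1 t2].
    have [|d _] := he t; first by rewrite ltr_norml; lra.
    by case: d.
  - by rewrite in_itv/=; lra.
  - move=> t; rewrite in_itv/= => /andP[t1 t2].
    by have [|_ ?] := he t; first by rewrite ltr_norml; lra.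
have [df dv] := f2.
have cv : h^-1 *: ((f' \o shift x) (h *: 1) - f' x) @[h --> 0^'] --> l.
  by rewrite -dv; exact: df.
have [d /= d0 hd] := cvgr_gt _ cv _ l0.
pose m := Num.min (d / 2) (e / 2).
have m0 : 0 < m by rewrite lt_min; apply/andP; split; lra.
have md : m < d by rewrite gt_min; apply/orP; left; lra.
have me : m < e by rewrite gt_min; apply/orP; right; lra.
have hin z : z \in `[x, x + m]%R -> `|x - z| < e.
  by rewrite in_itv/= => /andP[? ?]; rewrite ltr_norml; lra.
have [z zin zE] : exists2 c, c \in `]x, x + m[%R &
    f (x + m) - f x = f' c * (x + m - x).
  apply: MVT; first by rewrite ltrDl.
    by move=> z /subset_itv_oo_cc/hin/he[].
  apply: continuous_in_subspaceT => z; rewrite inE => /= /hin/he[+ _].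
  exact: der_continuous.
move: zin; rewrite in_itv/= => /andP[xz zm].
have fz : 0 < f' z.
  have := hd (z - x); rewrite /= sub0r normrN gtr0_norm ?subr_gt0//.
  move=> /(_ _ _); rewrite subr_eq0 gt_eqF//= f'x subr0 /GRing.scale/= mulr1 subrK.
  by rewrite pmulr_rgt0 ?invr_gt0 ?subr_gt0//; apply => //; lra.
have [_] : der f (x + m) (f' (x + m)) /\ f (x + m) <= f x.
  by apply: he; apply: hin; rewrite in_itv/=; lra.
rewrite leNgt => /negP; apply; rewrite -subr_gt0 zE addrAC subrr add0r.
by rewrite mulr_gt0.
Qed.

End Calculus.

(** * Maximum principle and comparison with superharmonic barriers *)

Section MaximumPrinciple.
Context {R : realType}.
Implicit Types (K : set (R * R)) (w h u : R -> R -> R).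

(** Weaker than being an interior point: only the horizontal and the vertical line through the point
    matter, because the Laplacian is tested one variable at a time. *)
Definition inner K (x y : R) :=
  (\forall z \near x, K (z, y)) /\ (\forall z \near y, K (x, z)).

Lemma maximum_principle K (r : R) w :
  closed K -> (forall p, K p -> `|p.1| <= r /\ `|p.2| <= r) ->
  (forall p, K p -> {for p, continuous (fun p => w p.1 p.2)}) ->
  (forall x y, K (x, y) -> w x y <= 0 \/
     inner K x y /\ exists2 l, 0 <= l & lap w x y l) ->
  forall x y, K (x, y) -> w x y <= 0.
Proof.
move=> cK bK cw Hw x0 y0 K0; apply/ler_addgt0Pr => e e0.
have r0 : 0 <= r by have [h _] := bK _ K0; exact: le_trans h.
pose d := e / (r ^+ 2 + 1).
have d0 : 0 < d by rewrite divr_gt0// ltr_wpDl// sqr_ge0.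
(* The added term is nonpositive on [K] and has Laplacian [2 d > 0], so [W] cannot have its maximum
   at a point where [w] has nonnegative Laplacian. The choice of [d] keeps the loss [d r^2] below
   [e]. *)
pose W x y := w x y + d * (x ^+ 2 - r ^+ 2).
have [[x1 y1] /= K1 mx] : exists2 c : R * R, c \in K &
    forall t, t \in K -> W t.1 t.2 <= W c.1 c.2.
  apply: (@compact_EVT_max _ _ (fun p : R * R => W p.1 p.2)).
  - by exists (x0, y0).
  - apply: (@subclosed_compact _ _ (`[- r, r]%classic `*` `[- r, r]%classic)) => //.
      by apply: compact_setX; exact: segment_compact.
    by move=> p /bK [/ler_normlP[? ?] /ler_normlP[? ?]];
      split; rewrite /= in_itv/=; lra.
  - apply: continuous_in_subspaceT => p; rewrite inE => /cw cp.
    apply: cvgD => //; apply: cvgM; first exact: cvg_cst.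
    apply: cvgB; last exact: cvg_cst.
    by apply: (@cvgM _ _ _ _ (fun p : R * R => p.1) (fun p : R * R => p.1)); exact: cvg_fst.
rewrite inE in K1.
have wW x y : K (x, y) -> W x y <= w x y.
  move=> /bK[/= /ler_normlP[? ?] _]; rewrite /W gerDl pmulr_rle0// subr_le0.
  by rewrite -ler_sqrt ?sqr_ge0// !sqrtr_sqr [leRHS]ger0_norm// ler_norml; lra.
have [w1|[[in1 in2] [l l0 [a [b [la lb lE]]]]]] := Hw _ _ K1.
  have := mx (x0, y0); rewrite inE => /(_ K0)/=; rewrite /W => h.
  have := wW _ _ K1; rewrite /W => h2.
  have h3 : 0 <= x0 ^+ 2 by exact: sqr_ge0.
  have h4 : d * r ^+ 2 <= e.
    by rewrite /d mulrAC ler_pdivrMr ?ltr_wpDl ?sqr_ge0// mulrDr mulr1 lerDl ltW.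
  have h5 : 0 <= d * x0 ^+ 2 by rewrite mulr_ge0// ltW.
  rewrite mulrBr in h; lra.
have qa : lap2 (W ^~ y1) x1 (a + d * 2).
  apply: lap2D la _; apply: lap2Z; exists (fun s => 2 * s); split.
    apply: filterE => z; apply: derE.
      by apply: derB; [apply: derX; exact: derI|exact: derC].
    by rewrite /=; ring.
  by apply: derE; [apply: derM; [exact: derC|exact: derI]|ring].
have qb : lap2 (W x1) y1 (b + 0).
  by apply: lap2D lb _; exact: lap2C.
have : a + d * 2 <= 0.
  apply: lap2_local_max qa _; apply: filterS in1 => z Kz.
  by have := mx (z, y1); rewrite inE; exact.
have : b + 0 <= 0.
  apply: lap2_local_max qb _; apply: filterS in2 => z Kz.
  by have := mx (x1, z); rewrite inE; exact.
lra.
Qed.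

(** Locally uniform limits of functions with nonnegative Laplacian. The approximant may depend on
    the box and on the error, which is all that a comparison on a bounded set requires. *)
Definition subh u := forall r e : R, 0 < e -> exists v : R -> R -> R,
  [/\ continuous (fun p : R * R => v p.1 p.2),
      (forall x y, exists2 l, 0 <= l & lap v x y l) &
      forall x y, `|x| <= r -> `|y| <= r -> `|u x y - v x y| <= e].

Lemma subhNx u : subh u -> subh (fun x y => u (- x) y).
Proof.
move=> hu r e e0; have [v [cv lv uv]] := hu r e e0.
exists (fun x y => v (- x) y); split.
- move=> p; apply: (@continuous_comp _ _ _ (fun p : R * R => (- p.1, p.2))
    (fun p : R * R => v p.1 p.2)); last exact: cv.
  apply: (@cvg_pair _ _ _ _ (nbhs (- p.1)) (nbhs p.2)); last exact: cvg_snd.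
  by apply: cvgN; exact: cvg_fst.
- move=> x y; have [l l0 [a [b [la lb lE]]]] := lv (- x) y.
  exists l => //; exists a, b; split => //.
  exact: (@lap2_comp_opp _ (v^~ y)).
- by move=> x y xr yr; apply: uv; rewrite ?normrN.
Qed.

Lemma subhNy u : subh u -> subh (fun x y => u x (- y)).
Proof.
move=> hu r e e0; have [v [cv lv uv]] := hu r e e0.
exists (fun x y => v x (- y)); split.
- move=> p; apply: (@continuous_comp _ _ _ (fun p : R * R => (p.1, - p.2))
    (fun p : R * R => v p.1 p.2)); last exact: cv.
  apply: (@cvg_pair _ _ _ _ (nbhs p.1) (nbhs (- p.2))); first exact: cvg_fst.
  by apply: cvgN; exact: cvg_snd.
- move=> x y; have [l l0 [a [b [la lb lE]]]] := lv x (- y).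
  exists l => //; exists a, b; split => //.
  exact: (@lap2_comp_opp _ (v x)).
- by move=> x y xr yr; apply: uv; rewrite ?normrN.
Qed.

(** The maximum principle is applied to [v - h - e/2], where [v] approximates [u] within [e/2]. The
    set on which [u <= h] is already known takes the place of the boundary of [K]. *)
Lemma comparison K (r : R) u h : subh u ->
  closed K -> (forall p, K p -> `|p.1| <= r /\ `|p.2| <= r) ->
  (forall p, K p -> {for p, continuous (fun p => h p.1 p.2)}) ->
  (forall x y, K (x, y) -> u x y <= h x y \/
     inner K x y /\ exists2 l, l <= 0 & lap h x y l) ->
  forall x y, K (x, y) -> u x y <= h x y.
Proof.
move=> su cK bK ch Hu x0 y0 K0; apply/ler_addgt0Pr => e e0.
have e20 : 0 < e / 2 by rewrite divr_gt0.
have [v [cv lv uv]] := su r _ e20.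
pose w x y := (v x y + (- 1) * h x y) + - (e / 2).
have : w x0 y0 <= 0.
  apply: (@maximum_principle K r w cK bK) => //.
    move=> p Kp; apply: cvgD; last exact: cvg_cst.
    apply: cvgD; first exact: cv.
    by apply: cvgM; [exact: cvg_cst|exact: ch].
  move=> x y Kxy; have [b1 b2] := bK _ Kxy.
  have [le|[inK [l l0 lh]]] := Hu _ _ Kxy.
    by left; have := uv x y b1 b2; rewrite ler_norml /w; lra.
  right; split => //; have [m m0 lm] := lv x y.
  exists ((m + (-1) * l) + 0); first lra.
  apply: lapD; last exact: lapC.
  by apply: lapD => //; exact: lapZ.
have [b1 b2] := bK _ K0.
by have := uv x0 y0 b1 b2; rewrite ler_norml /w; lra.
Qed.
End MaximumPrinciple.

(** * Complex modulus, Cauchy-Riemann equations, subharmonicity of [log (1 + |g|^2)] *)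

Section PolynomialSubharmonic.
Context {R : realType}.
Implicit Types (p : {poly R[i]}) (x y : R).
Local Notation nc := (@ComplexField.Normc.normc R).
Local Notation Re := (@complex.Re R).
Local Notation Im := (@complex.Im R).

Lemma ReD (z w : R[i]) : Re (z + w) = Re z + Re w. Proof. by case: z w => ? ? []. Qed.
Lemma ImD (z w : R[i]) : Im (z + w) = Im z + Im w. Proof. by case: z w => ? ? []. Qed.
Lemma ReM (z w : R[i]) : Re (z * w) = Re z * Re w - Im z * Im w.
Proof. by case: z w => ? ? []. Qed.
Lemma ImM (z w : R[i]) : Im (z * w) = Re z * Im w + Im z * Re w.
Proof. by case: z w => ? ? []. Qed.
Lemma ncE (z : R[i]) : nc z = Num.sqrt (Re z ^+ 2 + Im z ^+ 2).
Proof. by case: z. Qed.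
Lemma nc_ge0 (z : R[i]) : 0 <= nc z.
Proof. by rewrite ncE sqrtr_ge0. Qed.
Lemma nc_sqr (z : R[i]) : nc z ^+ 2 = Re z ^+ 2 + Im z ^+ 2.
Proof. by rewrite ncE sqr_sqrtr// addr_ge0// sqr_ge0. Qed.
Lemma nc_Re (z : R[i]) : `|Re z| <= nc z.
Proof. by rewrite ncE -sqrtr_sqr ler_sqrt ?addr_ge0 ?sqr_ge0// lerDl sqr_ge0. Qed.
Lemma nc_Im (z : R[i]) : `|Im z| <= nc z.
Proof. by rewrite ncE -sqrtr_sqr ler_sqrt ?addr_ge0 ?sqr_ge0// lerDr sqr_ge0. Qed.
Lemma nc_le (z : R[i]) : nc z <= `|Re z| + `|Im z|.
Proof.
rewrite -(@ler_pXn2r _ 2)// ?nnegrE ?addr_ge0 ?nc_ge0//.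
rewrite nc_sqr sqrrD !real_normK ?num_real//.
have : 0 <= `|Re z| * `|Im z| by rewrite mulr_ge0.
by rewrite mulr2n; lra.
Qed.
Lemma ncM (z w : R[i]) : nc (z * w) = nc z * nc w.
Proof. exact: ComplexField.Normc.normcM. Qed.
Lemma ncD (z w : R[i]) : nc (z + w) <= nc z + nc w.
Proof. exact: le_normcD. Qed.
Lemma ncN (z : R[i]) : nc (- z) = nc z.
Proof. exact: normcN. Qed.
Lemma ncB (z w : R[i]) : nc (z - w) <= nc z + nc w.
Proof. by rewrite -(ncN w); exact: ncD. Qed.
Lemma nc_distC (z w : R[i]) : nc (z - w) = nc (w - z).
Proof. by rewrite -ncN opprB. Qed.
Lemma nc_dist (z w : R[i]) : `|nc z - nc w| <= nc (z - w).
Proof.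
have h1 : nc z <= nc (z - w) + nc w by rewrite -{1}(subrK w z); exact: ncD.
have h2 : nc w <= nc (w - z) + nc z by rewrite -{1}(subrK z w); exact: ncD.
by rewrite nc_distC in h2; rewrite ler_norml; lra.
Qed.
Lemma nc0 : nc 0 = 0. Proof. exact: ComplexField.Normc.normc0. Qed.
Lemma nc1 : nc 1 = 1. Proof. exact: ComplexField.Normc.normc1. Qed.
Lemma ncX (z : R[i]) m : nc (z ^+ m) = nc z ^+ m.
Proof. by elim: m => [|m IH]; rewrite ?expr0 ?nc1// !exprS ncM IH. Qed.
Lemma ncR (x : R) : nc x%:C = `|x|.
Proof. by rewrite ncE /= expr0n addr0 sqrtr_sqr. Qed.
Lemma nc_sum (I : Type) (s : seq I) (P : pred I) (F : I -> R[i]) :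
  nc (\sum_(i <- s | P i) F i) <= \sum_(i <- s | P i) nc (F i).
Proof.
elim/big_ind2 : _ => //; first by rewrite nc0.
by move=> a b c d h1 h2; rewrite (le_trans (ncD _ _))// lerD.
Qed.
Lemma nc_eq0 (z : R[i]) : nc z = 0 -> z = 0.
Proof. exact: ComplexField.Normc.eq0_normc. Qed.

Lemma der_polyx p x y : der (fun s => Re p.[s +i* y]) x (Re (p^`()).[x +i* y]) /\
  der (fun s => Im p.[s +i* y]) x (Im (p^`()).[x +i* y]).
Proof.
elim/poly_ind: p => [|p c [IH1 IH2]].
  by rewrite deriv0 horner0; split; rewrite (_ : (fun s => _) = fun=> 0);
    [exact: derC|apply/funext => s; rewrite horner0|exact: derC|
     apply/funext => s; rewrite horner0].
split.
- rewrite (_ : (fun s => _) = fun s =>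
    Re p.[s +i* y] * s - Im p.[s +i* y] * y + Re c); last first.
    by apply/funext => s; rewrite hornerMXaddC ReD ReM.
  apply: derE.
    apply: derD; last exact: derC.
    by apply: derB; [exact: derM IH1 (derI x)|exact: derM IH2 (derC y x)].
  by rewrite derivMXaddC hornerD hornerMX ReD ReM /=; ring.
- rewrite (_ : (fun s => _) = fun s =>
    Re p.[s +i* y] * y + Im p.[s +i* y] * s + Im c); last first.
    by apply/funext => s; rewrite hornerMXaddC ImD ImM.
  apply: derE.
    apply: derD; last exact: derC.
    by apply: derD; [exact: derM IH1 (derC y x)|exact: derM IH2 (derI x)].
  by rewrite derivMXaddC hornerD hornerMX ImD ImM /=; ring.
Qed.

(** Together with [der_polyx] these are the Cauchy-Riemann equations: the vertical derivative is [i]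
    times [p']. *)
Lemma der_polyy p x y : der (fun s => Re p.[x +i* s]) y (- Im (p^`()).[x +i* y]) /\
  der (fun s => Im p.[x +i* s]) y (Re (p^`()).[x +i* y]).
Proof.
elim/poly_ind: p => [|p c [IH1 IH2]].
  by rewrite deriv0 horner0 oppr0; split; rewrite (_ : (fun s => _) = fun=> 0);
    [exact: derC|apply/funext => s; rewrite horner0|exact: derC|
     apply/funext => s; rewrite horner0].
split.
- rewrite (_ : (fun s => _) = fun s =>
    Re p.[x +i* s] * x - Im p.[x +i* s] * s + Re c); last first.
    by apply/funext => s; rewrite hornerMXaddC ReD ReM.
  apply: derE.
    apply: derD; last exact: derC.
    by apply: derB; [exact: derM IH1 (derC x y)|exact: derM IH2 (derI y)].
  by rewrite derivMXaddC hornerD hornerMX ImD ImM /=; ring.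
- rewrite (_ : (fun s => _) = fun s =>
    Re p.[x +i* s] * s + Im p.[x +i* s] * x + Im c); last first.
    by apply/funext => s; rewrite hornerMXaddC ImD ImM.
  apply: derE.
    apply: derD; last exact: derC.
    by apply: derD; [exact: derM IH1 (derI y)|exact: derM IH2 (derC x y)].
  by rewrite derivMXaddC hornerD hornerMX ReD ReM /=; ring.
Qed.

Lemma poly_continuous2 p : continuous (fun z : R * R => Re p.[z.1 +i* z.2]) /\
  continuous (fun z : R * R => Im p.[z.1 +i* z.2]).
Proof.
elim/poly_ind: p => [|p c [IH1 IH2]].
  by split; under eq_fun do rewrite horner0; exact: cst_continuous.
split.
  under eq_fun do rewrite hornerMXaddC ReD ReM.
  move=> z; apply: cvgD; last exact: cvg_cst.
  by apply: cvgB; apply: cvgM; [exact: IH1|exact: cvg_fst|exact: IH2|exact: cvg_snd].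
under eq_fun do rewrite hornerMXaddC ImD ImM.
move=> z; apply: cvgD; last exact: cvg_cst.
by apply: cvgD; apply: cvgM; [exact: IH1|exact: cvg_snd|exact: IH2|exact: cvg_fst].
Qed.

(** The Laplacian equals [4 |p'|^2 / (1 + |p|^2)^2]. Adding 1 under the logarithm removes the
    singularities of [log |p|] at the zeros of [p]. *)
Lemma lap_ln_poly p x y : exists2 l, 0 <= l &
  lap (fun x y => ln (1 + nc p.[x +i* y] ^+ 2)) x y l.
Proof.
pose A x y := Re p.[x +i* y]; pose B x y := Im p.[x +i* y].
pose A1 x y := Re (p^`()).[x +i* y]; pose B1 x y := Im (p^`()).[x +i* y].
pose q x y := 1 + (A x y ^+ 2 + B x y ^+ 2).
have q0 x' y' : 0 < q x' y' by rewrite ltr_pwDl// addr_ge0// sqr_ge0.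
rewrite (_ : (fun _ _ => _) = fun x y => ln (q x y)); last first.
  by apply/funext => ?; apply/funext => ?; rewrite nc_sqr.
have qx x' y' : der (q^~ y') x' (2 * (A x' y' * A1 x' y' + B x' y' * B1 x' y')).
  have [h1 h2] := der_polyx p x' y'.
  apply: derE.
    apply: derD; first exact: derC.
    by apply: derD; [exact: derX h1|exact: derX h2].
  by rewrite /A /A1 /B /B1 /=; ring.
have qy x' y' : der (q x') y' (2 * (B x' y' * A1 x' y' - A x' y' * B1 x' y')).
  have [h1 h2] := der_polyy p x' y'.
  apply: derE.
    apply: derD; first exact: derC.
    by apply: derD; [exact: derX h1|exact: derX h2].
  by rewrite /A /A1 /B /B1 /=; ring.
have [dA dB] := der_polyx p x y; have [dA1 dB1] := der_polyx p^`() x y.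
have [eA eB] := der_polyy p x y; have [eA1 eB1] := der_polyy p^`() x y.
have qn : q x y != 0 by rewrite gt_eqF.
exists (4 * (A1 x y ^+ 2 + B1 x y ^+ 2) / q x y ^+ 2).
  by rewrite divr_ge0 ?sqr_ge0// mulr_ge0// addr_ge0// sqr_ge0.
do 2 eexists; split.
- exists (fun s => 2 * (A s y * A1 s y + B s y * B1 s y) / q s y); split.
    by apply: filterE => z; apply: derln => //; exact: qx.
  apply: derM; last by apply: derV => //; exact: qx.
  by apply: derMc; apply: derD; apply: derM; eassumption.
- exists (fun s => 2 * (B x s * A1 x s - A x s * B1 x s) / q x s); split.
    by apply: filterE => z; apply: derln => //; exact: qy.
  apply: derM; last by apply: derV => //; exact: qy.
  by apply: derMc; apply: derB; apply: derM; eassumption.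
- rewrite /= -/(A x y) -/(B x y) -/(A1 x y) -/(B1 x y).
  move: qn; rewrite /q.
  set a := A x y; set b := B x y; set a1 := A1 x y; set b1 := B1 x y => qn.
  by field.
Qed.

(** For [b <= a] it suffices that [1 + a^2 <= (1 + (a - b))^2 (1 + b^2)], since
    [1 + (a - b) <= exp (a - b)]. The bound turns uniform approximation of [g] into uniform
    approximation of [log (1 + |g|^2)]. *)
Lemma dist_ln1sqr (a b : R) : 0 <= a -> 0 <= b ->
  `|ln (1 + a ^+ 2) - ln (1 + b ^+ 2)| <= 2 * `|a - b|.
Proof.
wlog ab : a b / b <= a.
  move=> h a0 b0; case: (leP b a) => [ba|/ltW ba]; first exact: h.
  by rewrite distrC (distrC a); exact: h.
move=> a0 b0; have pos (t : R) : 0 < 1 + t ^+ 2 by rewrite ltr_pwDl// sqr_ge0.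
rewrite !ger0_norm ?subr_ge0//; last first.
  by rewrite ler_ln ?posrE// lerD2l ler_pXn2r// nnegrE.
rewrite -ln_div ?posrE// -(expRK (2 * (a - b))) ler_ln ?posrE ?expR_gt0 ?divr_gt0//.
rewrite ler_pdivrMr//.
have h : (1 + (a - b)) ^+ 2 <= expR (2 * (a - b)).
  rewrite expRM_natl ler_pXn2r ?nnegrE ?expR_ge0 ?expR_ge1Dx//; lra.
apply: (le_trans _ (ler_wpM2r (ltW (pos b)) h)).
rewrite -subr_ge0 (_ : _ - _ =
  2 * (a - b) * (1 - b + b ^+ 2) + (a - b) ^+ 2 * b ^+ 2); last by ring.
have := sqr_ge0 (b - 1); have := sqr_ge0 b; rewrite sqrrB1 => h1 h2.
rewrite addr_ge0// !mulr_ge0 ?sqr_ge0 ?subr_ge0//; lra.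
Qed.

Definition papx (g : R[i] -> R[i]) := forall r e : R, 0 < e ->
  exists p : {poly R[i]}, forall z, nc z <= r -> nc (g z - p.[z]) <= e.

Lemma subh_papx (g : R[i] -> R[i]) : papx g ->
  subh (fun x y => ln (1 + nc (g (x +i* y)) ^+ 2)).
Proof.
move=> pg r e e0; have [|p hp] := pg (2 * r) (e / 2); first by rewrite divr_gt0.
exists (fun x y => ln (1 + nc p.[x +i* y] ^+ 2)); split.
- have [c1 c2] := poly_continuous2 p => z.
  pose F (z : R * R) : R := 1 + nc p.[z.1 +i* z.2] ^+ 2.
  have h : 0 < F z by rewrite ltr_pwDl// sqr_ge0.
  have cF : {for z, continuous F}.
    have -> : F = fun z => 1 + (Re p.[z.1 +i* z.2] ^+ 2 + Im p.[z.1 +i* z.2] ^+ 2).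
      by apply/funext => w; rewrite /F nc_sqr.
    apply: cvgD; first exact: cvg_cst.
    by apply: cvgD; apply: cvgM; [exact: c1|exact: c1|exact: c2|exact: c2].
  exact: (continuous_comp cF (continuous_ln h)).
- exact: lap_ln_poly.
- move=> x y xr yr; rewrite (le_trans (dist_ln1sqr _ _)) ?nc_ge0//.
  rewrite mulrC -ler_pdivlMr// (le_trans (nc_dist _ _))// hp//.
  by rewrite (le_trans (nc_le _))//=; lra.
Qed.
End PolynomialSubharmonic.

(** * Phragmén-Lindelöf in a quadrant and in a strip *)

Section PhragmenLindelof.
Context {R : realType}.
Implicit Types (x y : R) (u V : R -> R -> R).

Lemma near_gt (x c : R) : c < x -> \forall z \near x, c < z.
Proof.
move=> cx; exists (x - c); first by rewrite /= subr_gt0.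
by move=> z /=; rewrite ltr_norml => /andP[]; lra.
Qed.

Lemma near_lt (x c : R) : x < c -> \forall z \near x, z < c.
Proof.
move=> cx; exists (c - x); first by rewrite /= subr_gt0.
by move=> z /=; rewrite ltr_norml => /andP[]; lra.
Qed.

Lemma sqrD_gt0 (a b : R) : 0 < b -> 0 < a ^+ 2 + b ^+ 2.
Proof. by move=> b0; rewrite ltr_wpDl ?sqr_ge0// exprn_gt0. Qed.

Lemma lap_ln (a b x y : R) : 0 < y + b ->
  lap (fun x y => ln ((x + a) ^+ 2 + (y + b) ^+ 2)) x y 0.
Proof.
move=> yb; pose q x y := (x + a) ^+ 2 + (y + b) ^+ 2.
have q0 x' y' : 0 < y' + b -> 0 < q x' y' by exact: sqrD_gt0.
have dx (c s : R) : der (fun s => s + c) s 1.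
  by apply: derE; [exact: derD (derI s) (derC c s)|rewrite addr0].
have qx x' y' : der (q^~ y') x' (2 * (x' + a)).
  by apply: derE; [exact: derD (derX 2 (dx a x')) (derC _ _)|rewrite /=; ring].
have qy x' y' : der (q x') y' (2 * (y' + b)).
  by apply: derE; [exact: derD (derC _ _) (derX 2 (dx b y'))|rewrite /=; ring].
have qn : q x y != 0 by rewrite gt_eqF// q0.
do 2 eexists; split.
- exists (fun s => 2 * (s + a) / q s y); split.
    by apply: filterE => z; apply: derln; [exact: q0|exact: qx].
  apply: derM; last exact: derV.
  by apply: derMc; exact: dx.
- exists (fun s => 2 * (s + b) / q x s); split.
    have := @near_gt y (- b); rewrite -subr_gt0 opprK => /(_ yb).
    apply: filterS => z zb; apply: derln; last exact: qy.
    by apply: q0; lra.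
  apply: derM; last exact: derV.
  by apply: derMc; exact: dx.
- by move: qn; rewrite /q => qn; field.
Qed.

(** The kernel is [- Im (1 / (z - t + i d))], the Poisson kernel of the upper half plane lowered by
    [d], hence smooth up to the real axis. *)
Lemma lap_poisson (t d x y : R) : 0 < y + d ->
  lap (fun x y => (y + d) / ((x - t) ^+ 2 + (y + d) ^+ 2)) x y 0.
Proof.
move=> yb; pose q x y := (x - t) ^+ 2 + (y + d) ^+ 2.
have q0 x' y' : 0 < y' + d -> 0 < q x' y' by exact: sqrD_gt0.
have dx (c s : R) : der (fun s => s + c) s 1.
  by apply: derE; [exact: derD (derI s) (derC c s)|rewrite addr0].
have qx x' y' : der (q^~ y') x' (2 * (x' - t)).
  by apply: derE; [exact: derD (derX 2 (dx (- t) x')) (derC _ _)|rewrite /=; ring].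
have qy x' y' : der (q x') y' (2 * (y' + d)).
  by apply: derE; [exact: derD (derC _ _) (derX 2 (dx d y'))|rewrite /=; ring].
have qn : q x y != 0 by rewrite gt_eqF// q0.
have qn2 : q x y ^+ 2 != 0 by rewrite expf_neq0.
do 2 eexists; split.
- exists (fun s => (y + d) * (- (2 * (s - t)) / q s y ^+ 2)); split.
    apply: filterE => z; apply: derMc; apply: derV; last exact: qx.
    by rewrite gt_eqF// q0.
  apply: derMc; apply: derM; last by apply: derV; [exact: qn2|exact: derX (qx _ _)].
  by apply: derN; apply: derMc; exact: dx.
- exists (fun s => (s + d) * (- (2 * (s + d)) / q x s ^+ 2) + (q x s)^-1 * 1); split.
    have := @near_gt y (- d); rewrite -subr_gt0 opprK => /(_ yb).
    apply: filterS => z zb; apply: derM; first exact: dx.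
    apply: derV; last exact: qy.
    by rewrite gt_eqF// q0; lra.
  apply: derD; last by apply: derM; [exact: derV (qy _ _)|exact: derC].
  apply: derM; first exact: dx.
  apply: derM; last by apply: derV; [exact: qn2|exact: derX (qy _ _)].
  by apply: derN; apply: derMc; exact: dx.
- by move: qn; rewrite /q /= => qn; field.
Qed.

(** [N log |z + 2 + 2i|^2 + c]: harmonic, of logarithmic growth, and nonnegative on the closed first
    quadrant when [N] and [c] are, because the shift puts the pole at [-2 - 2i]. *)
Definition Lg (N c x y : R) := N * ln ((x + 2) ^+ 2 + (y + 2) ^+ 2) + c.

(** A harmonic majorant is asked only for the part of [phi] on [[0, r]], one for each [r], with the
    bound [K0 / y] uniform in [r]. No limit of majorants is taken. *)
Definition majorized (K0 : R) (phi : R -> R) := forall r, 0 < r ->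
  exists V, [/\ (forall p, 0 <= p.2 -> {for p, continuous (fun p => V p.1 p.2)}),
    (forall x y, 0 < y -> lap V x y 0),
    (forall x, 0 <= x <= r -> phi x <= V x 0),
    (forall x y, 0 <= y -> 0 <= V x y) &
    (forall x y, 0 < y -> V x y <= K0 / y)].

(** Barrier for the sector [k y <= x], where it grows like [k x^2 log (x^2)] and so overtakes any
    [B x^2]. A product of harmonic functions has as Laplacian twice the scalar product of the
    gradients; here this is at most 16, and [- 4 |z|^2] compensates it. *)
Definition hsec (k x y : R) :=
  (x * y + k * (x ^+ 2 - y ^+ 2)) * ln ((x + 2) ^+ 2 + (y + 2) ^+ 2)
  - 4 * (x ^+ 2 + y ^+ 2).

Lemma lap_hsec (k x y : R) : 0 <= k <= 1 -> 0 < x -> 0 < y ->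
  exists2 l, l <= 0 & lap (hsec k) x y l.
Proof.
move=> /andP[k0 k1] x0 y0.
pose q x y := (x + 2) ^+ 2 + (y + 2) ^+ 2 : R.
have q0 x' y' : 0 < y' + 2 -> 0 < q x' y' by exact: sqrD_gt0.
have dx (c s : R) : der (fun s => s + c) s 1.
  by apply: derE; [exact: derD (derI s) (derC c s)|rewrite addr0].
have qx x' y' : der (q^~ y') x' (2 * (x' + 2)).
  by apply: derE; [exact: derD (derX 2 (dx 2 x')) (derC _ _)|rewrite /=; ring].
have qy x' y' : der (q x') y' (2 * (y' + 2)).
  by apply: derE; [exact: derD (derC _ _) (derX 2 (dx 2 y'))|rewrite /=; ring].
have qn : q x y != 0 by rewrite gt_eqF// q0//; lra.
have qp : 0 < q x y by rewrite q0//; lra.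
pose A x y := (x * y + k * (x ^+ 2 - y ^+ 2)).
have Ax x' y' : der (A^~ y') x' (y' + 2 * k * x').
  apply: derE.
    apply: derD; first exact: derM (derI _) (derC _ _).
    by apply: derMc; apply: derB; [exact: derX (derI _)|exact: derC].
  by rewrite /=; ring.
have Ay x' y' : der (A x') y' (x' - 2 * k * y').
  apply: derE.
    apply: derD; first exact: derMc (derI _).
    by apply: derMc; apply: derB; [exact: derC|exact: derX (derI _)].
  by rewrite /=; ring.
exists (4 * ((y + 2 * k * x) * (x + 2) + (x - 2 * k * y) * (y + 2)) / q x y - 16).
  rewrite subr_le0 ler_pdivrMr//.
  have kx : k * x <= x by rewrite ler_piMl// ltW.
  have ky : 0 <= k * y by rewrite mulr_ge0// ltW.
  have kxx : k * x * x <= x * x by rewrite ler_wpM2r// ltW.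
  have kyy : 0 <= k * y * y by rewrite mulr_ge0// ltW.
  have xy : 0 <= (x - y) ^+ 2 by exact: sqr_ge0.
  by rewrite /q; nra.
do 2 eexists; split.
- exists (fun s => A s y * (2 * (s + 2) / q s y) + ln (q s y) * (y + 2 * k * s)
      - 4 * (2 * s)); split.
    apply: filterE => z; apply: derB.
      apply: derM; first exact: Ax.
      by apply: derln; [apply: q0; lra|exact: qx].
    apply: derMc; apply: derE; first exact: derD (derX 2 (derI z)) (derC _ _).
    by rewrite /=; ring.
  apply: derB; last by apply: derMc; apply: derMc; exact: derI.
  apply: derD.
    apply: derM; first exact: Ax.
    by apply: derM; [apply: derMc; exact: dx|exact: derV].
  apply: derM; first by apply: derln => //; exact: qx.
  by apply: derD; [exact: derC|apply: derMc; exact: derI].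
- exists (fun s => A x s * (2 * (s + 2) / q x s) + ln (q x s) * (x - 2 * k * s)
      - 4 * (2 * s)); split.
    have := @near_gt y (- 2); rewrite -subr_gt0 opprK.
    have y2 : 0 < y + 2 by lra.
    move=> /(_ y2); apply: filterS => z zb; apply: derB.
      apply: derM; first exact: Ay.
      by apply: derln; [apply: q0; lra|exact: qy].
    apply: derMc; apply: derE; first exact: derD (derC _ _) (derX 2 (derI z)).
    by rewrite /=; ring.
  apply: derB; last by apply: derMc; apply: derMc; exact: derI.
  apply: derD.
    apply: derM; first exact: Ay.
    by apply: derM; [apply: derMc; exact: dx|exact: derV].
  apply: derM; first by apply: derln => //; exact: qy.
  by apply: derB; [exact: derC|apply: derMc; exact: derI].
- by rewrite /= /A; move: qn; rewrite /q => qn; field.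
Qed.

Lemma continuous2_sqr (f : R * R -> R) p : {for p, continuous f} ->
  {for p, continuous (fun p => f p ^+ 2)}.
Proof. by move=> cf; apply: (cvgM cf cf). Qed.

Lemma continuous2_fst (p : R * R) : {for p, continuous (fun p : R * R => p.1)}.
Proof. exact: cvg_fst. Qed.

Lemma continuous2_snd (p : R * R) : {for p, continuous (fun p : R * R => p.2)}.
Proof. exact: cvg_snd. Qed.

Lemma continuous2_ln (a b : R) (p : R * R) : 0 < p.2 + b ->
  {for p, continuous (fun p => ln ((p.1 + a) ^+ 2 + (p.2 + b) ^+ 2))}.
Proof.
move=> pb; pose F (p : R * R) : R := (p.1 + a) ^+ 2 + (p.2 + b) ^+ 2.
have Fp : 0 < F p by exact: sqrD_gt0.
have cF : {for p, continuous F}.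
  apply: cvgD; apply: continuous2_sqr; apply: cvgD.
  - exact: continuous2_fst.
  - exact: cvg_cst.
  - exact: continuous2_snd.
  - exact: cvg_cst.
exact: (continuous_comp cF (continuous_ln Fp)).
Qed.

Lemma continuous2_hsec (k : R) (p : R * R) : 0 <= p.2 ->
  {for p, continuous (fun p => hsec k p.1 p.2)}.
Proof.
move=> p2; apply: cvgB; last first.
  apply: cvgM; first exact: cvg_cst.
  by apply: cvgD; apply: continuous2_sqr;
    [exact: continuous2_fst|exact: continuous2_snd].
apply: cvgM; last by apply: continuous2_ln; lra.
apply: cvgD; first by apply: cvgM; [exact: cvg_fst|exact: cvg_snd].
apply: cvgM; first exact: cvg_cst.
by apply: cvgB; apply: continuous2_sqr;
  [exact: continuous2_fst|exact: continuous2_snd].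
Qed.

Lemma closed_le2 (F G : R * R -> R) : continuous F -> continuous G ->
  closed [set p | F p <= G p].
Proof.
move=> cF cG; rewrite (_ : mkset _ = (fun p => G p - F p) @^-1` [set x | 0 <= x]).
  apply: (@preimage_closed _ _ _ _); last exact: closed_ge.
  by move=> p *; apply: cvgB; [exact: cG|exact: cF].
by apply/seteqP; split => p /=; rewrite subr_ge0.
Qed.

(** Comparison on the truncated sector [k y <= x <= r] with [H], one summand for each side: [V] and
    [Lg] on the real axis, the harmonic [B k x y] on the ray [x = k y], where it equals [B x^2], and
    a multiple of [hsec] on the edge [x = r]. The last two summands are small at the given point
    when [k] and [t] are. *)
Lemma PL_quadrant (u : R -> R -> R) (phi : R -> R) (B N c K0 : R) :
  0 <= B -> 0 <= N -> 0 <= c -> 0 <= K0 -> subh u -> majorized K0 phi ->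
  (forall x y, 0 <= x -> 0 <= y -> u x y <= B * x ^+ 2 + Lg N c x y) ->
  (forall x, 0 <= x -> u x 0 <= phi x + Lg N c x 0) ->
  forall x y, 0 <= x -> 0 < y -> u x y <= K0 / y + Lg N c x y.
Proof.
move=> B0 N0 c0 K00 su maj ub ur x0 y0 x00 y00.
(* On the imaginary axis, which no sector contains beyond 0, the a priori bound suffices because
   [B x^2] vanishes. *)
move: x00; rewrite le_eqVlt => /predU1P[<-|x00].
  have := ub 0 y0 (lexx 0) (ltW y00); rewrite expr0n/= mulr0 add0r => /le_trans.
  by apply; rewrite lerDr divr_ge0// ltW.
apply/ler_addgt0Pr => e e0.
(* The three bounds serve the superharmonicity of [hsec k], the membership of [(x0, y0)] in the
   sector, and [B k x0 y0 <= e / 2]. *)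
pose k := Num.min 1 (Num.min (x0 / y0) (e / 2 / (B * (x0 * y0) + 1))).
have P0 : 0 < B * (x0 * y0) + 1 by rewrite ltr_wpDl// mulr_ge0// mulr_ge0// ltW.
have k0 : 0 < k by rewrite !lt_min ltr01 !divr_gt0.
have k1 : k <= 1 by rewrite ge_min lexx.
have kxy : k * y0 <= x0.
  by rewrite -ler_pdivlMr// /k ge_min; apply/orP; right; rewrite ge_min lexx.
have kB : B * k * (x0 * y0) <= e / 2.
  have : k <= e / 2 / (B * (x0 * y0) + 1).
    by rewrite /k ge_min; apply/orP; right; rewrite ge_min lexx orbT.
  rewrite ler_pdivlMr//; apply: le_trans.
  rewrite mulrDr mulr1 -[leLHS]addr0 lerD ?(ltW k0)//.
  by rewrite !mulrA (mulrC B).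
pose D := 4 * (1 + k ^- 2).
have D0 : 0 < D by rewrite mulr_gt0// addr_gt0// invr_gt0 exprn_gt0.
(* For [x >= X0] the logarithm exceeds [D / k], so [hsec] is nonnegative by [hlow]; for smaller [x]
   it is at least [- D X0^2], and [C0] makes up for that. *)
pose X0 := expR (D / k).
pose C0 := D * X0 ^+ 2.
have C00 : 0 <= C0 by rewrite mulr_ge0 ?sqr_ge0// ltW.
pose h0 := hsec k x0 y0 + C0.
pose t := e / 2 / (`|h0| + 1).
have t0 : 0 < t by rewrite !divr_gt0// ltr_wpDl.
have th0 : t * h0 <= e / 2.
  rewrite /t mulrAC ler_pdivrMr ?ltr_wpDl// ler_pM2l ?divr_gt0//.
  by rewrite (le_trans (ler_norm _))// lerDl.
(* At this abscissa [k log |z + 2 + 2i|^2 - D >= B / t], hence [t hsec >= B x^2] on the far edge;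
   [x0 + 1] keeps the given point inside. *)
pose r := expR ((D + B / t) / k) + x0 + 1.
have r0 : 0 < r by rewrite addr_gt0// addr_gt0// expR_gt0.
have x0r : x0 < r by rewrite /r; have := expR_gt0 ((D + B / t) / k); lra.
have [V [cV lV Vphi V0 VK]] := maj r r0.
have lnq0 x y : 0 <= x -> 0 <= y -> 0 <= ln ((x + 2) ^+ 2 + (y + 2) ^+ 2).
  by move=> x_ y_; apply: ln_ge0; have := sqr_ge0 x; have := sqr_ge0 y; nra.
have lnq x y v : 0 <= x -> 0 <= y -> 0 <= v -> expR v <= x ->
    v <= ln ((x + 2) ^+ 2 + (y + 2) ^+ 2).
  move=> x_ y_ v0 vx; rewrite -[leLHS]expRK ler_ln ?posrE ?expR_gt0//; last first.
    by apply: sqrD_gt0; lra.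
  by rewrite (le_trans vx)//; have := sqr_ge0 x; have := sqr_ge0 (y + 2); nra.
have hlow x y : 0 <= y -> k * y <= x ->
    x ^+ 2 * (k * ln ((x + 2) ^+ 2 + (y + 2) ^+ 2) - D) <= hsec k x y.
  move=> y_ kyx; have x_ : 0 <= x by rewrite (le_trans _ kyx)// mulr_ge0// ltW.
  rewrite /hsec mulrBr lerB//.
    rewrite mulrA ler_wpM2r ?lnq0// -subr_ge0.
    have -> : x * y + k * (x ^+ 2 - y ^+ 2) - x ^+ 2 * k = y * (x - k * y) by ring.
    by rewrite mulr_ge0// subr_ge0.
  rewrite /D mulrCA ler_pM2l// mulrDr mulr1 lerD2l ler_pdivlMr ?exprn_gt0//.
  by rewrite mulrC -exprMn ler_pXn2r// nnegrE// mulr_ge0// ltW.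
have hC x y : 0 <= y -> k * y <= x -> 0 <= hsec k x y + C0.
  move=> y_ kyx; have x_ : 0 <= x by rewrite (le_trans _ kyx)// mulr_ge0// ltW.
  have := hlow x y y_ kyx; case: (leP X0 x) => [Xx|xX].
    move=> _; rewrite addr_ge0//.
    apply: (le_trans _ (hlow x y y_ kyx)).
    rewrite mulr_ge0 ?sqr_ge0// subr_ge0 mulrC -ler_pdivrMr//.
    by apply: lnq => //; rewrite divr_ge0// ltW.
  move=> h; rewrite -lerBlDr sub0r (le_trans _ h)// /C0 -mulrN mulrC.
  have xx : x ^+ 2 <= X0 ^+ 2 by rewrite ler_pXn2r ?nnegrE ?expR_ge0// ltW.
  have x2 := sqr_ge0 x.
  have kl : 0 <= k * ln ((x + 2) ^+ 2 + (y + 2) ^+ 2) by rewrite mulr_ge0 ?lnq0// ltW.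
  by nra.
pose K := [set p : R * R | 0 <= p.2] `&` [set p | k * p.2 <= p.1] `&` [set p | p.1 <= r].
pose H x y := V x y + Lg N c x y + B * k * (x * y) + t * (hsec k x y + C0).
have LgN x y : 0 <= x -> 0 <= y -> 0 <= Lg N c x y.
  by move=> x_ y_; rewrite addr_ge0// mulr_ge0// lnq0.
have : u x0 y0 <= H x0 y0.
  apply: (@comparison _ K (r / k) u H su).
  - apply: closedI; [apply: closedI|]; apply: closed_le2 => //.
    + by move=> p; exact: cvg_cst.
    + by move=> p; exact: cvg_snd.
    + by move=> p; apply: cvgM; [exact: cvg_cst|exact: cvg_snd].
    + by move=> p; exact: cvg_fst.
    + by move=> p; exact: cvg_fst.
    + by move=> p; exact: cvg_cst.
  - move=> [x y] [[/= y_ kyx] xr].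
    have x_ : 0 <= x by rewrite (le_trans _ kyx)// mulr_ge0// ltW.
    rewrite !ger0_norm//; split.
      by rewrite (le_trans xr)// ler_pdivlMr// ler_piMr// ltW.
    by rewrite ler_pdivlMr// mulrC (le_trans kyx).
  - move=> [x y] [[/= y_ kyx] xr].
    have x_ : 0 <= x by rewrite (le_trans _ kyx)// mulr_ge0// ltW.
    apply: cvgD; last first.
      apply: cvgM; first exact: cvg_cst.
      by apply: cvgD; [exact: continuous2_hsec|exact: cvg_cst].
    apply: cvgD; last first.
      by apply: cvgM; [exact: cvg_cst|apply: cvgM; [exact: cvg_fst|exact: cvg_snd]].
    apply: cvgD; first exact: cV.
    apply: cvgD; last exact: cvg_cst.
    apply: cvgM; first exact: cvg_cst.
    by apply: continuous2_ln => /=; lra.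
  - move=> x y [[/= y_ kyx] xr].
    have x_ : 0 <= x by rewrite (le_trans _ kyx)// mulr_ge0// ltW.
    have t1 : 0 <= t * (hsec k x y + C0) by rewrite mulr_ge0 ?hC// ltW.
    have t2 : 0 <= B * k * (x * y) by rewrite !mulr_ge0// ltW.
    have t3 := V0 x y y_; have t4 := LgN _ _ x_ y_.
    move: y_ t1 t2 t3 t4; rewrite le_eqVlt => /predU1P[<-|y_] t1 t2 t3 t4.
      left; have := ur x x_; have := Vphi x; rewrite x_ xr => /(_ isT).
      by rewrite /H; move: t1 t2; lra.
    move: (kyx); rewrite le_eqVlt => /predU1P[kE|kyx'].
      left; have := ub x y x_ (ltW y_); rewrite /H.
      have -> : B * x ^+ 2 = B * k * (x * y) by rewrite -kE; ring.
      by move: t1 t3; lra.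
    move: (xr); rewrite le_eqVlt => /predU1P[xE|xr'].
      left; have := ub x y x_ (ltW y_); rewrite /H.
      have : B * x ^+ 2 <= t * hsec k x y; last first.
        have : 0 <= t * C0 by rewrite mulr_ge0// ltW.
        by rewrite (mulrDr t (hsec k x y)); move: t2 t3; lra.
      have := hlow x y (ltW y_) kyx; rewrite -(ler_pM2l t0); apply: le_trans.
      have hh : D + B / t <= k * ln ((x + 2) ^+ 2 + (y + 2) ^+ 2).
        rewrite [leRHS]mulrC -ler_pdivrMr//; apply: lnq => //; first exact: ltW.
          by rewrite divr_ge0 ?addr_ge0 ?divr_ge0// ltW.
        by rewrite xE /r; lra.
      rewrite [leRHS]mulrCA [leLHS]mulrC ler_wpM2l ?sqr_ge0//.
      by rewrite mulrC -ler_pdivrMr//; move: hh; lra.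
    right; split.
      split.
        have h1 := near_gt kyx'; have h2 := near_lt xr'.
        apply: filterS2 h1 h2 => z z1 z2.
        by split; [split|]; rewrite /= ltW.
      have h1 := near_gt y_.
      have h2 : \forall z \near y, z < x / k.
        by apply: near_lt; rewrite ltr_pdivlMr// mulrC.
      apply: filterS2 h1 h2 => z z1; rewrite ltr_pdivlMr// mulrC => z2.
      by split; [split|]; rewrite /= ltW.
    have x_0 : 0 < x by rewrite (le_lt_trans _ kyx')// mulr_ge0// ltW.
    have [|l l0 ll] := @lap_hsec k x y _ x_0 y_; first by rewrite k1 ltW.
    exists (0 + (N * 0 + 0) + B * k * 0 + t * (l + 0)).
      by rewrite !mulr0 !addr0 add0r mulr_ge0_le0// ltW.
    apply: lapD; last by apply: lapZ; apply: lapD => //; exact: lapC.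
    apply: lapD; last first.
      apply: lapZ; exists 0, 0; split; last by rewrite addr0.
        exists (fun=> y); split; last exact: derC.
        apply: filterE => z; apply: derE; first exact: derM (derI _) (derC _ _).
        by rewrite mulr0 add0r mulr1.
      exists (fun=> x); split; last exact: derC.
      by apply: filterE => z; apply: derE; [exact: derMc (derI _)|rewrite mulr1].
    apply: lapD; first exact: lV.
    apply: lapD; last exact: lapC.
    by apply: lapZ; apply: lap_ln; lra.
  - by split; [split|]; rewrite //= ltW.
rewrite /H -/h0; have := VK x0 y0 y00; move: kB th0; lra.
Qed.

(** In a strip a quadratic a priori bound is far from critical, so one harmonic barrier of degree 4
    is enough. The logarithm is centred at [-3i], outside the strip. *)
Lemma PL_strip (u : R -> R -> R) (B N c : R) : 0 <= B -> 0 <= N -> subh u ->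
  (forall x y, `|y| <= 1 ->
     u x y <= B * x ^+ 2 + (N * ln ((x + 0) ^+ 2 + (y + 3) ^+ 2) + c)) ->
  (forall x y, `|y| = 1 -> u x y <= N * ln ((x + 0) ^+ 2 + (y + 3) ^+ 2) + c) ->
  forall x y, `|y| <= 1 -> u x y <= N * ln ((x + 0) ^+ 2 + (y + 3) ^+ 2) + c.
Proof.
move=> B0 N0 su ub u1 x0 y0 y01; apply/ler_addgt0Pr => e e0.
(* [P = Re z^4 + 9]. The constant makes [P >= (x^2 - 3)^2] on [|y| <= 1], so the barrier is
   nonnegative and of quartic growth. *)
pose P x y : R := x ^+ 4 - 6 * (x ^+ 2 * y ^+ 2) + y ^+ 4 + 9.
have P0 x y : `|y| <= 1 -> (x ^+ 2 - 3) ^+ 2 <= P x y.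
  move=> y1; rewrite /P.
  have yy : y ^+ 2 <= 1.
    by rewrite -[leLHS]real_normK ?num_real// expr_le1.
  have -> : x ^+ 4 = (x ^+ 2) ^+ 2 by rewrite -exprM.
  have -> : y ^+ 4 = (y ^+ 2) ^+ 2 by rewrite -exprM.
  have := sqr_ge0 x; have := sqr_ge0 y; have := sqr_ge0 (y ^+ 2).
  move: (x ^+ 2) (y ^+ 2) yy => X Y Y1 h1 h2 h3; nra.
pose t := e / (P x0 y0 + 1).
have Pp : 0 <= P x0 y0 by rewrite (le_trans _ (P0 _ _ y01)) ?sqr_ge0.
have t0 : 0 < t by rewrite divr_gt0// ltr_wpDl.
have tP : t * P x0 y0 <= e.
  by rewrite /t mulrAC ler_pdivrMr ?ltr_wpDl// ler_pM2l// lerDl.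
(* Chosen so that [B r^2 <= t (r^2 - 3)^2], which settles the edges [|x| = r]. *)
pose r := `|x0| + 4 + B / t.
have Bt : 0 <= B / t by rewrite divr_ge0// ltW.
have r4 : 4 <= r by rewrite /r; have := normr_ge0 x0; lra.
pose K := [set p : R * R | p.2 <= 1] `&` [set p | - 1 <= p.2] `&`
  [set p | p.1 <= r] `&` [set p | - r <= p.1].
pose H x y := N * ln ((x + 0) ^+ 2 + (y + 3) ^+ 2) + c + t * P x y.
have : u x0 y0 <= H x0 y0; last by rewrite /H; move: tP; lra.
apply: (@comparison _ K r u H su).
- do 3 (try apply: closedI); apply: closed_le2 => // p;
    solve [exact: cvg_cst|exact: cvg_fst|exact: cvg_snd].
- move=> [x y] [[[/= y1 y2] x1] x2].
  by rewrite !ler_norml; split; lra.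
- move=> [x y] [[[/= y1 y2] x1] x2].
  apply: cvgD.
    apply: cvgD; last exact: cvg_cst.
    apply: cvgM; first exact: cvg_cst.
    by apply: continuous2_ln => /=; lra.
  apply: cvgM; first exact: cvg_cst.
  apply: cvgD; last exact: cvg_cst.
  apply: cvgD; last by apply: cvgM; [exact: cvg_snd|]; apply: cvgM; [exact: cvg_snd|];
    apply: cvgM; exact: cvg_snd.
  apply: cvgB; first by apply: cvgM; [exact: cvg_fst|]; apply: cvgM; [exact: cvg_fst|];
    apply: cvgM; exact: cvg_fst.
  apply: cvgM; first exact: cvg_cst.
  by apply: cvgM; [apply: cvgM; exact: cvg_fst|apply: cvgM; exact: cvg_snd].
- move=> x y [[[/= y1 y2] x1] x2].
  have y_ : `|y| <= 1 by rewrite ler_norml y1 y2.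
  have tP0 : 0 <= t * P x y.
    by rewrite mulr_ge0 ?(le_trans _ (P0 _ _ y_)) ?sqr_ge0// ltW.
  have [yE|yN] := eqVneq `|y| 1.
    by left; have := u1 x y yE; rewrite /H; lra.
  have [xE|xN] := eqVneq (x ^+ 2) (r ^+ 2).
    left; have := ub x y y_; rewrite /H.
    suff : B * x ^+ 2 <= t * P x y by lra.
    have rB : B <= r * t by rewrite -ler_pdivrMr// /r; have := normr_ge0 x0; lra.
    apply: (le_trans _ (ler_wpM2l (ltW t0) (P0 x y y_))); rewrite xE.
    have rr : 4 * r <= r ^+ 2 by rewrite expr2 ler_wpM2r//; lra.
    have Br : B * 4 <= r ^+ 2 * t.
      have : 4 * r * t <= r ^+ 2 * t by rewrite ler_wpM2r// ltW.
      by move: rB; lra.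
    by move: (r ^+ 2) rr Br => Y rr Br; nra.
  have [y_1 y_2] : y < 1 /\ - 1 < y.
    move: y1 y2; rewrite !le_eqVlt => /predU1P[yE|->].
      by move: yN; rewrite yE normr1 eqxx.
    by move=> /predU1P[yE|->//]; move: yN; rewrite -yE normrN normr1 eqxx.
  have [x_1 x_2] : x < r /\ - r < x.
    move: x1 x2; rewrite !le_eqVlt => /predU1P[xE|->].
      by move: xN; rewrite xE eqxx.
    by move=> /predU1P[xE|->//]; move: xN; rewrite -xE sqrrN eqxx.
  right; split.
    split.
      apply: filterS2 (near_lt x_1) (near_gt x_2) => z z1 z2.
      by split; [split; [split|]|] => //=; exact: ltW.
    apply: filterS2 (near_lt y_1) (near_gt y_2) => z z1 z2.
    by split; [split; [split|]|] => //=; exact: ltW.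
  exists (N * 0 + 0 + t * 0); first by rewrite !mulr0 !addr0.
  apply: lapD.
    apply: lapD; last exact: lapC.
    by apply: lapZ; apply: lap_ln; lra.
  apply: lapZ; do 2 eexists; split.
  - exists (fun s => 4 * s ^+ 3 - 6 * (y ^+ 2 * (2 * s))); split.
      apply: filterE => z; apply: derE.
        apply: derD; last exact: derC.
        apply: derD; last exact: derC.
        apply: derB; first exact: derX (derI _).
        by apply: derMc; exact: derM (derX 2 (derI _)) (derC _ _).
      by rewrite /=; ring.
    apply: derB; first by apply: derMc; exact: derX (derI _).
    by do 3 apply: derMc; exact: derI.
  - exists (fun s => 4 * s ^+ 3 - 6 * (x ^+ 2 * (2 * s))); split.
      apply: filterE => z; apply: derE.
        apply: derD; last exact: derC.
        apply: derD; last exact: derX (derI _).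
        apply: derB; first exact: derC.
        by apply: derMc; apply: derMc; exact: derX (derI _).
      by rewrite /=; ring.
    apply: derB; first by apply: derMc; exact: derX (derI _).
    by do 3 apply: derMc; exact: derI.
  - by rewrite /=; ring.
- move: y01; rewrite ler_norml => /andP[? ?]; split; [split; [split|]|] => //=;
    rewrite /r; have := ler_norm x0; have := ler_norm (- x0);
    by rewrite normrN; move: Bt; lra.
Qed.

End PhragmenLindelof.

(** * Harmonic majorants built from an integral bound on the boundary values *)

Section Majorant.
Context {R : realType}.
Implicit Types (x y : R) (u V : R -> R -> R).

Lemma continuous2_sum (I : Type) (s : seq I) (F : I -> R * R -> R) p :
  (forall i, {for p, continuous (F i)}) ->
  {for p, continuous (fun p => \sum_(i <- s) F i p)}.
Proof.
move=> h; elim: s => [|i s IH].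
  have -> : (fun p => \sum_(i <- [::]) F i p) = fun=> 0.
    by apply/funext => q; rewrite big_nil.
  exact: cvg_cst.
have -> : (fun p => \sum_(j <- i :: s) F j p) =
    fun p => F i p + \sum_(j <- s) F j p.
  by apply/funext => q; rewrite big_cons.
by apply: cvgD; [exact: h|exact: IH].
Qed.

Definition uosc (f : R -> R) := forall r e, 0 < e ->
  exists2 d, 0 < d & forall s t, 0 <= s <= r -> 0 <= t <= r ->
  `|s - t| <= d -> `|f s - f t| <= e.

(** States that the integral of [f] over [[1, +oo[] is at most [K1], through lower Riemann sums on
    uniform grids. The comparison with the weighted measure then needs the mass of one cell at a
    time and no change of variables [x = t^n]. The origin 1 is where the density in [t] starts to be
    bounded below; [[0, 1]] is handled by boundedness. *)
Definition lower_sums_le (K1 : R) (f : R -> R) :=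
  forall (d : R) (M : nat) (m : nat -> R), 0 < d <= 1 ->
  (forall j, 0 <= m j) ->
  (forall j t, (j < M)%N -> 1 + j%:R * d <= t <= 1 + j.+1%:R * d -> m j <= f t) ->
  \sum_(0 <= j < M) m j * d <= K1.

Lemma continuous2_poisson (t d : R) (p : R * R) : 0 < p.2 + d ->
  {for p, continuous (fun p => (p.2 + d) / ((p.1 - t) ^+ 2 + (p.2 + d) ^+ 2))}.
Proof.
move=> pd; apply: cvgM; first by apply: cvgD; [exact: cvg_snd|exact: cvg_cst].
apply: cvgV; first by rewrite gt_eqF// sqrD_gt0.
apply: cvgD; apply: continuous2_sqr.
  by apply: cvgB; [exact: continuous2_fst|exact: cvg_cst].
by apply: cvgD; [exact: continuous2_snd|exact: cvg_cst].
Qed.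

(** For a cell of width [d] at [t], the kernel lowered by [d] and multiplied by [2 d] is at least 1
    on [|x - t| <= d], [y = 0], and at most [2 d / y] above. Weighted by upper values of [phi] and
    summed, these kernels dominate [phi] on the axis and add up to twice an upper Riemann sum over
    [y]. One kernel with [d = 1] at 0 takes care of [[0, 1]]. *)
Lemma majorizedP (phi : R -> R) (K1 M1 : R) : 0 <= K1 -> 0 <= M1 -> uosc phi ->
  (forall t, 0 <= t -> 0 <= phi t) -> (forall t, 0 <= t <= 1 -> phi t <= M1) ->
  lower_sums_le K1 phi -> majorized (2 * M1 + 2 * (K1 + 4)) phi.
Proof.
move=> K10 M10 uphi phi0 bphi lsum r r0.
(* The grid has total length at most [r + 1], so the gap [2 e] between lower and upper values costs
   at most 2 in the sum. *)
pose e := (r + 1)^-1.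
have e0 : 0 < e by rewrite invr_gt0; lra.
have [d1 d10 hd1] := uphi (r + 3) e e0.
pose d := Num.min d1 1.
have d0 : 0 < d by rewrite lt_min d10 ltr01.
have d_1 : d <= 1 by rewrite ge_min lexx orbT.
have dd1 : d <= d1 by rewrite ge_min lexx.
pose M := (Num.trunc (r / d)).+1.
have rd0 : 0 <= r / d by rewrite divr_ge0// ltW.
have Md : M%:R * d <= r + 1.
  have : (Num.trunc (r / d))%:R <= r / d by have /andP[] := truncn_itv rd0.
  by rewrite ler_pdivlMr// /M -natr1 mulrDl mul1r; lra.
have rM : r / d < M%:R by have /andP[] := truncn_itv rd0.
pose tj (j : nat) := 1 + j%:R * d.
(* [m j] bounds [phi] from below on cell [j] and [s j] bounds it from above; both come from the
   value at the left end and the oscillation bound [e]. *)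
pose m j := Num.max (phi (tj j) - e) 0.
have m0 j : 0 <= m j by rewrite le_max lexx orbT.
pose s j := m j + 2 * e.
have s0 j : 0 <= s j by rewrite addr_ge0// mulr_ge0// ltW.
have tjin j t : (j < M)%N -> tj j <= t <= 1 + j.+1%:R * d ->
    [/\ 0 <= tj j <= r + 3, 0 <= t <= r + 3 & `|tj j - t| <= d].
  move=> jM /andP[]; rewrite /tj => t1 t2.
  have jd0 : 0 <= j%:R * d by rewrite mulr_ge0// ltW.
  have jd1 : j.+1%:R * d <= M%:R * d by rewrite ler_wpM2r ?ler_nat// ltW.
  move: t2 jd1; rewrite -natr1 mulrDl mul1r => t2 jd1.
  by rewrite ler_norml; split; apply/andP; split; move: Md t1 t2 jd0 jd1 d_1 d0 r0; clear; lra.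
have phis j t : (j < M)%N -> tj j <= t <= 1 + j.+1%:R * d -> phi t <= s j.
  move=> jM tin; have [h1 h2 h3] := tjin j t jM tin.
  have := hd1 _ _ h1 h2 (le_trans h3 dd1); rewrite ler_norml => /andP[h4 h5].
  have : phi (tj j) - e <= m j by rewrite le_max lexx.
  by rewrite /s; move: h4 h5; lra.
have summ : \sum_(0 <= j < M) m j * d <= K1.
  apply: lsum => //; first by rewrite d0.
  move=> j t jM tin; have [h1 h2 h3] := tjin j t jM tin.
  have := hd1 _ _ h1 h2 (le_trans h3 dd1); rewrite ler_norml => /andP[h4 h5].
  rewrite /m ge_max; apply/andP; split; first by move: h4 h5; lra.
  by apply: phi0; case/andP: h2.
have sums : \sum_(0 <= j < M) s j * d <= K1 + 4.
  rewrite /s; under eq_bigr do rewrite mulrDl.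
  rewrite big_split /= lerD// sumr_const_nat subn0 -(mulr_natl (2 * e * d) M).
  have -> : M%:R * (2 * e * d) = 2 * (M%:R * d) / (r + 1) by rewrite /e; ring.
  by rewrite ler_pdivrMr; [move: Md; lra|lra].
pose V x y := 2 * M1 * ((y + 1) / ((x - 0) ^+ 2 + (y + 1) ^+ 2)) +
  \sum_(0 <= j < M) 2 * (s j * d) * ((y + d) / ((x - tj j) ^+ 2 + (y + d) ^+ 2)).
have ker0 (t d' x y : R) : 0 < d' -> 0 <= y ->
    0 <= (y + d') / ((x - t) ^+ 2 + (y + d') ^+ 2).
  by move=> d'0 y0; rewrite divr_ge0 ?addr_ge0 ?sqr_ge0// ltW.
have kerle (t d' x y : R) : 0 < d' -> 0 < y ->
    (y + d') / ((x - t) ^+ 2 + (y + d') ^+ 2) <= y^-1.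
  move=> d'0 y0; have yd : 0 < y + d' by lra.
  rewrite ler_pdivrMr ?sqrD_gt0// mulrDr -[leLHS]add0r lerD//.
    by rewrite mulr_ge0 ?sqr_ge0// invr_ge0 ltW.
  by rewrite expr2 mulrA ler_peMl ?ltW// mulrC ltr_pdivlMr// mul1r ltrDl.
have kerge (t d' x : R) : 0 < d' -> `|x - t| <= d' ->
    1 <= 2 * d' * ((0 + d') / ((x - t) ^+ 2 + (0 + d') ^+ 2)).
  move=> d'0 xt; rewrite add0r mulrA ler_pdivlMr ?sqrD_gt0// mul1r.
  have : (x - t) ^+ 2 <= d' ^+ 2.
    by rewrite -[leLHS]real_normK ?num_real// ler_pXn2r// nnegrE// ltW.
  by rewrite expr2 [d' ^+ 2]expr2; lra.
have sum0 x y : 0 <= y -> 0 <= \sum_(0 <= j < M) 2 * (s j * d) *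
    ((y + d) / ((x - tj j) ^+ 2 + (y + d) ^+ 2)).
  move=> y0; apply: sumr_ge0 => j _; rewrite mulr_ge0 ?ker0//.
  by rewrite !mulr_ge0// ltW.
exists V; split.
- move=> p p0; apply: cvgD.
    apply: cvgM; first exact: cvg_cst.
    by apply: continuous2_poisson; lra.
  apply: continuous2_sum => j; apply: cvgM; first exact: cvg_cst.
  by apply: continuous2_poisson; rewrite ltr_wpDl.
- move=> x y y0; rewrite -[X in lap _ _ _ X]addr0; apply: lapD.
    by rewrite -[X in lap _ _ _ X](mulr0 (2 * M1)); apply: lapZ; apply: lap_poisson; lra.
  apply: lap_sum => j; rewrite -[X in lap _ _ _ X](mulr0 (2 * (s j * d))).
  by apply: lapZ; apply: lap_poisson; rewrite addr_gt0.
- move=> x /andP[x0 xr]; rewrite /V.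
  case: (leP x 1) => x1.
    rewrite (le_trans (bphi x _)) ?x0//.
    rewrite -[leLHS]addr0 lerD ?sum0//.
    have := @kerge 0 1 x ltr01; rewrite subr0 ger0_norm// => /(_ x1).
    rewrite mulr1 => h.
    by rewrite mulrAC -[leLHS]mul1r ler_wpM2r.
  pose j := Num.trunc ((x - 1) / d).
  have x1d : 0 <= (x - 1) / d by rewrite divr_ge0; lra.
  have /andP[j1 j2] := truncn_itv x1d.
  have jM : (j < M)%N.
    rewrite -(ltr_nat R) (le_lt_trans j1)// (le_lt_trans _ rM)//.
    by rewrite ler_pM2r ?invr_gt0//; lra.
  move: j1 j2; rewrite ler_pdivlMr// ltr_pdivrMr// => j1 j2.
  have xin : tj j <= x <= 1 + j.+1%:R * d by rewrite /tj; apply/andP; split; lra.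
  rewrite (le_trans (phis j x jM xin))//.
  rewrite -[leLHS]add0r; apply: lerD.
    by apply: mulr_ge0; [rewrite mulr_ge0|exact: ker0].
  rewrite (bigD1_seq j) ?iota_uniq//=; last by rewrite mem_index_iota.
  rewrite -[leLHS]addr0 lerD//; last first.
    apply: sumr_ge0 => i _; rewrite mulr_ge0 ?ker0//.
    by rewrite !mulr_ge0// ltW.
  have [_ _ h3] := tjin j x jM xin; rewrite distrC in h3.
  have -> : forall q : R, 2 * (s j * d) * q = s j * (2 * d * q) by move=> q; ring.
  by rewrite ler_peMr// kerge.
- move=> x y y0; apply: addr_ge0; last exact: sum0.
  by apply: mulr_ge0; [rewrite mulr_ge0|exact: ker0].
- move=> x y y0; rewrite mulrDl lerD//.
    by rewrite ler_wpM2l ?mulr_ge0// kerle.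
  rewrite (@le_trans _ _ (\sum_(0 <= j < M) 2 * (s j * d) / y))//.
    apply: ler_sum => j _; rewrite ler_wpM2l ?kerle//.
    by rewrite !mulr_ge0// ltW.
  rewrite -mulr_suml -mulr_sumr ler_wpM2r ?invr_ge0 ?(ltW y0)//.
  by rewrite ler_pM2l.
Qed.

End Majorant.

(** * From Gaussian growth in [Re z] to polynomial growth *)

Section PolynomialGrowth.
Context {R : realType}.
Implicit Types (x y : R).
Local Notation nc := (@ComplexField.Normc.normc R).

Lemma ln1sqr_logp (a : R) : 0 <= a -> ln (1 + a ^+ 2) <= 2 * logp a + ln 2.
Proof.
move=> a0; have a2 := sqr_ge0 a; rewrite /logp; case: ifPn => [a1|].
  rewrite mulr_natl -lnXn; last lra.
  rewrite -lnM ?posrE// ?exprn_gt0//; last lra.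
  rewrite ler_ln ?posrE ?mulr_gt0 ?exprn_gt0//; try lra.
  have : 1 <= a ^+ 2 by rewrite exprn_ege1// ltW.
  by lra.
rewrite -leNgt mulr0 add0r => a1; rewrite ler_ln ?posrE//; last lra.
have : a ^+ 2 <= 1 by rewrite expr_le1.
by lra.
Qed.

(** The quadrant theorem, applied to the four reflections of [u], bounds it off the real axis by
    [K0 / |y|] plus a logarithm. On [|y| = 1] this is purely logarithmic, and the strip theorem
    carries it across the axis. *)
Lemma entire_poly_bound (g : R[i] -> R[i]) (A B K0 : R) (N : nat) :
  1 <= A -> 0 <= B -> 0 <= K0 -> papx g ->
  (forall z, nc (g z) <= A * (1 + nc z) ^+ N * expR (B * complex.Re z ^+ 2)) ->
  majorized K0 (fun t => 2 * logp (nc (g t%:C))) ->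
  majorized K0 (fun t => 2 * logp (nc (g (- t)%:C))) ->
  exists A', forall z, nc (g z) <= A' * (1 + nc z) ^+ (4 * N).
Proof.
move=> A1 B0 K00 pg gb maj1 maj2.
pose u x y := ln (1 + nc (g (x +i* y)) ^+ 2).
have su : subh u by exact: subh_papx.
pose N2 : R := (2 * N)%:R; pose c := ln 2 + 2 * ln A.
have N20 : 0 <= N2 by [].
have A0 : 0 < A by lra.
have c0 : 0 <= c by rewrite addr_ge0 ?mulr_ge0 ?ln_ge0//; lra.
have n1 (x y : R) : 1 + nc (x +i* y) <= (`|x| + 2) ^+ 2 + (`|y| + 2) ^+ 2.
  have h : nc (x +i* y) <= `|x| + `|y| by exact: nc_le.
  move: h (normr_ge0 x) (normr_ge0 y); move: (nc _) `|x| `|y| => m a b h a0 b0.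
  by have := sqr_ge0 a; have := sqr_ge0 b; rewrite !sqrrD; lra.
have q0 (x y : R) : 0 < (`|x| + 2) ^+ 2 + (`|y| + 2) ^+ 2.
  by apply: sqrD_gt0; have := normr_ge0 y; lra.
have ub x y : u x y <= 2 * B * x ^+ 2 + Lg N2 c `|x| `|y|.
  have z1 : 1 <= 1 + nc (x +i* y) by rewrite lerDl nc_ge0.
  have P1 : 1 <= A * (1 + nc (x +i* y)) ^+ N * expR (B * x ^+ 2).
    rewrite !mulr_ege1 ?exprn_ege1//.
    by rewrite -expR0 ler_expR mulr_ge0// sqr_ge0.
  have P0 : 0 < A * (1 + nc (x +i* y)) ^+ N * expR (B * x ^+ 2).
    exact: lt_le_trans P1.
  have zp : 0 < 1 + nc (x +i* y) by exact: lt_le_trans z1.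
  rewrite (@le_trans _ _ (ln (2 * (A * (1 + nc (x +i* y)) ^+ N * expR (B * x ^+ 2)) ^+ 2)))//.
    have h1 : nc (g (x +i* y)) ^+ 2 <=
        (A * (1 + nc (x +i* y)) ^+ N * expR (B * x ^+ 2)) ^+ 2.
      by rewrite ler_pXn2r ?nnegrE ?nc_ge0 ?(ltW P0)//; exact: gb.
    rewrite ler_ln ?posrE; [|by rewrite ltr_pwDl// sqr_ge0|
      by rewrite mulr_gt0// exprn_gt0].
    by have := exprn_ege1 2 P1; move: h1; move: (_ ^+ 2) (_ ^+ 2) => v w; lra.
  have -> : ln (2 * (A * (1 + nc (x +i* y)) ^+ N * expR (B * x ^+ 2)) ^+ 2) =
      ln 2 + (ln A + ln (1 + nc (x +i* y)) *+ N + B * x ^+ 2) *+ 2.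
    rewrite [ln (2 * _)]lnM ?posrE ?exprn_gt0// lnXn//; congr (_ + _ *+ 2).
    rewrite [ln (_ * expR _)]lnM ?posrE ?expR_gt0 ?mulr_gt0 ?exprn_gt0//.
    by rewrite [ln (A * _)]lnM ?posrE ?exprn_gt0// expRK lnXn.
  have : ln (1 + nc (x +i* y)) <= ln ((`|x| + 2) ^+ 2 + (`|y| + 2) ^+ 2).
    by rewrite ler_ln ?posrE.
  have gen (l1 l2 l3 l4 v : R) : l1 <= l2 ->
      l4 + (l3 + l1 *+ N + B * v) *+ 2 <= 2 * B * v + (2 * N%:R * l2 + (l4 + 2 * l3)).
    move=> h; have := ler_wpM2l (ler0n R N) h.
    by rewrite -[l1 *+ N]mulr_natl -[_ *+ 2]mulr_natl; lra.
  by rewrite /Lg /N2 /c natrM => h; exact: gen.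
(* The sign of [x] decides which half of the real axis, hence which majorant, bounds the quadrant;
   the sign of [y] is removed by reflection alone. *)
have qd x y : 0 < `|y| -> u x y <= K0 / `|y| + Lg N2 c `|x| `|y|.
  move=> y0.
  have gen (v : R -> R -> R) (phi : R -> R) : subh v -> majorized K0 phi ->
      (forall x y, 0 <= x -> 0 <= y -> v x y <= 2 * B * x ^+ 2 + Lg N2 c x y) ->
      (forall x, 0 <= x -> v x 0 <= phi x + Lg N2 c x 0) ->
      v `|x| `|y| <= K0 / `|y| + Lg N2 c `|x| `|y|.
    move=> sv mv h1 h2; apply: (@PL_quadrant R v phi (2 * B)) => //.
    by rewrite mulr_ge0.
  have lg x' : 0 <= x' -> ln 2 <= Lg N2 c x' 0.
    move=> x'0; rewrite /Lg /c.
    have : 0 <= N2 * ln ((x' + 2) ^+ 2 + (0 + 2) ^+ 2).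
      by rewrite mulr_ge0// ln_ge0//; have := sqr_ge0 (x' + 2); nra.
    have : 0 <= 2 * ln A by rewrite mulr_ge0 ?ln_ge0.
    by lra.
  have ab x' y' : 0 <= x' -> 0 <= y' -> `|x'| = x' /\ `|y'| = y'.
    by move=> *; rewrite !ger0_norm.
  have l1 x' : 0 <= x' -> u x' 0 <= 2 * logp (nc (g x'%:C)) + Lg N2 c x' 0.
    move=> /lg; have := ln1sqr_logp (nc_ge0 (g x'%:C)); rewrite /u.
    rewrite -/(x'%:C); move: (ln _) (logp _) (Lg _ _ _ _) (ln 2) => v1 v2 v3 v4.
    by lra.
  have l2 x' : 0 <= x' -> u (- x') 0 <= 2 * logp (nc (g (- x')%:C)) + Lg N2 c x' 0.
    move=> /lg; have := ln1sqr_logp (nc_ge0 (g (- x')%:C)); rewrite /u.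
    rewrite -/((- x')%:C); move: (ln _) (logp _) (Lg _ _ _ _) (ln 2) => v1 v2 v3 v4.
    by lra.
  case: (ger0P x) (ger0P y) => [x0|x0] [y_0|y_0].
  - have := gen u _ su maj1; rewrite !ger0_norm//; apply => // x' y' x'0 y'0.
    by have := ub x' y'; rewrite !ger0_norm.
  - have := gen _ _ (subhNy su) maj1; rewrite (ltr0_norm y_0) (ger0_norm x0) opprK.
    apply => [x' y' x'0 y'0|x' x'0]; last by rewrite oppr0; exact: l1.
    by have := ub x' (- y'); rewrite normrN !ger0_norm.
  - have := gen _ _ (subhNx su) maj2; rewrite (ltr0_norm x0) (ger0_norm y_0) opprK.
    apply => [x' y' x'0 y'0|x' x'0]; last exact: l2.
    by have := ub (- x') y'; rewrite normrN sqrrN !ger0_norm.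
  - have := gen _ _ (subhNy (subhNx su)) maj2; rewrite (ltr0_norm x0) (ltr0_norm y_0) !opprK.
    apply => [x' y' x'0 y'0|x' x'0]; last by rewrite oppr0; exact: l2.
    by have := ub (- x') (- y'); rewrite !normrN sqrrN !ger0_norm.
pose c2 := K0 + N2 * ln 16 + c.
have q3 (x y : R) : `|y| <= 1 -> 0 < (x + 0) ^+ 2 + (y + 3) ^+ 2.
  by rewrite ler_norml => /andP[? ?]; apply: sqrD_gt0; lra.
have sq2 (x : R) : (`|x| + 2) ^+ 2 <= 2 * x ^+ 2 + 8.
  have <- : `|x| ^+ 2 = x ^+ 2 by rewrite real_normK ?num_real.
  by move: `|x| => v; have := sqr_ge0 (v - 2); rewrite sqrrB sqrrD !mulr2n; lra.
(* The logarithms of the two theorems have different centres; on the strip their arguments differ by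
   a factor of at most 16. *)
have LgS x y : `|y| <= 1 -> Lg N2 c `|x| `|y| <=
    N2 * ln ((x + 0) ^+ 2 + (y + 3) ^+ 2) + (N2 * ln 16 + c).
  move=> y1; rewrite /Lg [leRHS]addrA lerD2r -mulrDr ler_wpM2l//.
  rewrite -lnM ?posrE ?q3// ler_ln ?posrE ?mulr_gt0 ?q3 ?q0//.
  move: y1; rewrite addr0 ler_norml => /andP[y1 y2].
  have e3 : 4 <= (y + 3) ^+ 2 by nra.
  have e2 : (`|y| + 2) ^+ 2 <= 9.
    have : `|y| <= 1 by rewrite ler_norml y1 y2.
    by move: (normr_ge0 y); move: `|y| => v; nra.
  move: (sq2 x) e2 e3 (sqr_ge0 x).
  move: ((`|x| + 2) ^+ 2) ((`|y| + 2) ^+ 2) ((y + 3) ^+ 2) (x ^+ 2) => v1 v2 v3 v4.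
  by lra.
have strip x y : `|y| <= 1 -> u x y <= N2 * ln ((x + 0) ^+ 2 + (y + 3) ^+ 2) + c2.
  apply: (@PL_strip R u (2 * B)) => //; first by rewrite mulr_ge0.
    move=> {}x {}y y1; have := ub x y; have := LgS x y y1; rewrite /c2.
    move: (u x y) (Lg _ _ _ _) (N2 * ln _) (N2 * ln _) (x ^+ 2) => v1 v2 v3 v4 v5.
    by lra.
  move=> {}x {}y y1; have := @qd x y; have := LgS x y; rewrite y1 divr1.
  move=> /(_ (lexx 1)) + /(_ ltr01); rewrite /c2.
  by move: (u x y) (Lg _ _ _ _) (N2 * ln _) (N2 * ln _) => v1 v2 v3 v4; lra.
pose c3 := c2 + N2 * ln 16.
have all16 (x y : R) : u x y <= N2 * (2 * ln (1 + nc (x +i* y))) + c3.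
  have z0 : 0 < 1 + nc (x +i* y) by rewrite ltr_pwDl// nc_ge0.
  have key q : 0 < q -> q <= 16 * (1 + nc (x +i* y)) ^+ 2 ->
      N2 * ln q <= N2 * (2 * ln (1 + nc (x +i* y))) + N2 * ln 16.
    move=> qp ql; rewrite -mulrDr ler_wpM2l// mulr_natl -lnXn// addrC -lnM ?posrE ?exprn_gt0//.
    by rewrite ler_ln ?posrE ?mulr_gt0 ?exprn_gt0.
  have zz : nc (x +i* y) ^+ 2 = x ^+ 2 + y ^+ 2 by rewrite nc_sqr.
  have sq : (1 + nc (x +i* y)) ^+ 2 >= 1 + x ^+ 2 + y ^+ 2.
    move: (nc_ge0 (x +i* y)) zz; move: (nc _) (x ^+ 2) (y ^+ 2) => m v w m0.
    by rewrite sqrrD expr1n => ->; lra.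
  case: (leP `|y| 1) => y1.
    have := strip x y y1; move=> /le_trans; apply.
    have : N2 * ln ((x + 0) ^+ 2 + (y + 3) ^+ 2) <=
        N2 * (2 * ln (1 + nc (x +i* y))) + N2 * ln 16.
      apply: key; first exact: q3.
      apply: (le_trans _ (ler_wpM2l _ sq)) => //.
      rewrite addr0; move: y1; rewrite ler_norml => /andP[y1 y2].
      have : (y + 3) ^+ 2 <= 16 by nra.
      move: (sqr_ge0 x) (sqr_ge0 y); move: ((y + 3) ^+ 2) (x ^+ 2) (y ^+ 2) => v1 v2 v3.
      by lra.
    rewrite /c3.
    by move: (N2 * ln (_ + _)) (N2 * (2 * _)) (N2 * ln 16) => v1 v2 v3; lra.
  have y0 : 0 < `|y| by lra.
  have := qd x y y0; move=> /le_trans; apply.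
  have : K0 / `|y| <= K0 by rewrite ler_pdivrMr// ler_peMr// ltW.
  have : N2 * ln ((`|x| + 2) ^+ 2 + (`|y| + 2) ^+ 2) <=
      N2 * (2 * ln (1 + nc (x +i* y))) + N2 * ln 16.
    apply: key; first exact: q0.
    apply: (le_trans _ (ler_wpM2l _ sq)) => //.
    move: (sq2 x) (sq2 y) (sqr_ge0 x) (sqr_ge0 y).
    move: ((`|x| + 2) ^+ 2) ((`|y| + 2) ^+ 2) (x ^+ 2) (y ^+ 2) => v1 v2 v3 v4.
    by lra.
  rewrite /c3 /c2 /Lg.
  have : 0 <= N2 * ln 16 by rewrite mulr_ge0// ln_ge0; lra.
  move: (N2 * ln 16) => v3.
  by move: (N2 * ln (_ + _)) (N2 * (2 * _)) (K0 / _) => v1 v2 v4; lra.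
exists (expR c3) => -[x y].
have z0 : 0 < 1 + nc (x +i* y) by rewrite ltr_pwDl// nc_ge0.
have := all16 x y; rewrite -ler_expR /u lnK ?posrE ?ltr_pwDl ?sqr_ge0//.
rewrite expRD mulrA /N2 -natrM expRM_natl lnK ?posrE// mulrC.
rewrite (_ : (2 * N * 2 = 4 * N)%N); last by rewrite mulnAC.
(* [|g| <= 1 + |g|^2] replaces a square root; any polynomial degree will do. *)
apply: le_trans; have := sqr_ge0 (nc (g (x +i* y)) - 1); rewrite sqrrB1.
have := nc_ge0 (g (x +i* y)); move: (nc _) => m; move: (m ^+ 2) => m2.
by rewrite mulr2n; lra.
Qed.

End PolynomialGrowth.

(** * Cauchy estimates, and entire functions of polynomial growth are polynomials *)

Section EntirePolynomial.
Context {R : realType}.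
Implicit Types (p q : {poly R[i]}) (z w : R[i]).
Local Notation nc := (@ComplexField.Normc.normc R).

Lemma complex_prim_root m : (0 < m)%N -> exists z : R[i], m.-primitive_root z.
Proof.
pose p : {poly R[i]} := 'X^m - 1; have [r Dp] := closed_field_poly_normal p.
move=> m0; rewrite (monicP _) ?monicXnsubC // scale1r in Dp.
have rm1 : all m.-unity_root r by apply/allP=> z; rewrite -root_prod_XsubC -Dp.
have szr : (m < (size r).+1)%N.
  by rewrite -(size_prod_XsubC r id) -Dp size_XnsubC.
have [|z] := hasP (cyclic.has_prim_root m0 rm1 _ szr); last by exists z.
by rewrite -separable_prod_XsubC -Dp cyclotomic.separable_Xn_sub_1 // pnatr_eq0 -lt0n.
Qed.

Lemma unity_sum (m : nat) w : w ^+ m = 1 -> w != 1 -> \sum_(j < m) w ^+ j = 0.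
Proof.
move=> wm w1; apply/eqP; have := subrX1 w m; rewrite wm subrr => /esym/eqP.
by rewrite mulf_eq0 subr_eq0 (negbTE w1).
Qed.

Lemma poly_coef_bound p (r S : R) : 0 < r ->
  (forall z, nc z = r -> nc p.[z] <= S) -> forall l, nc p`_l * r ^+ l <= S.
Proof.
move=> r0 hS l.
have S0 : 0 <= S.
  by rewrite (le_trans (nc_ge0 p.[r%:C]))// hS// ncR gtr0_norm.
have [szl|lsz] := leqP (size p) l; first by rewrite nth_default// nc0 mul0r.
(* With [m] at least the size of [p], distinct exponents stay distinct modulo [m], so the average
   over the [m]-th roots of unity isolates one coefficient. The factor [zeta ^ (j (m - l))] plays
   the role of [zeta ^ (- j l)]. *)
pose m := size p; have m0 : (0 < m)%N by rewrite (leq_ltn_trans _ lsz).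
have [zeta hz] := complex_prim_root m0.
have zm : zeta ^+ m = 1 by exact: prim_expr_order.
have nz : nc zeta = 1.
  apply/eqP; rewrite -(@pexpr_eq1 _ _ m) ?nc_ge0//.
  by rewrite -ncX zm nc1.
have key : \sum_(j < m) p.[r%:C * zeta ^+ j] * zeta ^+ (j * (m - l)) =
    m%:R * (p`_l * r%:C ^+ l).
  under eq_bigr do rewrite horner_coef mulr_suml.
  rewrite exchange_big /= (bigD1 (Ordinal lsz)) //= [X in _ + X]big1 ?addr0.
    under eq_bigr => j _.
      rewrite exprMn -!mulrA -exprM -exprD -mulnDr subnKC ?(ltnW lsz)//.
      rewrite mulnC exprM zm expr1n mulr1; over.
    by rewrite sumr_const card_ord mulr_natl.
  move=> i il.
  under eq_bigr do rewrite exprMn -!mulrA -exprM -exprD -mulnDr mulnC exprM.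
  rewrite -mulr_sumr -mulr_sumr unity_sum ?mulr0//.
    by rewrite -exprM mulnC exprM zm expr1n.
  rewrite -(prim_order_dvd hz) addnBA ?(ltnW lsz)// addnC.
  apply/negP => /dvdnP [t tE].
  have iN : nat_of_ord i <> l.
    by move=> h; case/eqP: il; apply/val_inj.
  have {tE} : (i + m = l + t * m)%N.
    by move: tE (lsz : (l < m)%N); move: (t * m)%N => v; lia.
  have : (i < m)%N by exact: ltn_ord.
  move: (lsz : (l < m)%N) iN; clear; move: (nat_of_ord i) m => j m lm jl jm.
  case: t => [|[|t]]; rewrite ?mulSn ?mul0n => h.
  - by lia.
  - by apply: jl; lia.
  - by move: h; move: (t * m)%N => v; lia.
have mR : (0 : R) < m%:R by rewrite ltr0n.
rewrite -(ler_pM2l mR).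
have -> : m%:R * (nc p`_l * r ^+ l) = nc (m%:R * (p`_l * r%:C ^+ l)).
  rewrite !ncM ncX ncR (gtr0_norm r0); congr (_ * _).
  by rewrite -(rmorph_nat (real_complex R)) ncR ger0_norm.
rewrite -key (le_trans (nc_sum _ _ _))//.
rewrite (@le_trans _ _ (\sum_(j < m) S))//; last by rewrite sumr_const card_ord mulr_natl.
apply: ler_sum => j _; rewrite ncM ncX nz expr1n mulr1 hS//.
by rewrite ncM ncX nz expr1n mulr1 ncR gtr0_norm.
Qed.

(** The intervals of radius [1 / (j + 1)] around the [a j] meet pairwise, so the supremum of their
    left ends lies in all of them. *)
Lemma approximating_limit (a : nat -> R) :
  (forall i j, `|a i - a j| <= i.+1%:R^-1 + j.+1%:R^-1) ->
  exists l, forall j, `|a j - l| <= j.+1%:R^-1.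
Proof.
move=> h; pose S := [set a j - j.+1%:R^-1 | j in setT].
have ubS i : ubound S (a i + i.+1%:R^-1).
  move=> _ [j _ <-]; have := h i j; rewrite ler_norml => /andP[].
  by move: (i.+1%:R^-1 : R) (j.+1%:R^-1 : R) => u v; lra.
exists (sup S) => j.
have hS : has_sup S by split; [exists (a 0%N - 1%:R^-1); exists 0%N|exists (a 0%N + 1%:R^-1); exact: ubS].
have l1 : a j - j.+1%:R^-1 <= sup S by apply: sup_ubound => //; [case: hS|exists j].
have l2 : sup S <= a j + j.+1%:R^-1 by apply: ge_sup => //; case: hS.
by move: l1 l2; rewrite ler_norml; move: (j.+1%:R^-1 : R) => u; lra.
Qed.

Lemma geometric_tail (x : R) (a b : nat) : 0 <= x <= 2^-1 ->
  \sum_(a <= l < b) x ^+ l <= 2 * x ^+ a.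
Proof.
move=> /andP[x0 x1]; case: (leqP a b) => [ab|/ltnW ba]; last first.
  by rewrite big_geq// mulr_ge0// exprn_ge0.
rewrite -{1}[a]add0n big_addn.
under eq_bigr do rewrite exprD.
rewrite -mulr_suml ler_wpM2r ?exprn_ge0// big_mkord.
have := subrX1 x (b - a); set s := \sum_(i < _) _ => h.
have s0 : 0 <= s by apply: sumr_ge0 => i _; rewrite exprn_ge0.
have : 0 <= x ^+ (b - a) by rewrite exprn_ge0.
nra.
Qed.

(** Let [P j] approximate [g] on the disc of radius [r = j + 1]. By the Cauchy estimate on the unit
    circle each coefficient converges in [j]. By the estimate on the circle of radius [r], the
    coefficient of degree [l] is [O(r^(N - l))], so the part of degree above [N] is [O(1 / r)] at a
    fixed point. *)
Lemma entire_poly_growth (g : R[i] -> R[i]) (A : R) (N : nat) : papx g ->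
  (forall z, nc (g z) <= A * (1 + nc z) ^+ N) ->
  exists q, forall z, g z = q.[z].
Proof.
move=> pg gb.
have A0 : 0 <= A.
  by have := gb 0; rewrite nc0 addr0 expr1n mulr1; apply: le_trans; exact: nc_ge0.
have ex (j : nat) : exists p : {poly R[i]}, forall z, nc z <= j.+1%:R ->
    nc (g z - p.[z]) <= j.+1%:R^-1 by exact: pg.
have /(@choice _ _ _)[P hP] := ex.
have cau i j l : nc ((P i)`_l - (P j)`_l) <= i.+1%:R^-1 + j.+1%:R^-1.
  have h := @poly_coef_bound (P i - P j) 1 (i.+1%:R^-1 + j.+1%:R^-1) ltr01 _ l.
  rewrite expr1n mulr1 coefB in h; apply: h => z z1.
  have hi k : nc z <= k.+1%:R by rewrite z1 ler1n.
  rewrite hornerD hornerN.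
  have -> : (P i).[z] - (P j).[z] = (g z - (P j).[z]) - (g z - (P i).[z]) by ring.
  have h1 := hP i z (hi i); have h2 := hP j z (hi j).
  by rewrite (le_trans (ncB _ _))// (le_trans (lerD h2 h1))// addrC.
have lim l : exists c : R[i], forall j, nc ((P j)`_l - c) <= 2 * j.+1%:R^-1.
  have [|x hx] := @approximating_limit (fun j => complex.Re (P j)`_l).
    move=> i j; apply: le_trans (cau i j l); apply: le_trans (nc_Re _).
    by case: (P i)`_l (P j)`_l => ? ? [].
  have [|y hy] := @approximating_limit (fun j => complex.Im (P j)`_l).
    move=> i j; apply: le_trans (cau i j l); apply: le_trans (nc_Im _).
    by case: (P i)`_l (P j)`_l => ? ? [].
  exists (x +i* y) => j; apply: (le_trans (nc_le _)).
  have := hx j; have := hy j; case: (P j)`_l => a b /=.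
  move: (j.+1%:R^-1 : R) => v; have -> : a + - x = a - x by [].
  by move: `|a - x| `|b - y| => v1 v2; lra.
have /(@choice _ _ _)[c hc] := lim.
exists (\poly_(l < N.+1) c l) => z; apply/eqP; rewrite -subr_eq0; apply/eqP.
apply: nc_eq0; apply/eqP; rewrite eq_le nc_ge0 andbT.
(* The three summands bound, up to the factor [1 / r], the approximation error, the error in the
   first [N + 1] coefficients, and the tail. *)
pose T := 1 + (\sum_(l < N.+1) 2 * nc z ^+ l) + 2 * (A * 2 ^+ N + 1) * nc z ^+ N.+1.
have T0 : 0 <= T.
  rewrite !addr_ge0 ?mulr_ge0 ?addr_ge0 ?exprn_ge0 ?nc_ge0 ?mulr_ge0 ?exprn_ge0//.
  by apply: sumr_ge0 => l _; rewrite mulr_ge0 ?exprn_ge0 ?nc_ge0.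
suff key j : 2 * nc z <= j.+1%:R ->
    nc (g z - (\poly_(l < N.+1) c l).[z]) <= T / j.+1%:R.
  apply/ler_addgt0Pr => e e0; rewrite add0r.
  pose j := Num.trunc (2 * nc z + T / e).
  have j0 : 0 <= 2 * nc z + T / e.
    by apply: addr_ge0; [rewrite mulr_ge0 ?nc_ge0|rewrite divr_ge0// ltW].
  have /andP[_ /ltW jj] := truncn_itv j0.
  have Te : 0 <= T / e by rewrite divr_ge0// ltW.
  have nz := nc_ge0 z.
  apply: (le_trans (key j _)); first by apply: le_trans jj; lra.
  rewrite ler_pdivrMr// mulrC -ler_pdivrMr//; apply: le_trans jj; lra.
move=> zj; pose r : R := j.+1%:R.
have r1 : 1 <= r by rewrite ler1n.
have r0 : 0 < r by lra.
have cb l : nc (P j)`_l * r ^+ l <= A * (1 + r) ^+ N + 1.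
  apply: poly_coef_bound => // w wr.
  have -> : (P j).[w] = g w - (g w - (P j).[w]) by ring.
  rewrite (le_trans (ncB _ _))// lerD//; first by rewrite -wr gb.
  rewrite (le_trans (hP j w _)) ?wr//.
  by rewrite invf_le1.
have Ar : A * (1 + r) ^+ N + 1 <= (A * 2 ^+ N + 1) * r ^+ N.
  rewrite mulrDl mul1r lerD ?exprn_ege1//.
  by rewrite -mulrA ler_wpM2l// -exprMn lerXn2r ?nnegrE//; lra.
pose M := maxn N.+1 (size (P j)).
have PE : (P j).[z] = \sum_(0 <= l < N.+1) (P j)`_l * z ^+ l +
    \sum_(N.+1 <= l < M) (P j)`_l * z ^+ l.
  rewrite -big_cat_nat ?leq_maxl//= big_mkord; apply: horner_coef_wide.
  exact: leq_maxr.
have -> : g z - (\poly_(l < N.+1) c l).[z] = (g z - (P j).[z]) +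
   (\sum_(0 <= l < N.+1) ((P j)`_l - c l) * z ^+ l +
    \sum_(N.+1 <= l < M) (P j)`_l * z ^+ l).
  rewrite PE horner_poly -(big_mkord xpredT (fun l => c l * z ^+ l)).
  under [X in _ = _ + (X + _)]eq_bigr do rewrite mulrBl.
  by rewrite sumrB; ring.
apply: (le_trans (ncD _ _)); rewrite /T -addrA mulrDl mul1r lerD//.
  by apply: hP; have := nc_ge0 z; lra.
apply: (le_trans (ncD _ _)); rewrite mulrDl lerD//.
  apply: (le_trans (nc_sum _ _ _)); rewrite big_mkord mulr_suml.
  apply: ler_sum => l _; rewrite ncM ncX mulrAC ler_wpM2r ?exprn_ge0 ?nc_ge0//.
apply: (le_trans (nc_sum _ _ _)).
rewrite (@le_trans _ _ (\sum_(N.+1 <= l < M)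
    ((A * 2 ^+ N + 1) * r ^+ N) * (nc z / r) ^+ l))//.
  apply: ler_sum => l _; rewrite ncM ncX expr_div_n [leRHS]mulrA.
  rewrite ler_pdivlMr ?exprn_gt0// [leLHS]mulrAC ler_wpM2r ?exprn_ge0 ?nc_ge0//.
  exact: le_trans (cb l) Ar.
rewrite -mulr_sumr.
have zr : 0 <= nc z / r <= 2^-1.
  rewrite divr_ge0 ?nc_ge0 ?(ltW r0)//= ler_pdivrMr//.
  by move: zj; rewrite -/r; lra.
have A2 : 0 <= (A * 2 ^+ N + 1) * r ^+ N.
  by rewrite mulr_ge0 ?addr_ge0 ?mulr_ge0 ?exprn_ge0// ltW.
apply: (le_trans (ler_wpM2l A2 (geometric_tail _ _ zr))).
rewrite expr_div_n [r ^+ N.+1]exprSr.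
have rN : r ^+ N != 0 by rewrite expf_neq0// gt_eqF.
have rn : r != 0 by rewrite gt_eqF.
have -> : (A * 2 ^+ N + 1) * r ^+ N * (2 * (nc z ^+ N.+1 / (r ^+ N * r))) =
  2 * (A * 2 ^+ N + 1) * nc z ^+ N.+1 / r.
  clear -rn rN; clearbody r; move: (r ^+ N) (nc z ^+ N.+1) (2 ^+ N) rN => v w t vn.
  by field; rewrite ?vn ?rn.
by [].
Qed.

(** Induction on [p X + c], along the positive axis only, since that is where the log condition will
    be contradicted. *)
Lemma poly_unbounded q : (1 < size q)%N -> forall C : R,
  exists2 T, 1 <= T & forall t, T <= t -> C <= nc q.[t%:C].
Proof.
elim/poly_ind: q => [|p c IH]; first by rewrite size_poly0.
rewrite size_MXaddC; case: ifPn => // + p0 C.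
rewrite ltnS size_poly_gt0 in p0 *.
have [sz1|szp] := leqP (size p) 1.
  move=> _; have /size_poly1P [a a0 pE] : size p == 1%N.
    by rewrite eqn_leq sz1 size_poly_gt0.
  have na : 0 < nc a.
    by rewrite lt_neqAle nc_ge0 andbT; apply: contra a0 => /eqP h; apply/eqP; exact: nc_eq0.
  exists (1 + (`|C| + nc c) / nc a).
    by rewrite lerDl divr_ge0 ?addr_ge0 ?nc_ge0.
  move=> t tT; rewrite hornerMXaddC pE hornerC.
  have t0 : 0 <= t.
    by apply: le_trans tT; rewrite addr_ge0 ?divr_ge0 ?addr_ge0 ?nc_ge0.
  have h : (`|C| + nc c) <= nc a * t.
    by rewrite mulrC -ler_pdivrMr//; move: tT; lra.
  have : nc (a * t%:C) <= nc (a * t%:C + c) + nc c.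
    by rewrite -{1}(addrK c (a * t%:C)); exact: ncB.
  by rewrite ncM ncR (ger0_norm t0); have := ler_norm C; lra.
move=> _; have [T T1 hT] := IH szp 1.
exists (T + `|C| + nc c); first by rewrite -addrA ler_wpDr// addr_ge0 ?nc_ge0.
move=> t tT; have nC := normr_ge0 C; have n_c := nc_ge0 c.
have t0 : 0 <= t by lra.
have pt : 1 <= nc p.[t%:C] by apply: hT; lra.
rewrite hornerMXaddC.
have : nc (p.[t%:C] * t%:C) <= nc (p.[t%:C] * t%:C + c) + nc c.
  by rewrite -{1}(addrK c (p.[t%:C] * t%:C)); exact: ncB.
rewrite ncM ncR (ger0_norm t0); have := ler_norm C.
have : t <= nc p.[t%:C] * t by rewrite ler_peMl.
by lra.
Qed.

Lemma poly_lipschitz p (r : R) : exists2 L, 0 <= L & forall z w,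
  nc z <= r -> nc w <= r -> nc (p.[z] - p.[w]) <= L * nc (z - w).
Proof.
elim/poly_ind: p => [|p c [L L0 IH]].
  by exists 0 => // z w _ _; rewrite !horner0 subr0 nc0 mul0r.
case: (ltP r 0) => r0.
  by exists 0 => // z w zr _; have := nc_ge0 z; lra.
exists (L * r + (nc p.[0] + L * r)).
  by rewrite addr_ge0 ?addr_ge0 ?mulr_ge0 ?nc_ge0.
move=> z w zr wr; rewrite !hornerMXaddC.
have -> : p.[z] * z + c - (p.[w] * w + c) = (p.[z] - p.[w]) * z + p.[w] * (z - w).
  by ring.
have n0 : nc 0 <= r by rewrite nc0.
have pw : nc p.[w] <= nc p.[0] + L * r.
  have -> : p.[w] = p.[0] + (p.[w] - p.[0]) by ring.
  rewrite (le_trans (ncD _ _))// lerD2l (le_trans (IH _ _ wr n0))// subr0.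
  by rewrite ler_wpM2l.
rewrite (le_trans (ncD _ _))// !ncM [leRHS]mulrDl lerD//.
  rewrite (le_trans (ler_wpM2r (nc_ge0 _) (IH z w zr wr)))// mulrAC.
  by rewrite ler_wpM2r ?nc_ge0// ler_wpM2l.
by rewrite ler_wpM2r ?nc_ge0.
Qed.

Lemma papx_oscillation (g : R[i] -> R[i]) (r e : R) : papx g -> 0 < e ->
  exists2 d, 0 < d & forall z w, nc z <= r -> nc w <= r -> nc (z - w) <= d ->
  nc (g z - g w) <= e.
Proof.
move=> pg e0; have [|p hp] := pg r (e / 3); first by rewrite divr_gt0.
have [L L0 hL] := poly_lipschitz p r.
exists (e / 3 / (L + 1)); first by rewrite !divr_gt0// ltr_wpDl.
move=> z w zr wr zw.
have -> : g z - g w = (g z - p.[z]) + ((p.[z] - p.[w]) - (g w - p.[w])) by ring.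
apply: (le_trans (ncD _ _)).
have h1 := ncB (p.[z] - p.[w]) (g w - p.[w]).
have h2 := hp z zr; have h3 := hp w wr; have h4 := hL z w zr wr.
have h5 : L * nc (z - w) <= e / 3.
  apply: (@le_trans _ _ ((L + 1) * nc (z - w))).
    by rewrite ler_wpM2r ?nc_ge0// lerDl.
  by rewrite mulrC -ler_pdivlMr// ltr_wpDl.
by lra.
Qed.

Lemma logp_ge0 (a : R) : 0 <= logp a.
Proof. by rewrite /logp; case: ifPn => // a1; rewrite ln_ge0// ltW. Qed.

Lemma logp_lipschitz (a b : R) : `|logp a - logp b| <= `|a - b|.
Proof.
wlog ab : a b / b <= a.
  move=> h; case: (leP b a) => [ba|/ltW ba]; first exact: h.
  by rewrite distrC (distrC a); exact: h.
rewrite (@ger0_norm _ (a - b)) ?subr_ge0// /logp.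
case: (ltP 1 b) => b1; case: (ltP 1 a) => a1; last by rewrite subrr normr0 subr_ge0.
- rewrite ger0_norm ?subr_ge0 ?ler_ln ?posrE//; try lra.
  rewrite -ln_div ?posrE//; try lra.
  have -> : a / b = 1 + (a / b - 1) by ring.
  have ab1 : 1 <= a / b by rewrite ler_pdivlMr; lra.
  apply: (le_trans (le_ln1Dx _)); first lra.
  rewrite -[X in _ - X](@divff _ b) -?mulrBl; last by rewrite gt_eqF//; lra.
  by rewrite ler_pdivrMr ?ler_peMr//; lra.
- by lra.
- rewrite subr0 ger0_norm ?ln_ge0 ?(ltW a1)//.
  have -> : a = 1 + (a - 1) by ring.
  by apply: (le_trans (le_ln1Dx _)); lra.
Qed.

End EntirePolynomial.

(** * The Gamma function and Gaussian-type integrals *)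

Section GammaFunction.
Context {R : realType}.
Implicit Types (s t a b c p : R).
Local Notation mu := (@lebesgue_measure R).

Lemma powR_continuous p (x : R) : 0 < x -> {for x, continuous (fun t => t `^ p)}.
Proof.
move=> x0; have h : der (fun t => t `^ p) x (p * x `^ (p - 1)).
  exact: is_derive1_powR.
exact: der_continuous h.
Qed.

(** This is [ln u < u] at [u = e t / s]. *)
Lemma powR_le_expR s e t : 0 < s -> 0 < e -> 0 < t ->
  t `^ s <= expR (s * ln (s / e)) * expR (e * t).
Proof.
move=> s0 e0 t0; rewrite /powR gt_eqF// -expRD ler_expR.
have tE : t = (s / e) * (e * t / s) by field; rewrite ?gt_eqF.
have h0 : 0 < e * t / s by rewrite divr_gt0 ?mulr_gt0.
have h1 : 0 < s / e by rewrite divr_gt0.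
rewrite {1}tE lnM ?posrE// mulrDr lerD2l.
rewrite mulrC -ler_pdivlMr//; exact: ltW (ln_sublinear h0).
Qed.

Definition gw s t : R := t `^ (s - 1) * expR (- t).

Lemma gw_ge0 s t : 0 <= gw s t.
Proof. by rewrite mulr_ge0 ?powR_ge0 ?expR_ge0. Qed.

Lemma measurable_gw s D : measurable_fun D (gw s).
Proof.
apply: measurable_funTS; apply: measurable_funM; first exact: measurable_powR.
by apply: measurableT_comp => //; exact: measurable_funN.
Qed.

Lemma gw_continuous s t : 0 < t -> {for t, continuous (gw s)}.
Proof.
move=> t0; apply: cvgM; first exact: powR_continuous.
apply: (@continuous_comp _ _ _ -%R expR); first exact: opp_continuous.
exact: continuous_expR.
Qed.

Lemma measurable_pos : measurable [set t : R | 0 < t].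
Proof.
rewrite (_ : mkset _ = `]0, +oo[%classic)//.
by apply/seteqP; split => x /=; rewrite in_itv/= andbT.
Qed.

(** Integration by parts and substitution hold on compact intervals, so integrals over the open
    half-line are taken as limits along this exhaustion. *)
Definition compacta (N : nat) : set R := `[N.+1%:R^-1, N.+1%:R]%classic.

Lemma compacta_lt N : (0 : R) < N.+1%:R^-1 /\ (N.+1%:R^-1 : R) <= N.+1%:R.
Proof.
split; first by rewrite invr_gt0.
by rewrite (@le_trans _ _ 1) ?invf_le1 ?ler1n.
Qed.

Lemma bigcup_compacta : \bigcup_N compacta N = [set t : R | 0 < t].
Proof.
apply/seteqP; split => t /=.
  move=> [N _]; rewrite /compacta /= in_itv/= => /andP[h _].
  by apply: lt_le_trans h; rewrite invr_gt0.
move=> t0; pose N := maxn (Num.trunc t) (Num.trunc t^-1).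
have /andP[_ h1] := truncn_itv (ltW t0).
have ti0 : 0 <= t^-1 by rewrite invr_ge0 ltW.
have /andP[_ h2] := truncn_itv ti0.
exists N => //; rewrite /compacta /= in_itv/=; apply/andP; split.
  rewrite -(invrK t) lef_pV2 ?posrE ?invr_gt0//.
  by apply: (le_trans (ltW h2)); rewrite ler_nat ltnS leq_maxr.
by apply: (le_trans (ltW h1)); rewrite ler_nat ltnS leq_maxl.
Qed.

Lemma nondecreasing_compacta : nondecreasing_seq compacta.
Proof.
move=> m n mn; apply/subsetPset => t; rewrite /compacta /= !in_itv/= => /andP[h1 h2].
apply/andP; split; last by apply: (le_trans h2); rewrite ler_nat.
by apply: le_trans h1; rewrite lef_pV2 ?posrE// ler_nat.
Qed.

Lemma exhaustion (f : R -> R) : measurable_fun setT f -> (forall t, 0 <= f t) ->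
  (\int[mu]_(x in compacta N) (f x)%:E @[N --> \oo] -->
  \int[mu]_(x in [set t | (0 < t)%R]) (f x)%:E)%E.
Proof.
move=> mf f0; rewrite -bigcup_compacta.
apply: ge0_nondecreasing_set_cvg_integral.
- exact: nondecreasing_compacta.
- by move=> N; exact: measurable_itv.
- by move=> N; apply/measurable_EFinP; exact: measurable_funTS.
- by move=> N x _; rewrite lee_fin.
Qed.

(** Each boundary term is added on the side where it is positive, so that no extended reals are
    subtracted before finiteness is known. *)
Lemma gw_parts s a b : 0 < s -> 0 < a -> a <= b ->
  (\int[mu]_(x in `[a, b]) (gw (s + 1) x)%:E + (b `^ s * expR (- b))%:E =
   s%:E * \int[mu]_(x in `[a, b]) (gw s x)%:E + (a `^ s * expR (- a))%:E)%E.
Proof.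
move=> s0 a0; rewrite le_eqVlt => /predU1P[<-|ab].
  by rewrite set_itv1 !integral_set1 mule0.
have pos x : x \in `[a, b] -> 0 < x.
  by rewrite in_itv/= => /andP[h _]; exact: lt_le_trans h.
have poso x : x \in `]a, b[ -> 0 < x by move=> /subset_itv_oo_cc/pos.
have dp x : 0 < x -> der (fun t => t `^ s) x (s * x `^ (s - 1)).
  by move=> x0; exact: is_derive1_powR.
have de x : der (fun t => - expR (- t)) x (expR (- x)).
  by apply: derE; [apply: derN; apply: derexp; apply: derN; exact: derI|rewrite mulN1r opprK].
have cw (f : R -> R) : (forall x, 0 < x -> {for x, continuous f}) ->
    {within `[a, b], continuous f}.
  by move=> cf; apply: continuous_in_subspaceT => x; rewrite inE/= => /pos; exact: cf.
have LR (f : R -> R) df : (forall x, 0 < x -> der f x (df x)) ->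
    derivable_oo_LRcontinuous f a b.
  move=> hf; split.
  - by move=> x /poso /hf [].
  - by apply: cvg_at_right_filter; exact: der_continuous (hf a a0).
  - by apply: cvg_at_left_filter; exact: der_continuous (hf b (lt_trans a0 ab)).
have ig : mu.-integrable `[a, b] (EFin \o gw s).
  apply: continuous_compact_integrable; first exact: segment_compact.
  by apply: cw => x; exact: gw_continuous.
have parts := @integration_by_parts R (fun t => t `^ s) (fun t => - expR (- t))
  (fun t => s * t `^ (s - 1)) (fun t => expR (- t)) a b ab.
have -> : (\int[mu]_(x in `[a, b]) (gw (s + 1) x)%:E =
    \int[mu]_(x in `[a, b]) (x `^ s * expR (- x))%:E)%E.
  by apply: eq_integral => x _; rewrite /gw addrK.
rewrite parts; last 6 first.
- by apply: cw => x x0; apply: cvgM; [exact: cvg_cst|exact: powR_continuous].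
- exact: LR dp.
- by move=> x /poso /dp [_ <-]; rewrite derive1E.
- apply: cw => x _; apply: (@continuous_comp _ _ _ -%R expR); first exact: opp_continuous.
  exact: continuous_expR.
- by apply: (@LR _ (fun x => expR (- x))) => x _.
- by move=> x _; have [_ <-] := de x; rewrite derive1E.
have -> : (\int[mu]_(x in `[a, b]) (s * x `^ (s - 1) * - expR (- x))%:E =
    (- s)%:E * \int[mu]_(x in `[a, b]) (gw s x)%:E)%E.
  rewrite -integralZl//; apply: eq_integral => x _.
  by rewrite -EFinM /gw mulrN mulNr mulrA.
have /fineK <- : (\int[mu]_(x in `[a, b]) (gw s x)%:E)%E \is a fin_num.
  exact: integrable_fin_num.
by rewrite -!EFinM -!EFinB -!EFinD; congr EFin; ring.
Qed.

Lemma gw_integrable_gt1 s : 1 < s -> (\int[mu]_(x in [set t | (0 < t)%R]) (gw s x)%:E < +oo)%E.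
Proof.
move=> s1; pose C := expR ((s - 1) * ln ((s - 1) / 2^-1)).
apply: (@le_lt_trans _ _ (\int[mu]_(x in [set t | (0 < t)%R])
    ((2 * C) * exponential_pdf 2^-1 x)%:E)%E).
  apply: ge0_le_integral => //.
  - exact: measurable_pos.
  - by move=> x _; rewrite lee_fin gw_ge0.
  - by apply/measurable_EFinP; exact: measurable_gw.
  - apply/measurable_EFinP; apply: measurable_funTS; apply: measurable_funM => //.
    exact: measurable_exponential_pdf.
  - move=> x /= x0; rewrite lee_fin /exponential_pdf patchE mem_set; last first.
      by rewrite /= in_itv/= (ltW x0).
    have i2 : (0 : R) < 2^-1 by [].
    have := @powR_le_expR (s - 1) 2^-1 x; rewrite subr_gt0 => /(_ s1 i2 x0) h.
    rewrite /gw (le_trans (ler_wpM2r (expR_ge0 _) h))//.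
    have hE : expR (2^-1 * x) * expR (- x) = expR (- 2^-1 * x).
      by rewrite -expRD; congr expR; field.
    rewrite -[leLHS]mulrA hE -/C.
    have -> : 2 * C * (2^-1 * expR (- 2^-1 * x)) = C * expR (- 2^-1 * x) by field.
    by [].
rewrite (@le_lt_trans _ _ (\int[mu]_x ((2 * C) * exponential_pdf 2^-1 x)%:E)%E)//.
  apply: ge0_subset_integral => //.
  - exact: measurable_pos.
  - apply/measurable_EFinP; apply: measurable_funM => //.
    exact: measurable_exponential_pdf.
  - by move=> x _; rewrite lee_fin mulr_ge0 ?mulr_ge0 ?expR_ge0 ?exponential_pdf_ge0.
have i2 : (0 : R) < 2^-1 by [].
under eq_integral do rewrite EFinM.
rewrite integralZl//; last exact: integrable_exponential_pdf.
by rewrite integral_exponential_pdf// mule1 ltry.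
Qed.

(** Near 0 the integrand may be unbounded; integration by parts on the compacta bounds its integral
    by the one for [s + 1 > 1] plus a bounded boundary term, and the case above 1 is dominated by an
    exponential density of rate 1/2. *)
Lemma gw_integrable s : 0 < s -> (\int[mu]_(x in [set t | (0 < t)%R]) (gw s x)%:E < +oo)%E.
Proof.
move=> s0; have s1 : 1 < s + 1 by rewrite ltrDr.
pose C := expR (s * ln s).
have gC b : 0 < b -> b `^ s * expR (- b) <= C.
  move=> b0; have := powR_le_expR s0 ltr01 b0; rewrite divr1 mul1r.
  by rewrite expRN ler_pdivrMr ?expR_gt0.
pose B := (s^-1%:E * (\int[mu]_(x in [set t | (0 < t)%R]) (gw (s + 1) x)%:E + C%:E))%E.
apply: (@le_lt_trans _ _ B); last first.
  by rewrite lte_mul_pinfty ?lee_fin ?invr_ge0 ?(ltW s0)// lte_add_pinfty ?ltry// gw_integrable_gt1.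
have cv := exhaustion (@measurable_gw s setT) (gw_ge0 s).
rewrite -(cvg_lim _ cv)//; apply: lime_le; first by apply/cvg_ex; eexists; exact: cv.
apply: nearW => N; have [a0 ab] := compacta_lt N.
have := gw_parts s0 a0 ab; rewrite -/(compacta N) => parts.
rewrite /B lee_pdivlMl//; apply: (@le_trans _ _ (s%:E * \int[mu]_(x in compacta N) (gw s x)%:E
   + (N.+1%:R^-1 `^ s * expR (- N.+1%:R^-1))%:E)%E).
  by rewrite leeDl// lee_fin mulr_ge0 ?powR_ge0 ?expR_ge0.
rewrite -parts leeD ?lee_fin ?gC//; apply: ge0_subset_integral => //.
- exact: measurable_itv.
- exact: measurable_pos.
- by apply/measurable_EFinP; exact: measurable_gw.
- by move=> x _; rewrite lee_fin gw_ge0.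
- by rewrite -bigcup_compacta; exact: bigcup_sup.
Qed.

Lemma GammaE s : 0 < s -> (\int[mu]_(x in [set t | (0 < t)%R]) (gw s x)%:E = (Gamma s)%:E)%E.
Proof.
move=> s0; rewrite /Gamma /Rintegral fineK// ge0_fin_numE ?gw_integrable//.
by apply: integral_ge0 => x _; rewrite lee_fin gw_ge0.
Qed.

Lemma GammaS s : 0 < s -> Gamma (s + 1) = s * Gamma s.
Proof.
move=> s0; have s1 : 0 < s + 1 by rewrite addr_gt0.
have c1 := exhaustion (@measurable_gw (s + 1) setT) (gw_ge0 (s + 1)).
have c2 := exhaustion (@measurable_gw s setT) (gw_ge0 s).
rewrite GammaE// in c1; rewrite GammaE// in c2.
pose e1 (N : nat) := N.+1%:R `^ s * expR (- N.+1%:R) : R.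
pose e2 (N : nat) := (N.+1%:R^-1) `^ s * expR (- N.+1%:R^-1) : R.
have h1 : e1 N @[N --> \oo] --> (0 : R).
  pose C := expR ((s + 1) * ln (s + 1)).
  have u0 : C * harmonic N @[N --> \oo] --> (0 : R).
    rewrite -[X in _ --> X](mulr0 C); apply: cvgM; first exact: cvg_cst.
    exact: cvg_harmonic.
  apply: (squeeze_cvgr _ (cvg_cst (0 : R)) u0); apply: nearW => N.
  rewrite /e1 mulr_ge0 ?powR_ge0 ?expR_ge0//= /harmonic/=.
  have b0 : (0 : R) < N.+1%:R by [].
  rewrite ler_pdivlMr// mulrAC expRN ler_pdivrMr ?expR_gt0//.
  have := powR_le_expR s1 ltr01 b0; rewrite divr1 mul1r; apply: le_trans.
  rewrite powRD ?powRr1 ?(ltW b0)//.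
  by rewrite gt_eqF ?implybT// pnatr_eq0.
have h2 : e2 N @[N --> \oo] --> (0 : R).
  have u0 : (harmonic N) `^ s @[N --> \oo] --> (0 : R).
    suff hc : harmonic N @[N --> \oo] --> (0 : R)^'+ by exact: cvg_comp hc (powR_cvg0 s0).
    move=> A /= [d /= d0 hA]; have /cvgr0Pnorm_lt /(_ d d0) := @cvg_harmonic R.
    apply: filterS => N hN; apply: hA; first by rewrite /= sub0r normrN.
    by rewrite /= /harmonic /= invr_gt0.
  apply: (squeeze_cvgr _ (cvg_cst (0 : R)) u0); apply: nearW => N.
  have E1 : expR (- N.+1%:R^-1) <= (1 : R).
    by rewrite expR_le1 oppr_le0 invr_ge0.
  apply/andP; split; first by rewrite mulr_ge0 ?powR_ge0 ?expR_ge0.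
  by apply: (le_trans (ler_wpM2l (powR_ge0 _ _) E1)); rewrite mulr1.
have l1 : (\int[mu]_(x in compacta N) (gw (s + 1) x)%:E + (e1 N)%:E @[N --> \oo] -->
    (Gamma (s + 1))%:E + (0 : R)%:E)%E.
  by apply: cvgeD => //; apply: cvg_EFin; [exact: nearW|exact: h1].
have l2 : (s%:E * \int[mu]_(x in compacta N) (gw s x)%:E + (e2 N)%:E @[N --> \oo] -->
    s%:E * (Gamma s)%:E + (0 : R)%:E)%E.
  apply: cvgeD => //; last by apply: cvg_EFin; [exact: nearW|exact: h2].
  exact: cvgeZl.
have E : (fun N => \int[mu]_(x in compacta N) (gw (s + 1) x)%:E + (e1 N)%:E)%E =
    (fun N => s%:E * \int[mu]_(x in compacta N) (gw s x)%:E + (e2 N)%:E)%E.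
  by apply/funext => N; have [a0 ab] := compacta_lt N; exact: gw_parts.
rewrite E in l1; apply: EFin_inj; rewrite EFinM.
by have := cvg_unique _ l1 l2; rewrite !adde0; apply.
Qed.

Lemma Gamma_gt0 s : 0 < s -> 0 < Gamma s.
Proof.
move=> s0; rewrite -lte_fin -GammaE//.
have pos12 x : x \in `[1, 2] -> (0 : R) < x.
  by rewrite in_itv/= => /andP[h _]; exact: lt_le_trans h.
have [c cin cmin] : exists2 c, c \in `[1, 2]%R & forall t, t \in `[1, 2]%R -> gw s c <= gw s t.
  apply: EVT_min; first by rewrite ler1n.
  by apply: continuous_in_subspaceT => x; rewrite inE/= => /pos12; exact: gw_continuous.
have c0 : 0 < gw s c by rewrite mulr_gt0 ?expR_gt0// powR_gt0// pos12.
apply: (@lt_le_trans _ _ (\int[mu]_(x in `[1%R, 2%R]) (gw s c)%:E)%E).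
  rewrite integral_cst//= lebesgue_measure_itv/= lte_fin ltr1n -EFinB -EFinM lte_fin.
  by rewrite mulr_gt0// subr_gt0 ltr1n.
apply: (@le_trans _ _ (\int[mu]_(x in `[1%R, 2%R]) (gw s x)%:E)%E).
  apply: ge0_le_integral => //.
  - by move=> x _; rewrite lee_fin ltW.
  - by apply/measurable_EFinP; exact: measurable_gw.
apply: ge0_subset_integral => //.
- exact: measurable_pos.
- by apply/measurable_EFinP; exact: measurable_gw.
- by move=> x _; rewrite lee_fin gw_ge0.
Qed.

(** Substitution [u = c x^p] on the compacta. Their images exhaust the half-line as well, so both
    sides pass to the limit. *)
Lemma power_gauss_integral p c th : 0 < p -> 0 < c -> 0 < th ->
  (\int[mu]_(x in [set t | (0 < t)%R]) (x `^ (p * th - 1) * expR (- (c * x `^ p)))%:E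
   = (p^-1 * c `^ (- th) * Gamma th)%:E)%E.
Proof.
move=> p0 c0 th0; pose F x := c * x `^ p; pose F' x := c * (p * x `^ (p - 1)).
pose h x := x `^ (p * th - 1) * expR (- (c * x `^ p)).
have h0 x : 0 <= h x by rewrite mulr_ge0 ?powR_ge0 ?expR_ge0.
have mh : measurable_fun setT h.
  apply: measurable_funM; first exact: measurable_powR.
  apply: measurableT_comp => //; apply: measurable_funN; apply: measurable_funM.
    exact: measurable_cst.
  exact: measurable_powR.
have dF x : 0 < x -> der F x (F' x).
  by move=> x0; apply: derMc; exact: is_derive1_powR.
have F'E x : 0 < x -> (derive1 F) x = F' x.
  by move=> /dF [_ <-]; rewrite derive1E.
have cF' x : 0 < x -> {for x, continuous F'}.
  move=> x0; apply: cvgM; first exact: cvg_cst.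
  by apply: cvgM; [exact: cvg_cst|exact: powR_continuous].
have cF'x (x : R) : 0 < x -> (derive1 F) y @[y --> x] --> F' x.
  move=> x0; apply: cvg_trans (cF' x x0); apply: near_eq_cvg.
  by apply: filterS (near_gt x0) => y y0; rewrite F'E.
have Fpos x : 0 < x -> 0 < F x by move=> x0; rewrite mulr_gt0// powR_gt0.
have Finc x y : 0 < x -> x < y -> F x < F y.
  move=> x0 xy; rewrite ltr_pM2l// gt0_ltr_powR// ?nnegrE ltW//.
  exact: lt_trans xy.
pose Fa (N : nat) := F N.+1%:R^-1; pose Fb (N : nat) := F N.+1%:R.
have key N : (\int[mu]_(x in `[Fa N, Fb N]) (gw th x)%:E =
    (p * c `^ th)%:E * \int[mu]_(x in compacta N) (h x)%:E)%E.
  have [a0 ab] := compacta_lt N.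
  have pos x : x \in `[N.+1%:R^-1, N.+1%:R] -> (0 : R) < x.
    by rewrite in_itv/= => /andP[+ _]; exact: lt_le_trans.
  rewrite /Fa /Fb integration_by_substitution_increasing//; last 6 first.
  - by move=> x y /pos x0 _; exact: Finc.
  - move=> x /subset_itv_oo_cc /pos x0; rewrite /continuous_at F'E//; exact: cF'x.
  - by apply/cvg_ex; exists (F' N.+1%:R^-1); apply: cvg_at_right_filter; exact: cF'x.
  - by apply/cvg_ex; exists (F' N.+1%:R); apply: cvg_at_left_filter; exact: cF'x.
  - split.
    + by move=> x /subset_itv_oo_cc /pos /dF [].
    + by apply: cvg_at_right_filter; exact: der_continuous (dF _ a0).
    + by apply: cvg_at_left_filter; exact: der_continuous (dF _ (ltr0Sn _ _)).
  - apply: continuous_in_subspaceT => x; rewrite inE/= in_itv/= => /andP[x1 _].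
    by apply: gw_continuous; apply: lt_le_trans x1; exact: Fpos.
  rewrite -ge0_integralZl_EFin//; last 4 first.
  - exact: measurable_itv.
  - by move=> x _; rewrite lee_fin h0.
  - by apply/measurable_EFinP; exact: measurable_funTS.
  - by rewrite mulr_ge0 ?powR_ge0// ltW.
  apply: eq_integral => x; rewrite inE => /pos x0; rewrite -EFinM; congr EFin.
  have -> : ((gw th \o F) * derive1 F) x = gw th (F x) * F' x.
    by rewrite -F'E.
  rewrite /F' /gw /h /F.
  have -> : (c * x `^ p) `^ (th - 1) = c `^ (th - 1) * x `^ (p * (th - 1)).
    by rewrite powRM ?powR_ge0 ?(ltW c0)// -powRrM.
  have -> : x `^ (p * th - 1) = x `^ (p * (th - 1)) * x `^ (p - 1).
    rewrite -powRD; last by rewrite (gt_eqF x0) implybT.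
    by congr (_ `^ _); ring.
  have -> : c `^ th = c `^ (th - 1) * c.
    by rewrite mulrC mulr_powRB1// ltW.
  ring.
have c1 := exhaustion mh h0.
have c2 : (\int[mu]_(x in `[Fa N, Fb N]) (gw th x)%:E @[N --> \oo] -->
    \int[mu]_(x in [set t | (0 < t)%R]) (gw th x)%:E)%E.
  have -> : [set t : R | 0 < t] = \bigcup_N `[Fa N, Fb N]%classic.
    apply/seteqP; split => t /=.
      move=> t0; have : [set t : R | 0 < t] ((t / c) `^ p^-1).
        by rewrite /= powR_gt0// divr_gt0.
      rewrite -bigcup_compacta => -[N _]; rewrite /compacta /= in_itv/= => /andP[l1 l2].
      have FtE : F ((t / c) `^ p^-1) = t.
        rewrite /F -powRrM mulVf ?gt_eqF// powRr1 ?divr_ge0 ?ltW//.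
        by rewrite mulrCA mulfV ?mulr1 ?gt_eqF.
      have [a0 ab] := compacta_lt N.
      exists N => //=; rewrite /Fa /Fb in_itv/= -FtE; apply/andP; split.
        move: l1; rewrite le_eqVlt => /predU1P[->//|l1]; exact: ltW (Finc _ _ a0 l1).
      move: l2; rewrite le_eqVlt => /predU1P[->//|l2]; apply: ltW (Finc _ _ _ l2).
      by rewrite powR_gt0// divr_gt0.
    move=> [N _]; rewrite /= /Fa /Fb in_itv/= => /andP[l1 _]; apply: lt_le_trans l1.
    by apply: Fpos; rewrite invr_gt0.
  apply: ge0_nondecreasing_set_cvg_integral.
  - move=> m n mn; apply/subsetPset => t; rewrite /= /Fa /Fb !in_itv/= => /andP[l1 l2].
    have Fle x y : 0 < x -> x <= y -> F x <= F y.
      by move=> x0; rewrite le_eqVlt => /predU1P[->//|xy]; exact: ltW (Finc _ _ x0 xy).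
    apply/andP; split.
      apply: le_trans l1; apply: Fle; first by rewrite invr_gt0.
      by rewrite lef_pV2 ?posrE// ler_nat.
    by apply: (le_trans l2); apply: Fle => //; rewrite ler_nat.
  - by move=> N; exact: measurable_itv.
  - by move=> N; apply/measurable_EFinP; exact: measurable_gw.
  - by move=> N x _; rewrite lee_fin gw_ge0.
have pc : 0 < p * c `^ th by rewrite mulr_gt0// powR_gt0.
have c3 : ((p * c `^ th)%:E * \int[mu]_(x in compacta N) (h x)%:E @[N --> \oo] -->
    (p * c `^ th)%:E * \int[mu]_(x in [set t | (0 < t)%R]) (h x)%:E)%E.
  exact: cvgeZl.
have E : (fun N => \int[mu]_(x in `[Fa N, Fb N]) (gw th x)%:E)%E =
    (fun N => (p * c `^ th)%:E * \int[mu]_(x in compacta N) (h x)%:E)%E.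
  by apply/funext => N; exact: key.
rewrite E GammaE// in c2.
have GE : (Gamma th)%:E = ((p * c `^ th)%:E *
    \int[mu]_(x in [set t | (0 < t)%R]) (h x)%:E)%E by exact: (cvg_unique _ c2 c3).
rewrite powRN -invfM EFinM GE muleA -EFinM mulVf ?mul1e//.
by rewrite gt_eqF.
Qed.

End GammaFunction.

(** * Entire power series of exponential type, differentiated along rays *)

Section EntireSeries.
Context {R : realType}.
Implicit Types (c : nat -> R[i]) (z w zeta : R[i]) (t : R).
Local Notation nc := (@ComplexField.Normc.normc R).
Local Notation Re := (@complex.Re R).
Local Notation Im := (@complex.Im R).

Lemma exp_partial_le (x : R) M : 0 <= x ->
  \sum_(0 <= l < M) x ^+ l / l`!%:R <= expR x.
Proof.
move=> x0; have h := @is_cvg_series_exp_coeff R x.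
have := nondecreasing_cvgn_le _ h M; apply.
by apply/nondecreasing_series => // k _ _; exact: exp_coeff_ge0.
Qed.

(** For [l >= a] one has [x^l <= 2^-a (2 x)^l]: doubling the argument buys a geometric rate in the
    starting index. *)
Lemma exp_tail_le (x : R) (a b : nat) : 0 <= x ->
  \sum_(a <= l < b) x ^+ l / l`!%:R <= 2^-1 ^+ a * expR (2 * x).
Proof.
move=> x0; apply: (@le_trans _ _ (\sum_(a <= l < b) 2^-1 ^+ a * ((2 * x) ^+ l / l`!%:R))).
  rewrite !big_seq; apply: ler_sum => l; rewrite mem_index_iota => /andP[al _].
  rewrite exprMn !mulrA ler_wpM2r ?invr_ge0//.
  rewrite ler_peMl ?exprn_ge0// -(subnK al) exprD mulrCA -exprMn mulVf// expr1n mulr1.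
  by rewrite exprn_ege1// ler1n.
rewrite -mulr_sumr ler_wpM2l ?exprn_ge0//.
apply: (le_trans _ (@exp_partial_le (2 * x) (maxn a b) _)); last by rewrite mulr_ge0.
have [ab|/ltnW ba] := leqP a b; last first.
  by rewrite big_geq//; apply: sumr_ge0 => l _; rewrite divr_ge0 ?exprn_ge0 ?mulr_ge0.
rewrite [leRHS](big_cat_nat _ (n := a))//= lerDr.
by apply: sumr_ge0 => l _; rewrite divr_ge0 ?exprn_ge0 ?mulr_ge0.
Qed.

Lemma real_series_tail (a : nat -> R) (D x : R) : 0 <= D -> 0 <= x ->
  (forall l, `|a l| <= D * (x ^+ l / l`!%:R)) ->
  cvgn (series a) /\
  forall M, `|limn (series a) - series a M| <= D * (2^-1 ^+ M * expR (2 * x)).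
Proof.
move=> D0 x0 ha.
have cv : cvgn (series a).
  apply: normed_cvg; apply: (@series_le_cvg _ _ (fun l => D * exp_coeff x l)).
  - by move=> l /=.
  - by move=> l /=; rewrite mulr_ge0 ?exp_coeff_ge0.
  - by move=> l; exact: ha.
  - by apply: is_cvg_seriesZ; exact: is_cvg_series_exp_coeff.
split=> // M.
have tail M' : (M <= M')%N -> `|series a M' - series a M| <= D * (2^-1 ^+ M * expR (2 * x)).
  move=> MM; rewrite /series /= (big_cat_nat _ (n := M) (p := M'))//= addrAC subrr add0r.
  apply: (le_trans (ler_norm_sum _ _ _)).
  apply: (@le_trans _ _ (\sum_(M <= l < M') D * (x ^+ l / l`!%:R))).
    by apply: ler_sum => l _; exact: ha.
  by rewrite -mulr_sumr ler_wpM2l// exp_tail_le.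
have cv2 : `|series a M' - series a M| @[M' --> \oo] --> `|limn (series a) - series a M|.
  by apply: cvg_norm; apply: cvgB => //; exact: cvg_cst.
rewrite -(cvg_lim _ cv2)//; apply: limr_le; first by apply/cvg_ex; eexists; exact: cv2.
by exists M => // M' /= MM; exact: tail.
Qed.

Definition cpart c z M := \sum_(0 <= l < M) c l * z ^+ l.

(** The two limits are real; they are meaningful under [egrowth], which gives convergence with an
    explicit rate. *)
Definition csum c z : R[i] :=
  limn (series (fun l => Re (c l * z ^+ l))) +i*
  limn (series (fun l => Im (c l * z ^+ l))).

Definition egrowth c (D rho : R) := [/\ 0 <= D, 0 <= rho &
  forall l, nc (c l) <= D * (rho ^+ l / l`!%:R)].

Lemma Re_sum (I : Type) (s : seq I) (F : I -> R[i]) :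
  Re (\sum_(i <- s) F i) = \sum_(i <- s) Re (F i).
Proof. by elim/big_rec2: _ => // i x y _ <-; rewrite ReD. Qed.

Lemma Im_sum (I : Type) (s : seq I) (F : I -> R[i]) :
  Im (\sum_(i <- s) F i) = \sum_(i <- s) Im (F i).
Proof. by elim/big_rec2: _ => // i x y _ <-; rewrite ImD. Qed.

Lemma egrowth_term c D rho z l : egrowth c D rho ->
  nc (c l * z ^+ l) <= D * ((rho * nc z) ^+ l / l`!%:R).
Proof.
move=> [D0 r0 h]; rewrite ncM ncX exprMn mulrAC mulrA ler_wpM2r ?exprn_ge0 ?nc_ge0//.
Qed.

Lemma csum_tail c D rho z M : egrowth c D rho ->
  nc (csum c z - cpart c z M) <= 2 * D * (2^-1 ^+ M * expR (2 * (rho * nc z))).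
Proof.
move=> hc; have [D0 r0 _] := hc.
have x0 : 0 <= rho * nc z by rewrite mulr_ge0 ?nc_ge0.
have [_ h1] := @real_series_tail (fun l => Re (c l * z ^+ l)) D _ D0 x0
  (fun l => le_trans (nc_Re _) (egrowth_term z l hc)).
have [_ h2] := @real_series_tail (fun l => Im (c l * z ^+ l)) D _ D0 x0
  (fun l => le_trans (nc_Im _) (egrowth_term z l hc)).
apply: (le_trans (nc_le _)); rewrite -mulrA mulr_natl mulr2n; apply: lerD.
  rewrite ReD; have -> : Re (- cpart c z M) = - Re (cpart c z M) by case: (cpart c z M).
  by rewrite /cpart Re_sum; exact: h1.
rewrite ImD; have -> : Im (- cpart c z M) = - Im (cpart c z M) by case: (cpart c z M).
by rewrite /cpart Im_sum; exact: h2.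
Qed.

Lemma csum_approx c D rho z e : egrowth c D rho -> 0 < e ->
  exists M0, forall M, (M0 <= M)%N -> nc (csum c z - cpart c z M) <= e.
Proof.
move=> hc e0; pose B := 2 * D * expR (2 * (rho * nc z)).
have [D0 r0 _] := hc.
have B0 : 0 <= B by rewrite !mulr_ge0 ?expR_ge0.
exists (Num.trunc (B / e)).+1 => M hM.
have Be : 0 <= B / e by rewrite divr_ge0// ltW.
have /andP[_ h] := truncn_itv Be.
apply: (le_trans (csum_tail z M hc)).
have -> : 2 * D * (2^-1 ^+ M * expR (2 * (rho * nc z))) = B * 2^-1 ^+ M.
  by rewrite /B -[RHS]mulrA [X in _ = _ * X]mulrC.
rewrite exprVn ler_pdivrMr ?exprn_gt0// mulrC -ler_pdivrMr//.
apply: (le_trans (ltW h)); rewrite -natrX ler_nat.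
by apply: (leq_trans hM); exact: ltnW (ltn_expl _ _).
Qed.

(** Identities between series are reduced by this to identities between partial sums. *)
Lemma csum_unique c D rho z w : egrowth c D rho ->
  (forall e, 0 < e -> exists M0, forall M, (M0 <= M)%N -> nc (w - cpart c z M) <= e) ->
  w = csum c z.
Proof.
move=> hc hw; apply/eqP; rewrite -subr_eq0; apply/eqP/nc_eq0.
apply/eqP; rewrite eq_le nc_ge0 andbT; apply/ler_addgt0Pr => e e0; rewrite add0r.
have e2 : 0 < e / 2 by rewrite divr_gt0.
have [M0 hM0] := hw _ e2; have [M1 hM1] := csum_approx z hc e2.
pose M := maxn M0 M1.
have -> : w - csum c z = (w - cpart c z M) - (csum c z - cpart c z M) by ring.
apply: (le_trans (ncB _ _)).
by rewrite (splitr e) lerD ?hM0 ?hM1 ?leq_maxl ?leq_maxr.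
Qed.

Lemma egrowthZ c D rho k : egrowth c D rho -> egrowth (fun l => k * c l) (nc k * D) rho.
Proof.
move=> [D0 r0 h]; split; [by rewrite mulr_ge0 ?nc_ge0|by []|move=> l].
by rewrite ncM -mulrA ler_wpM2l ?nc_ge0.
Qed.

Lemma csumZ c D rho k z : egrowth c D rho -> csum (fun l => k * c l) z = k * csum c z.
Proof.
move=> hc; apply/esym; apply: (csum_unique (egrowthZ k hc)) => e e0.
have k0 : 0 < nc k + 1 by rewrite ltr_wpDl// nc_ge0.
have [|M0 hM] := @csum_approx c D rho z (e / (nc k + 1)) hc; first by rewrite divr_gt0.
exists M0 => M MM.
have -> : cpart (fun l => k * c l) z M = k * cpart c z M.
  by rewrite /cpart mulr_sumr; apply: eq_bigr => l _; rewrite mulrA.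
rewrite -mulrBr ncM; apply: (le_trans (ler_wpM2l (nc_ge0 _) (hM M MM))).
by rewrite mulrCA ler_piMr// ?(ltW e0)// ler_pdivrMr// mul1r lerDl.
Qed.

Lemma egrowthD c1 c2 D1 D2 rho : egrowth c1 D1 rho -> egrowth c2 D2 rho ->
  egrowth (fun l => c1 l + c2 l) (D1 + D2) rho.
Proof.
move=> [d1 r h1] [d2 _ h2]; split; [by rewrite addr_ge0|by []|move=> l].
by rewrite mulrDl (le_trans (ncD _ _))// lerD.
Qed.

Lemma csumD c1 c2 D1 D2 rho z : egrowth c1 D1 rho -> egrowth c2 D2 rho ->
  csum (fun l => c1 l + c2 l) z = csum c1 z + csum c2 z.
Proof.
move=> h1 h2; apply/esym; apply: (csum_unique (egrowthD h1 h2)) => e e0.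
have e2 : 0 < e / 2 by rewrite divr_gt0.
have [M1 hM1] := csum_approx z h1 e2; have [M2 hM2] := csum_approx z h2 e2.
exists (maxn M1 M2) => M; rewrite geq_max => /andP[m1 m2].
have -> : cpart (fun l => c1 l + c2 l) z M = cpart c1 z M + cpart c2 z M.
  by rewrite /cpart -big_split; apply: eq_bigr => l _; rewrite mulrDl.
rewrite opprD addrACA (splitr e); apply: (le_trans (ncD _ _)).
by rewrite lerD ?hM1 ?hM2.
Qed.

Definition cshift c l := if l is l'.+1 then c l' else 0.

(** The new rate comes from [(l + 1) rho^l <= (2 (rho + 1))^(l + 1)]. *)
Lemma egrowth_shift c D rho : egrowth c D rho -> egrowth (cshift c) D (2 * (rho + 1)).
Proof.
move=> [D0 r0 h]; split=> //; first by rewrite mulr_ge0// addr_ge0.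
case=> [|l]; rewrite /cshift.
  by rewrite nc0 mulr_ge0 ?divr_ge0 ?exprn_ge0 ?mulr_ge0 ?addr_ge0.
apply: (le_trans (h l)); rewrite ler_wpM2l// factS natrM invfM mulrA.
rewrite ler_wpM2r ?invr_ge0// ler_pdivlMr// exprMn mulrC.
rewrite ler_pM ?exprn_ge0//.
  by rewrite -natrX ler_nat; exact: ltnW (ltn_expl _ _).
rewrite exprSr (@le_trans _ _ ((rho + 1) ^+ l))//.
  by rewrite lerXn2r ?nnegrE ?addr_ge0// lerDl.
by rewrite ler_peMr ?exprn_ge0 ?addr_ge0// lerDr.
Qed.

Lemma csum_shift c D rho z : egrowth c D rho -> csum (cshift c) z = z * csum c z.
Proof.
move=> hc; apply/esym; apply: (csum_unique (egrowth_shift hc)) => e e0.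
have z0 : 0 < nc z + 1 by rewrite ltr_wpDl// nc_ge0.
have [|M0 hM] := @csum_approx c D rho z (e / (nc z + 1)) hc; first by rewrite divr_gt0.
exists M0.+1 => -[//|M] MM.
have -> : cpart (cshift c) z M.+1 = z * cpart c z M.
  rewrite /cpart big_nat_recl//= mul0r add0r mulr_sumr; apply: eq_bigr => l _.
  by rewrite exprS mulrCA.
rewrite -mulrBr ncM; apply: (le_trans (ler_wpM2l (nc_ge0 _) (hM M MM))).
by rewrite mulrCA ler_piMr// ?(ltW e0)// ler_pdivrMr// mul1r lerDl.
Qed.

Definition cdiff c l := l.+1%:R * c l.+1.

Lemma ncnat m : nc m%:R = m%:R.
Proof. by rewrite -(rmorph_nat (real_complex R)) ncR ger0_norm. Qed.

Lemma fact_shift (E x : R) l : l.+1%:R * (E * (x ^+ l.+1 / l.+1`!%:R)) =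
  E * x * (x ^+ l / l`!%:R).
Proof.
rewrite factS natrM invfM exprS; have : (l.+1%:R : R) != 0 by rewrite pnatr_eq0.
by move: (l.+1%:R : R) (l`!%:R^-1 : R) (x ^+ l) => u v w u0; field.
Qed.

Lemma egrowth_diff c D rho : egrowth c D rho -> egrowth (cdiff c) (D * rho) rho.
Proof.
move=> [D0 r0 h]; split=> //; first by rewrite mulr_ge0.
move=> l; rewrite /cdiff ncM ncnat.
apply: (le_trans (ler_wpM2l (ler0n R l.+1) (h l.+1))).
by rewrite fact_shift.
Qed.

Lemma der_pseries (a : nat -> R) (D x t : R) : 0 <= D -> 0 <= x ->
  (forall l, `|a l| <= D * (x ^+ l / l`!%:R)) ->
  der (fun t => limn (pseries a t)) t (limn (pseries (pseries_diffs a) t)).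
Proof.
move=> D0 x0 ha; pose K := `|t| + 1.
have K0 : 0 <= K by rewrite addr_ge0.
have cvp (b : nat -> R) E : 0 <= E -> (forall l, `|b l| <= E * (x ^+ l / l`!%:R)) ->
    cvgn (pseries b K).
  move=> E0 hb; have xK : 0 <= x * K by rewrite mulr_ge0.
  have [] // := @real_series_tail (fun l => b l * K ^+ l) E (x * K) E0 xK.
  move=> l; rewrite normrM (ger0_norm (exprn_ge0 _ K0)) exprMn mulrAC mulrA.
  by rewrite ler_wpM2r ?exprn_ge0.
have hd (b : nat -> R) E : 0 <= E -> (forall l, `|b l| <= E * (x ^+ l / l`!%:R)) ->
    forall l, `|pseries_diffs b l| <= (E * x) * (x ^+ l / l`!%:R).
  move=> E0 hb l; rewrite /pseries_diffs normrM ger0_norm//.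
  apply: (le_trans (ler_wpM2l (ler0n R l.+1) (hb l.+1))).
  by rewrite fact_shift.
have D1 : 0 <= D * x by rewrite mulr_ge0.
apply: (@pseries_snd_diffs _ a K t).
- exact: cvp ha.
- by apply: (cvp _ (D * x)) => //; exact: hd.
- by apply: (cvp _ (D * x * x)); [rewrite mulr_ge0|exact: (hd _ _ D1 (hd _ _ D0 ha))].
- by rewrite (ger0_norm K0) /K ltrDl.
Qed.

Lemma cvg_pseries_ext (a b : nat -> R) (t : R) : (forall l, a l = b l * t ^+ l) ->
  limn (series a) = limn (pseries b t).
Proof. by move=> h; congr (limn (series _)); apply/funext => l; rewrite h. Qed.

(** Restricting to a ray [t zeta] makes the function one of a real variable, so term-by-term
    differentiation of real series replaces complex derivatives. *)
Lemma der_csum c D rho zeta t : egrowth c D rho ->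
  der (fun t => Re (csum c (t%:C * zeta))) t (Re (zeta * csum (cdiff c) (t%:C * zeta))) /\
  der (fun t => Im (csum c (t%:C * zeta))) t (Im (zeta * csum (cdiff c) (t%:C * zeta))).
Proof.
move=> hc; have [D0 r0 h] := hc.
have x0 : 0 <= rho * nc zeta by rewrite mulr_ge0 ?nc_ge0.
rewrite -(csumZ zeta _ (egrowth_diff hc)).
have pw (s : R) (k : R[i]) l : k * (s%:C * zeta) ^+ l = (k * zeta ^+ l) * (s ^+ l)%:C.
  by rewrite exprMn rmorphXn /= -!mulrA (mulrC (_ ^+ l)).
have ReC (k : R[i]) (s : R) : Re (k * s%:C) = Re k * s.
  by rewrite ReM /= mulr0 subr0.
have ImC (k : R[i]) (s : R) : Im (k * s%:C) = Im k * s.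
  by rewrite ImM /= mulr0 add0r.
have dif l : zeta * cdiff c l * zeta ^+ l = l.+1%:R * (c l.+1 * zeta ^+ l.+1).
  by rewrite /cdiff exprS; ring.
have ReN (k : R[i]) m : Re (m%:R * k) = m%:R * Re k.
  by rewrite -(rmorph_nat (real_complex R)) mulrC ReC mulrC.
have ImN (k : R[i]) m : Im (m%:R * k) = m%:R * Im k.
  by rewrite -(rmorph_nat (real_complex R)) mulrC ImC mulrC.
split.
- have -> : (fun t => Re (csum c (t%:C * zeta))) =
      fun t => limn (pseries (fun l => Re (c l * zeta ^+ l)) t).
    by apply/funext => s /=; apply: cvg_pseries_ext => l; rewrite pw ReC.
  apply: derE.
    apply: (@der_pseries _ D (rho * nc zeta)) => // l.
    exact: le_trans (nc_Re _) (egrowth_term zeta l hc).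
  by apply/esym/cvg_pseries_ext => l; rewrite pw ReC dif ReN.
- have -> : (fun t => Im (csum c (t%:C * zeta))) =
      fun t => limn (pseries (fun l => Im (c l * zeta ^+ l)) t).
    by apply/funext => s /=; apply: cvg_pseries_ext => l; rewrite pw ImC.
  apply: derE.
    apply: (@der_pseries _ D (rho * nc zeta)) => // l.
    exact: le_trans (nc_Im _) (egrowth_term zeta l hc).
  by apply/esym/cvg_pseries_ext => l; rewrite pw ImC dif ImN.
Qed.

Lemma csum0 c D rho : egrowth c D rho -> csum c 0 = c 0%N.
Proof.
move=> hc; apply/esym; apply: (csum_unique hc) => e e0.
exists 1%N => -[//|M] _; rewrite /cpart big_nat_recl// expr0 mulr1 big1 ?addr0.
  by rewrite subrr nc0 ltW.
by move=> l _; rewrite expr0n mulr0.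
Qed.

Definition cexp z := csum (fun l => (l`!%:R)^-1) z.

Lemma egrowth_exp : egrowth (fun l => (l`!%:R)^-1) 1 1.
Proof.
split=> // l; rewrite expr1n !mul1r.
have -> : ((l`!%:R)^-1 : R[i]) = ((l`!%:R)^-1)%:C by rewrite fmorphV rmorph_nat.
by rewrite ncR ger0_norm// invr_ge0.
Qed.

Lemma cexp_real (x : R) : cexp x%:C = (expR x)%:C.
Proof.
rewrite /cexp /csum.
have e l : (l`!%:R)^-1 * x%:C ^+ l = (exp_coeff x l)%:C :> R[i].
  by rewrite /exp_coeff /= rmorphM fmorphV rmorph_nat rmorphXn mulrC.
congr (_ +i* _).
  by rewrite /expR; congr (limn (series _)); apply/funext => l; rewrite e.
rewrite (_ : (fun l => _) = fun=> 0); last by apply/funext => l; rewrite e.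
rewrite (_ : series _ = fun=> 0); first exact: lim_cst.
by apply/funext => M; rewrite /series /= big1.
Qed.

(** [|exp (t z)|^2 exp (- 2 t Re z)] has zero derivative in [t] and equals 1 at 0. *)
Lemma nc_cexp z : nc (cexp z) <= expR (Re z).
Proof.
have he := egrowth_exp.
pose wr t := Re (cexp (t%:C * z)); pose wi t := Im (cexp (t%:C * z)).
have dE : cdiff (fun l => (l`!%:R)^-1) = (fun l => (l`!%:R)^-1 : R[i]).
  apply/funext => l; rewrite /cdiff factS natrM invfM mulrA mulfV ?mul1r//.
have dw t : der wr t (Re z * wr t - Im z * wi t) /\ der wi t (Re z * wi t + Im z * wr t).
  have [h1 h2] := der_csum z t he; rewrite dE -/(cexp _) ReM ImM in h1 h2.
  by split.
pose f t := (wr t ^+ 2 + wi t ^+ 2) * expR (- (2 * Re z) * t).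
have df t : der f t 0.
  have [h1 h2] := dw t; apply: derE.
    apply: derM; first by apply: derD; [exact: derX h1|exact: derX h2].
    by apply: derexp; apply: derMc; exact: derI.
  by rewrite /= !expr1; ring.
have f10 : f 1 = f 0.
  have cf : {within `[0, 1], continuous f}.
    by apply: continuous_in_subspaceT => x _; exact: der_continuous (df x).
  have [s _] := @MVT R f (fun=> 0) 0 1 ltr01 (fun x _ => df x) cf.
  by rewrite mul0r => /eqP; rewrite subr_eq0 => /eqP.
have W1 : nc (cexp z) ^+ 2 = expR (2 * Re z).
  have : f 1 = 1.
    rewrite f10 /f /wr /wi mul0r /cexp (csum0 he) fact0 invr1 mulr0 expR0 mulr1 /=.
    by rewrite expr1n expr0n addr0.
  rewrite /f /wr /wi mul1r mulr1 -nc_sqr expRN.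
  rewrite -[X in _ = X](@mulfV _ (expR (2 * Re z))) ?expR_eq0//.
  by apply: mulIf; rewrite invr_eq0 expR_eq0.
rewrite -(@ler_pXn2r _ 2) ?nnegrE ?nc_ge0 ?expR_ge0//.
by rewrite W1 -expRM_natl.
Qed.

End EntireSeries.

(** * Normalized Bessel functions of complex argument and their exponential bound *)

Section Bessel.
Context {R : realType}.
Implicit Types (z w zeta : R[i]) (t beta : R).
Local Notation nc := (@ComplexField.Normc.normc R).
Local Notation Re := (@complex.Re R).
Local Notation Im := (@complex.Im R).

(** Coefficient of [z^(2 m)] in [j_beta]; [bc] inserts the zero odd coefficients. *)
Definition bm beta m : R :=
  (-1) ^+ m * Gamma (beta + 1) / (m`!%:R * Gamma (beta + m%:R + 1) * 4 ^+ m).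

Definition bc beta l : R := if odd l then 0 else bm beta l./2.

Lemma complex_ext z w : Re z = Re w -> Im z = Im w -> z = w.
Proof. by case: z w => a b [c d] /= -> ->. Qed.

Lemma ReCM (x : R) z : Re (x%:C * z) = x * Re z.
Proof. by rewrite ReM /= mul0r subr0. Qed.
Lemma ImCM (x : R) z : Im (x%:C * z) = x * Im z.
Proof. by rewrite ImM /= mul0r addr0. Qed.
Lemma ReN z : Re (- z) = - Re z. Proof. by case: z. Qed.
Lemma ImN z : Im (- z) = - Im z. Proof. by case: z. Qed.

Lemma bm0 beta : - 1 < beta -> bm beta 0 = 1.
Proof.
move=> b0; have G0 : Gamma (beta + 1) != 0 by rewrite gt_eqF// Gamma_gt0//; lra.
by rewrite /bm expr0 fact0 addr0 !mul1r mulr1 mulfV.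
Qed.

Lemma bmS beta m : - 1 < beta ->
  4 * m.+1%:R * (beta + m.+1%:R) * bm beta m.+1 = - bm beta m.
Proof.
move=> b0; rewrite /bm factS natrM.
have m0 : (0 : R) <= m%:R by [].
have G1 : 0 < Gamma (beta + m%:R + 1) by apply: Gamma_gt0; lra.
have -> : beta + m.+1%:R + 1 = (beta + m%:R + 1) + 1 by rewrite -natr1; ring.
rewrite (@GammaS _ (beta + m%:R + 1)); last lra.
have h1 : beta + m%:R + 1 != 0 by rewrite gt_eqF//; lra.
have h2 : Gamma (beta + m%:R + 1) != 0 by rewrite gt_eqF.
have h3 : (m`!%:R : R) != 0 by rewrite pnatr_eq0 -lt0n fact_gt0.
have h4 : (m.+1%:R : R) != 0 by rewrite pnatr_eq0.
have h5 : (4 ^+ m : R) != 0 by rewrite expf_neq0.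
have -> : beta + m.+1%:R = beta + m%:R + 1 by rewrite -natr1; ring.
rewrite !exprS; move: (Gamma _) (beta + m%:R + 1) (m`!%:R : R) (m.+1%:R : R) (4 ^+ m)
  (Gamma _) ((-1) ^+ m) h1 h2 h3 h4 h5 => g s u v w G sg *.
by field; do ?[apply/andP; split].
Qed.

Lemma bm_up beta m : - 1 < beta ->
  (beta + 1 + m%:R) * bm (beta + 1) m = (beta + 1) * bm beta m.
Proof.
move=> b0; rewrite /bm.
have m0 : (0 : R) <= m%:R by [].
have G1 : 0 < Gamma (beta + m%:R + 1) by apply: Gamma_gt0; lra.
have -> : beta + 1 + m%:R + 1 = (beta + m%:R + 1) + 1 by ring.
rewrite (@GammaS _ (beta + m%:R + 1)); last lra.
rewrite (@GammaS _ (beta + 1)); last lra.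
have -> : beta + 1 + m%:R = beta + m%:R + 1 by ring.
have h1 : beta + m%:R + 1 != 0 by rewrite gt_eqF//; lra.
have h2 : Gamma (beta + m%:R + 1) != 0 by rewrite gt_eqF.
have h3 : (m`!%:R : R) != 0 by rewrite pnatr_eq0 -lt0n fact_gt0.
have h5 : (4 ^+ m : R) != 0 by rewrite expf_neq0.
move: (Gamma (beta + 1)) => G; move: h2; move: (Gamma (beta + m%:R + 1)) => g h2; move: (beta + m%:R + 1) (m`!%:R : R) (4 ^+ m)
   ((-1) ^+ m) h1 h3 h5 => s u w sg *.
by field; do ?[apply/andP; split].
Qed.

(** For [beta >= -1/2] the recurrence divides by [4 (m + 1) (beta + m + 1) >= (2 m + 1) (2 m + 2)].
    Equality at [beta = -1/2] is the cosine series. *)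
Lemma bm_bound beta m : - 2^-1 <= beta -> `|bm beta m| <= ((2 * m)`!%:R)^-1.
Proof.
move=> b0; have b1 : - 1 < beta by lra.
elim: m => [|m IH]; first by rewrite bm0// normr1 muln0 fact0 invr1.
have m0 : (0 : R) <= m%:R by [].
have q0 : 0 < 4 * m.+1%:R * (beta + m.+1%:R) by rewrite !mulr_gt0// -natr1; lra.
have := congr1 Num.norm (bmS m b1); rewrite normrN normrM (gtr0_norm q0) => E.
have -> : (2 * m.+1 = (2 * m).+2)%N by rewrite mulnS.
rewrite !factS !natrM !invfM.
have h1 : 0 < ((2 * m).+2%:R : R) * (2 * m).+1%:R by rewrite mulr_gt0.
rewrite mulrA -invfM mulrC ler_pdivlMr//.
apply: le_trans IH; rewrite -E mulrC ler_wpM2r//.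
by rewrite -!natr1 natrM; nra.
Qed.

Lemma egrowth_bc beta : - 2^-1 <= beta -> egrowth (fun l => (bc beta l)%:C) 1 1.
Proof.
move=> b0; split=> // l; rewrite expr1n !mul1r ncR /bc.
case: ifPn => [_|lo]; first by rewrite normr0 invr_ge0.
apply: (le_trans (bm_bound _ b0)).
by rewrite mul2n -{2}(odd_double_half l) (negbTE lo).
Qed.

Lemma bc0 beta : - 1 < beta -> bc beta 0 = 1.
Proof. by move=> b0; rewrite /bc /= bm0. Qed.

Definition JC beta z := csum (fun l => (bc beta l)%:C) z.

(** On coefficients, [j_beta' (z) = - z j_(beta+1) (z) / (2 (beta + 1))]. *)
Lemma bc_diff beta l : - 1 < beta ->
  l.+1%:R * bc beta l.+1 = - (2 * (beta + 1))^-1 * (if l is l'.+1 then bc (beta + 1) l' else 0).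
Proof.
move=> b0; case: l => [|l]; first by rewrite /bc /= mulr0 mulr0.
rewrite /bc /= negbK; case: ifPn => lo; first by rewrite !mulr0.
have lE : l = (l./2).*2 by rewrite -{1}(odd_double_half l) (negbTE lo).
set m := l./2 in lE *.
have m0 : (0 : R) <= m%:R by [].
have h1 := bmS m b0; have h2 := bm_up m b0.
have b1 : beta + 1 != 0 by rewrite gt_eqF//; clear -b0; lra.
have c1 : beta + m.+1%:R != 0 by rewrite -natr1 gt_eqF//; clear -b0 m0; lra.
have c2 : beta + 1 + m%:R = beta + m.+1%:R by rewrite -natr1; ring.
rewrite c2 in h2.
have -> : (l.+2%:R : R) = 2 * m.+1%:R by rewrite lE -doubleS -mul2n natrM.
apply: (mulfI c1); apply: (mulfI (_ : 2 != 0)) => //.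
move: h1 h2 b1; clear; move: (bm beta m.+1) (bm beta m) (bm (beta + 1) m) (m.+1%:R : R).
move=> x y w u h1 h2 b1.
have -> : 2 * ((beta + u) * (2 * u * x)) = 4 * u * (beta + u) * x by ring.
rewrite h1; have -> : 2 * ((beta + u) * (- (2 * (beta + 1))^-1 * w)) =
  - (2 * (beta + 1))^-1 * 2 * ((beta + u) * w) by ring.
by rewrite h2; field.
Qed.

(** On coefficients, [z j_(beta+1)' + 2 (beta + 1) j_(beta+1) = 2 (beta + 1) j_beta]. Together with
    [bc_diff] this is the Bessel equation written as a first-order system. *)
Lemma bc_up beta l : - 1 < beta ->
  l%:R * bc (beta + 1) l + 2 * (beta + 1) * bc (beta + 1) l = 2 * (beta + 1) * bc beta l.
Proof.
move=> b0; rewrite /bc; case: ifPn => lo; first by rewrite !mulr0 addr0.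
have lE : l = (l./2).*2 by rewrite -{1}(odd_double_half l) (negbTE lo).
rewrite {1}lE -mul2n natrM -mulrDl -mulrDr -mulrA addrC bm_up//.
by rewrite mulrA.
Qed.

Local Opaque bm bc.

(** Along the ray, [w (t) = j_beta (t zeta)] satisfies [w'' + (2 beta + 1) / t w' + zeta^2 w = 0].
    The energy [|w'|^2 + |zeta|^2 |w|^2] grows at most at rate [2 |Im zeta|], as the damping term
    only decreases it when [beta >= -1/2]. It starts at [|zeta|^2], and dividing by [|zeta|^2] at
    [t = 1] gives the bound; hence [zeta = 0] is treated apart. *)
Lemma JC_bound beta zeta : - 2^-1 <= beta -> nc (JC beta zeta) <= expR `|Im zeta|.
Proof.
move=> b0; have b1 : - 1 < beta by lra.
have b01 : - 2^-1 <= beta + 1 by lra.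
have g0 := egrowth_bc b0; have g1 := egrowth_bc b01.
have [->|z0] := eqVneq zeta 0.
  by rewrite /JC (csum0 g0) bc0// ncR normr1 normr0 expR0.
pose k := (2 * (beta + 1))^-1.
pose W0 t := JC beta (t%:C * zeta); pose W1 t := JC (beta + 1) (t%:C * zeta).
have dW0 t : der (fun t => Re (W0 t)) t (Re (- (k * t)%:C * zeta ^+ 2 * W1 t)) /\
    der (fun t => Im (W0 t)) t (Im (- (k * t)%:C * zeta ^+ 2 * W1 t)).
  have E : zeta * csum (cdiff (fun l => (bc beta l)%:C)) (t%:C * zeta) =
      - (k * t)%:C * zeta ^+ 2 * W1 t.
    have -> : cdiff (fun l => (bc beta l)%:C) =
        fun l => (- k)%:C * cshift (fun l => (bc (beta + 1) l)%:C) l.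
      apply/funext => l; rewrite /cdiff -(rmorph_nat (real_complex R)) -rmorphM /= bc_diff//.
      by rewrite rmorphM; case: l => [|l] //=; rewrite /cshift rmorph0.
    rewrite (csumZ _ _ (egrowth_shift g1)) (csum_shift _ g1) -/(JC _ _) -/(W1 t).
    by rewrite rmorphN /= rmorphM /=; ring.
  by have := der_csum zeta t g0; rewrite E.
have dW1 t : der (fun t => Re (W1 t)) t (Re (zeta * csum (cdiff (fun l => (bc (beta + 1) l)%:C)) (t%:C * zeta))) /\
    der (fun t => Im (W1 t)) t (Im (zeta * csum (cdiff (fun l => (bc (beta + 1) l)%:C)) (t%:C * zeta))).
  exact: der_csum g1.
have tW1 t : t%:C * (zeta * csum (cdiff (fun l => (bc (beta + 1) l)%:C)) (t%:C * zeta)) =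
    (2 * (beta + 1))%:C * (W0 t - W1 t).
  rewrite mulrA -(csum_shift _ (egrowth_diff g1)).
  have -> : csum (cshift (cdiff (fun l => (bc (beta + 1) l)%:C))) (t%:C * zeta) =
    csum (fun l => (2 * (beta + 1))%:C * ((bc beta l)%:C + (-1) * (bc (beta + 1) l)%:C)) (t%:C * zeta).
    congr (csum _ _); apply/funext => l; rewrite mulN1r -rmorphB -rmorphM /=.
    have := bc_up l b1; rewrite mulrBr => h.
    have -> : 2 * (beta + 1) * bc beta l - 2 * (beta + 1) * bc (beta + 1) l = l%:R * bc (beta + 1) l.
      by move: h; move: (bc _ _) (bc _ _) => x y <-; rewrite addrK.
    case: l {h} => [|l]; rewrite /cshift /cdiff ?mul0r ?rmorph0//.
    by rewrite rmorphM rmorph_nat.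
  rewrite (csumZ _ _ (egrowthD g0 (egrowthZ (-1) g1))) (csumD _ g0 (egrowthZ (-1) g1)).
  by rewrite (csumZ _ _ g1) mulN1r.
pose p := Re zeta; pose q := Im zeta.
pose w0r t := Re (W0 t); pose w0i t := Im (W0 t).
pose w1r t := Re (W1 t); pose w1i t := Im (W1 t).
pose A := p ^+ 2 - q ^+ 2; pose B := 2 * p * q.
have z2 : zeta ^+ 2 = A +i* B.
  apply: complex_ext; rewrite expr2 ?ReM ?ImM /= /A /B /p /q; ring.
have AE : A = p ^+ 2 - q ^+ 2 by [].
have BE : B = 2 * p * q by [].
clearbody A B.
(* [vr + i vi] is the derivative of [W0], written through [j_(beta+1)] so that it makes sense and is
   continuous at [t = 0]. *)
pose vr t := - (k * t) * (A * w1r t - B * w1i t).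
pose vi t := - (k * t) * (A * w1i t + B * w1r t).
have vE t : - (k * t)%:C * zeta ^+ 2 * W1 t = vr t +i* vi t.
  rewrite z2 /vr /vi /w1r /w1i; apply: complex_ext; rewrite !(ReM, ImM) /=; ring.
have dw0 t : der w0r t (vr t) /\ der w0i t (vi t).
  by have := dW0 t; rewrite vE.
have dv t : 0 < t ->
    der vr t (- (A * w0r t - B * w0i t) - (2 * beta + 1) / t * vr t) /\
    der vi t (- (A * w0i t + B * w0r t) - (2 * beta + 1) / t * vi t).
  move=> t0; have [h1 h2] := dW1 t; have tE := tW1 t.
  move: h1 h2 tE; set Z := zeta * _; move=> h1 h2 tE.
  have tn : t != 0 by rewrite gt_eqF.
  have bn : beta + 1 != 0 by rewrite gt_eqF//; lra.
  have e1 : Re Z = 2 * (beta + 1) * (w0r t - w1r t) / t.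
    apply: (mulfI tn); rewrite mulrCA mulfV// mulr1.
    by have := congr1 Re tE; rewrite !ReCM ReD ReN.
  have e2 : Im Z = 2 * (beta + 1) * (w0i t - w1i t) / t.
    apply: (mulfI tn); rewrite mulrCA mulfV// mulr1.
    by have := congr1 Im tE; rewrite !ImCM ImD ImN.
  rewrite e1 in h1; rewrite e2 in h2.
  have dk : der (fun t => - (k * t)) t (- (k * 1)) by apply: derN; apply: derMc; exact: derI.
  split.
    apply: derE.
      apply: derM; first exact: dk.
      by apply: derB; apply: derMc; [exact: h1|exact: h2].
  rewrite /vr /k; move: tn bn; clear.
  move: (w0r t) (w1r t) (w0i t) (w1i t) => x1 x2 x3 x4 tn bn.
  by field; rewrite ?tn ?bn.
  apply: derE.
    apply: derM; first exact: dk.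
    by apply: derD; apply: derMc; [exact: h2|exact: h1].
  rewrite /vi /k; move: tn bn; clear.
  move: (w0r t) (w1r t) (w0i t) (w1i t) => x1 x2 x3 x4 tn bn.
  by field; rewrite ?tn ?bn.
(* The energy; [f] is the energy with its maximal growth rate removed, to be shown nonincreasing. *)
pose W t := vr t ^+ 2 + vi t ^+ 2 + (p ^+ 2 + q ^+ 2) * (w0r t ^+ 2 + w0i t ^+ 2).
pose f t := W t * expR (- (2 * `|q|) * t).
have cf : {within `[0, 1], continuous f}.
  apply: continuous_in_subspaceT => t _.
  have [h1 h2] := dw0 t; have [h3 h4] := dW1 t.
  have c3 := der_continuous h3; have c4 := der_continuous h4.
  have ck : {for t, continuous (fun t => - (k * t))}.
    have : der (fun t => - (k * t)) t (- (k * 1)) by apply: derN; apply: derMc; exact: derI.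
    exact: der_continuous.
  have cvr : {for t, continuous vr}.
    apply: cvgM; first exact: ck.
    by apply: cvgB; apply: cvgM; [exact: cvg_cst|exact: c3|exact: cvg_cst|exact: c4].
  have cvi : {for t, continuous vi}.
    apply: cvgM; first exact: ck.
    by apply: cvgD; apply: cvgM; [exact: cvg_cst|exact: c4|exact: cvg_cst|exact: c3].
  have ce : {for t, continuous (fun t => expR (- (2 * `|q|) * t))}.
    have : der (fun t => expR (- (2 * `|q|) * t)) t (- (2 * `|q|) * 1 * expR (- (2 * `|q|) * t)).
      by apply: derexp; apply: derMc; exact: derI.
    exact: der_continuous.
  apply: cvgM; last exact: ce.
  apply: cvgD; first by apply: cvgD; [exact: (cvgM cvr cvr)|exact: (cvgM cvi cvi)].
  apply: cvgM; first exact: cvg_cst.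
  have c1 := der_continuous h1; have c2 := der_continuous h2.
  by apply: cvgD; [exact: (cvgM c1 c1)|exact: (cvgM c2 c2)].
pose f' t := (2 * (vr t * (- (A * w0r t - B * w0i t) - (2 * beta + 1) / t * vr t) +
   vi t * (- (A * w0i t + B * w0r t) - (2 * beta + 1) / t * vi t)) +
   (p ^+ 2 + q ^+ 2) * (2 * (w0r t * vr t + w0i t * vi t)) - 2 * `|q| * W t) *
   expR (- (2 * `|q|) * t).
have df t : 0 < t -> der f t (f' t).
  move=> t0; have [h1 h2] := dw0 t; have [h3 h4] := dv t t0.
  apply: derE.
    apply: derM; last by apply: derexp; apply: derMc; exact: derI.
    apply: derD; first by apply: derD; [exact: derX h3|exact: derX h4].
    by apply: derMc; apply: derD; [exact: derX h1|exact: derX h2].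
  rewrite /f' -/(W t) /= !expr1.
  by move: (expR _) (W t) (2 * beta + 1) (t^-1) => E V s ti; ring.
have f'le t : 0 < t -> f' t <= 0.
  move=> t0; rewrite /f' pmulr_lle0 ?expR_gt0//.
  have bt : 0 <= (2 * beta + 1) / t by rewrite divr_ge0 ?(ltW t0)//; lra.
  rewrite /W; move: (vr t) (vi t) (w0r t) (w0i t) ((2 * beta + 1) / t) bt => a b c d s s0.
  (* With [e = 1] and [e = -1] these sums of two squares give [2 |Q| <= V], where [4 q Q] is the
     undamped part of the derivative of the energy [V]. *)
  have sq (e : R) : e ^+ 2 = 1 -> 0 <= a ^+ 2 + b ^+ 2 + (p ^+ 2 + q ^+ 2) * (c ^+ 2 + d ^+ 2)
      - 2 * e * (q * (c * a + d * b) + p * (a * d - b * c)).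
    move=> e1; have := addr_ge0 (sqr_ge0 (a - e * (q * c + p * d))) (sqr_ge0 (b - e * (q * d - p * c))).
    have -> : (a - e * (q * c + p * d)) ^+ 2 + (b - e * (q * d - p * c)) ^+ 2 =
      a ^+ 2 + b ^+ 2 + e ^+ 2 * ((p ^+ 2 + q ^+ 2) * (c ^+ 2 + d ^+ 2))
      - 2 * e * (q * (c * a + d * b) + p * (a * d - b * c)) by ring.
    by rewrite e1 mul1r.
  have eN : (-1) ^+ 2 = 1 :> R by rewrite sqrrN expr1n.
  have s1 := sq 1 (expr1n _ _); have s2 := sq (-1) eN.
  have sab : 0 <= s * (a ^+ 2 + b ^+ 2) by rewrite mulr_ge0 ?addr_ge0 ?sqr_ge0.
  set V := a ^+ 2 + b ^+ 2 + _ in s1 s2 *.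
  set Q := q * (c * a + d * b) + p * (a * d - b * c) in s1 s2.
  have -> : 2 * (a * (- (A * c - B * d) - s * a) + b * (- (A * d + B * c) - s * b)) +
      (p ^+ 2 + q ^+ 2) * (2 * (c * a + d * b)) - 2 * `|q| * V =
      4 * q * Q - 2 * `|q| * V - 2 * (s * (a ^+ 2 + b ^+ 2)).
    by rewrite AE BE /Q; ring.
  move: s1 s2 sab; clear; move: Q V (s * _) => Q V S s1 s2 sab.
  case: (ger0P q) => q0; nra.
(* The mean value theorem asks for the derivative only in the open interval, which avoids the
   singular coefficient [1 / t] at 0. *)
have [s sin] := @MVT R f f' 0 1 ltr01
  (fun x xin => df x (proj1 (andP xin))) cf.
have s0 : 0 < s by move: sin; rewrite in_itv/= => /andP[].
have := f'le s s0; rewrite subr0 mulr1 => fs E.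
have W1le : f 1 <= f 0 by rewrite -subr_le0 E.
have f0 : f 0 = p ^+ 2 + q ^+ 2.
  rewrite /f /W /vr /vi !mulr0 expR0 mulr1 oppr0 !mul0r expr0n !add0r.
  rewrite /w0r /w0i /W0 mul0r /JC (csum0 g0) bc0//= expr1n expr0n addr0.
  by rewrite mulr1.
have n0 : 0 < p ^+ 2 + q ^+ 2.
  rewrite -nc_sqr exprn_gt0// lt_neqAle nc_ge0 andbT.
  by apply: contra z0 => /eqP h; apply/eqP; exact: nc_eq0.
rewrite f0 /f mulr1 expRN ler_pdivrMr ?expR_gt0// in W1le.
have : nc (JC beta zeta) ^+ 2 <= expR (2 * `|q|).
  rewrite -(ler_pM2l n0); apply: le_trans W1le.
  rewrite /W /w0r /w0i /W0 mul1r nc_sqr lerDr.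
  by rewrite addr_ge0 ?sqr_ge0.
rewrite expRM_natl ler_pXn2r ?nnegrE ?nc_ge0 ?expR_ge0//.
Qed.

End Bessel.

(** * The measure as a density, and Gaussian moments *)

Section Weight.
Context {R : realType} (k : R) (n : nat).
Hypotheses (n1 : (1 <= n)%N) (hk : (n%:R - 1) / (2 * n%:R) <= k).
Local Notation leb := (@lebesgue_measure R).
Local Notation mu := (mu_kn k n).
Local Notation al := (alpha k n).

Lemma n_gt0 : (0 : R) < n%:R. Proof. by rewrite ltr0n. Qed.

Lemma alpha_ge : - 2^-1 <= al.
Proof.
have n0 := n_gt0; move: hk; rewrite ler_pdivrMr ?mulr_gt0// /alpha; lra.
Qed.

Lemma alpha1_gt0 : 0 < al + 1.
Proof. by have := alpha_ge; lra. Qed.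

Lemma GammaA_gt0 : 0 < Gamma (al + 1). Proof. exact: Gamma_gt0 alpha1_gt0. Qed.

Lemma weight_ge0 x : 0 <= weight_kn k n x.
Proof.
rewrite /weight_kn !mulr_ge0 ?powR_ge0// invr_ge0 mulr_ge0// ltW//.
exact: GammaA_gt0.
Qed.

Lemma max_weight x : Num.max (weight_kn k n x) 0 = weight_kn k n x.
Proof. by apply/max_idPl; exact: weight_ge0. Qed.

Lemma measurable_weight : measurable_fun setT (weight_kn k n).
Proof.
apply: measurable_funM => //.
by apply: (measurableT_comp (measurable_powR _)); exact: normr_measurable.
Qed.

Import HBNNSimple.

(** [mu] is given by its density on sets only; linearity extends this to simple functions and
    monotone convergence to nonnegative measurable ones. *)
Lemma ge0_integral_density (D : set R) (f : R -> \bar R) : measurable D ->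
  measurable_fun D f -> (forall x, 0 <= f x)%E ->
  (\int[mu]_(x in D) f x = \int[leb]_(x in D) (f x * (weight_kn k n x)%:E))%E.
Proof.
move=> mD mf f0; pose w x := (weight_kn k n x)%:E.
have w0 x : (0 <= w x)%E by rewrite lee_fin weight_ge0.
have mw A : measurable_fun A w.
  by apply: measurable_funTS; apply/measurable_EFinP; exact: measurable_weight.
have muE A : mu A = (\int[leb]_(x in A) w x)%E.
  by apply: eq_integral => x _; rewrite max_weight.
pose h := nnsfun_approx mD mf.
pose hf i : R -> R := h i.
have nd (x : R) (a b : nat) : (a <= b)%N -> (hf a x <= hf b x)%R.
  by move=> ab; exact/lefP/nd_nnsfun_approx.
have cvh x : D x -> ((hf i x)%:E @[i --> \oo] --> f x)%E.
  by move=> Dx; exact: cvg_nnsfun_approx.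
have step i : (\int[mu]_(x in D) (hf i x)%:E = \int[leb]_(x in D) ((hf i x)%:E * w x))%E.
  have mI r : measurable (h i @^-1` [set r]) by exact: measurable_sfunP.
  have E x : (hf i x)%:E = (\sum_(y \in range (h i)) (y * \1_(h i @^-1` [set y]) x)%:E)%E.
    by rewrite fsumEFin// -(fimfunE (h i) x).
  under eq_integral do rewrite E.
  under [RHS]eq_integral => x _.
    rewrite E ge0_mule_fsuml; last by move=> y; exact: nnfun_muleindic_ge0.
    over.
  have mind r : measurable_fun D (fun x => (r * \1_(h i @^-1` [set r]) x)%:E).
    by apply/measurable_EFinP; exact: measurable_funM.
  rewrite ge0_integral_fsum//; last by move=> r x _; exact: nnfun_muleindic_ge0.
  rewrite [RHS]ge0_integral_fsum//; last 2 first.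
  - by move=> r; apply: emeasurable_funM; [exact: mind|exact: mw].
  - by move=> r x _; apply: mule_ge0; [exact: nnfun_muleindic_ge0|exact: w0].
  apply: eq_fsbigr => r; rewrite inE => -[t _ rE].
  have r0 : 0 <= r by rewrite -rE.
  under eq_integral do rewrite EFinM.
  under [RHS]eq_integral do rewrite EFinM -muleA.
  rewrite ge0_integralZl_EFin//; last first.
    by apply/measurable_EFinP; apply: measurable_indic; exact: mI.
  rewrite [RHS]ge0_integralZl_EFin//; last 2 first.
  - by move=> x _; apply: mule_ge0 => //; rewrite lee_fin.
  - apply: emeasurable_funM; last exact: mw.
    by apply/measurable_EFinP; apply: measurable_indic; exact: mI.
  congr (_ * _)%E; rewrite integral_indic//; apply: (etrans (muE _)); rewrite setIC integral_mkcondr.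
  by apply: eq_integral => x _; rewrite epatch_indic muleC.
have -> : (\int[mu]_(x in D) f x = limn (fun i => \int[mu]_(x in D) (hf i x)%:E))%E.
  rewrite -monotone_convergence//.
  - by apply: eq_integral => x /[!inE] Dx; apply/esym/cvg_lim => //; exact: cvh.
  - by move=> i; apply/measurable_EFinP; apply: measurable_funTS.
  - by move=> i x _; rewrite lee_fin.
  - by move=> x _ a b ab; rewrite lee_fin; exact: nd.
have -> : (\int[leb]_(x in D) (f x * (weight_kn k n x)%:E) =
    limn (fun i => \int[leb]_(x in D) ((hf i x)%:E * w x)))%E.
  rewrite -monotone_convergence//.
  - apply: eq_integral => x /[!inE] Dx; apply/esym/cvg_lim => //.
    by apply: cvgeZr => //; exact: cvh.
  - move=> i; apply: emeasurable_funM; last exact: mw.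
    by apply/measurable_EFinP; apply: measurable_funTS; exact: (measurable_funPT (h i)).
  - by move=> i x _; rewrite mule_ge0// lee_fin.
  - by move=> x _ a b ab; rewrite lee_wpmul2r// lee_fin; exact: nd.
by congr (limn _); apply/funext => i; exact: step.
Qed.

Definition nroot (x : R) : R := `|x| `^ n%:R^-1.

Lemma U_ge0 x : 0 <= nroot x. Proof. exact: powR_ge0. Qed.

Lemma measurable_U : measurable_fun setT nroot.
Proof. by apply: (measurableT_comp (measurable_powR _)); exact: normr_measurable. Qed.

Lemma UX x m : nroot x ^+ m.+1 = `|x| `^ (m.+1%:R / n%:R).
Proof.
rewrite -powR_mulrn ?U_ge0// /nroot -powRrM mulrC.
by [].
Qed.

Lemma U2 x : `|x| `^ (2 / n%:R) = nroot x ^+ 2. Proof. by rewrite UX. Qed.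

Lemma Un x : nroot x ^+ n = `|x|.
Proof.
move: n1; rewrite /nroot; case: n => [//|m] _.
by rewrite -powR_mulrn ?powR_ge0// -powRrM mulVf ?powRr1.
Qed.

Lemma even_integral (f : R -> R) : measurable_fun setT f -> (forall x, 0 <= f x) ->
  (forall x, f (- x) = f x) ->
  (\int[leb]_x (f x)%:E = 2%:E * \int[leb]_(x in [set t | (0 < t)%R]) (f x)%:E)%E.
Proof.
move=> mf f0 fe.
have mE A : measurable_fun A (EFin \o f) by apply: measurable_funTS; exact/measurable_EFinP.
have s1 : (\int[leb]_(x in [set t | (0 < t)%R]) (f x)%:E = \int[leb]_(x in `[0%R, +oo[) (f x)%:E)%E.
  rewrite -integral_itv_obnd_cbnd//; congr (integral _ _ _).
  by apply/seteqP; split => x /=; rewrite in_itv/= andbT.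
have s2 : (\int[leb]_(x in `]-oo, 0%R[) (f x)%:E = \int[leb]_(x in `[0%R, +oo[) (f x)%:E)%E.
  rewrite (ge0_integration_by_substitution0 (f := EFin \o f))//.
  rewrite integral_itv_bndo_bndc//.
  by apply: eq_integral => x _ /=; rewrite fe.
rewrite s1 -(setUv `]-oo, 0%R[%classic) ge0_integral_setU//=; last 4 first.
- exact: measurableC.
- exact: mE.
- by move=> x _; rewrite lee_fin.
- exact/disj_setPCl.
by rewrite setCitvl s2 mule_natl mule2n.
Qed.

(** The constant for which [exp (- c U^2)] times [U^(2 m)] integrates to [KG th * c ^ (- th)] with
    [th = alpha + 1 + m]. *)
Definition KG (th : R) : R := (n%:R / 2) `^ (al + 1) * Gamma th / Gamma (al + 1).

Lemma gauss_moment (c : R) (m : nat) : 0 < c ->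
  (\int[mu]_x (nroot x ^+ (2 * m) * expR (- (c * nroot x ^+ 2)))%:E =
   (KG (al + 1 + m%:R) * c `^ (- (al + 1 + m%:R)))%:E)%E.
Proof.
move=> c0; have n0 := n_gt0.
have th0 : 0 < al + 1 + m%:R by rewrite ltr_pwDl// alpha1_gt0.
have mf : measurable_fun setT (fun x => nroot x ^+ (2 * m) * expR (- (c * nroot x ^+ 2))).
  apply: measurable_funM; first by apply: measurable_funX; exact: measurable_U.
  apply: measurableT_comp => //; apply: measurable_funN; apply: measurable_funM => //.
  by apply: measurable_funX; exact: measurable_U.
rewrite ge0_integral_density//; last 2 first.
- exact/measurable_EFinP.
- by move=> x; rewrite lee_fin mulr_ge0 ?expR_ge0// exprn_ge0// U_ge0.
under eq_integral do rewrite -EFinM.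
rewrite even_integral; last 3 first.
- by apply: measurable_funM => //; exact: measurable_weight.
- move=> x; rewrite mulr_ge0 ?weight_ge0// mulr_ge0 ?expR_ge0//.
  by rewrite exprn_ge0// U_ge0.
- by move=> x; rewrite /nroot /weight_kn normrN.
pose cw := (2 * Gamma (al + 1))^-1 * (n%:R / 2) `^ al.
have cw0 : 0 <= cw.
  by rewrite mulr_ge0 ?powR_ge0// invr_ge0 mulr_ge0// ltW// GammaA_gt0.
have p0 : (0 : R) < 2 / n%:R by rewrite divr_gt0.
transitivity (2%:E * (\int[leb]_(x in [set t | (0 < t)%R])
   (cw%:E * (x `^ (2 / n%:R * (al + 1 + m%:R) - 1) *
     expR (- (c * x `^ (2 / n%:R))))%:E)))%E.
  congr (_ * _)%E; apply: eq_integral => x; rewrite inE /= => x0.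
  rewrite -EFinM; congr EFin; rewrite /weight_kn -/cw -U2 (gtr0_norm x0).
  have -> : nroot x ^+ (2 * m) = x `^ ((2 * m)%:R / n%:R).
    case: m {th0 mf} => [|m]; first by rewrite muln0 expr0 mul0r powRr0.
    by rewrite mulnS UX (gtr0_norm x0).
  have -> : 2 / n%:R * (al + 1 + m%:R) - 1 =
      (2 * m)%:R / n%:R + (2 * k + 2 / n%:R - 2).
    by rewrite /alpha natrM; field; rewrite gt_eqF.
  rewrite (@powRD _ x ((2 * m)%:R / n%:R)); last by rewrite (gt_eqF x0) implybT.
  ring.
rewrite ge0_integralZl_EFin//; last 3 first.
- exact: measurable_pos.
- by move=> x _; rewrite lee_fin mulr_ge0 ?powR_ge0 ?expR_ge0.
- apply/measurable_EFinP; apply: measurable_funTS; apply: measurable_funM.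
    exact: measurable_powR.
  apply: measurableT_comp => //; apply: measurable_funN; apply: measurable_funM.
    exact: measurable_cst.
  exact: measurable_powR.
rewrite power_gauss_integral// -!EFinM; congr EFin.
rewrite /KG /cw powRD; last by rewrite (gt_eqF (divr_gt0 _ _)) ?implybT.
rewrite powRr1 ?divr_ge0//.
by field; rewrite !gt_eqF// GammaA_gt0.
Qed.

End Weight.

(** * Determinacy of the moment problem under exponential integrability *)

Section MomentProblem.
Context {d : measure_display} {T : measurableType d} {R : realType}.
Variables (mu : {measure set T -> \bar R}) (v H : T -> R) (c : R).
Hypotheses (mv : measurable_fun setT v) (v0 : forall x, 0 <= v x).
Hypotheses (mH : measurable_fun setT H) (c0 : 0 < c).
Hypothesis intH : mu.-integrable setT (fun x => (H x * expR (c * v x))%:E).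

Lemma pow_le_expR (e x : R) m : 0 < e -> 0 <= x ->
  x ^+ m <= m`!%:R / e ^+ m * expR (e * x).
Proof.
move=> e0 x0; rewrite mulrAC ler_pdivlMr ?exprn_gt0// -exprMn [x * e]mulrC.
have ex0 : 0 <= e * x by rewrite mulr_ge0// ltW.
case: m => [|m]; first by rewrite expr0 fact0 mul1r -expR0 ler_expR.
rewrite -ler_pdivrMl ?ltr0n ?fact_gt0//.
by have := expR_ge1Dxn m ex0; rewrite [_ / _]mulrC; move: (_^-1 * _) => u; lra.
Qed.

Lemma integrable_weight (w : T -> R) (C : R) : measurable_fun setT w ->
  (forall x, `|w x| <= C * expR (c * v x)) ->
  mu.-integrable setT (fun x => (H x * w x)%:E).
Proof.
move=> mw hw.
have C0 : 0 <= C.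
  rewrite leNgt; apply/negP => C_lt0; have /integrableP[_] := intH => _.
  have := hw point; rewrite leNgt => /negP; apply.
  by apply: lt_le_trans (normr_ge0 _); rewrite nmulr_rlt0// expR_gt0.
apply: (@le_integrable _ _ _ _ _ _ _ (fun x => (C * (H x * expR (c * v x)))%:E)) => //.
- by apply/measurable_EFinP; exact: measurable_funM.
- move=> x _; rewrite !abse_EFin lee_fin !normrM (ger0_norm C0) (ger0_norm (expR_ge0 _)).
  by rewrite mulrCA ler_wpM2l.
- under eq_fun do rewrite EFinM.
  exact: integrableZl.
Qed.

Hypothesis moments : forall m, \int[mu]_x (H x * v x ^+ m) = 0.

(** Expand [exp (- e v)] in its power series, each term of which integrates to 0. For [e <= c / 2]
    the partial sums are dominated by [exp (c v / 2)], and the other half of the exponent dominates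
    [v^m]. *)
Lemma laplace_moments_step s e m : 0 <= s -> 0 <= e <= c / 2 ->
  (forall m, \int[mu]_x (H x * (expR (- s * v x) * v x ^+ m)) = 0) ->
  \int[mu]_x (H x * (expR (- (s + e) * v x) * v x ^+ m)) = 0.
Proof.
move=> s0 /andP[e0 ec] hs; have c2 : 0 < c / 2 by rewrite divr_gt0.
pose C := m`!%:R / (c / 2) ^+ m.
have C0 : 0 <= C by rewrite divr_ge0// exprn_ge0// ltW.
pose part M x := \sum_(0 <= l < M) ((- e) ^+ l / l`!%:R) * v x ^+ l.
have mp (j : nat) : measurable_fun setT (fun x => v x ^+ j).
  exact: measurable_funX.
have me s' : measurable_fun setT (fun x => expR (- s' * v x)).
  by apply: measurableT_comp => //; exact: measurable_funM.
have mpart M : measurable_fun setT (part M).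
  apply: measurable_sum => l; apply: measurable_funM => //.
have partle M x : `|part M x| <= expR (c / 2 * v x).
  apply: (le_trans (ler_norm_sum _ _ _)).
  apply: (@le_trans _ _ (\sum_(0 <= l < M) (e * v x) ^+ l / l`!%:R)).
    apply: ler_sum => l _; rewrite !normrM normrX normrN (ger0_norm e0) normfV.
    rewrite (@ger0_norm _ l`!%:R)// (ger0_norm (exprn_ge0 _ (v0 x))).
    by rewrite exprMn mulrAC.
  apply: (@le_trans _ _ (expR (e * v x))); last first.
    by rewrite ler_expR ler_wpM2r.
  have ev : 0 <= e * v x by rewrite mulr_ge0.
  have h := @is_cvg_series_exp_coeff R (e * v x).
  have := nondecreasing_cvgn_le _ h M; apply.
  by apply/nondecreasing_series => // k _ _; exact: exp_coeff_ge0.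
have esv x : `|expR (- s * v x)| <= 1.
  rewrite ger0_norm ?expR_ge0// expR_le1 mulNr oppr_le0.
  exact: mulr_ge0.
have vm x : v x ^+ m <= C * expR (c / 2 * v x) by exact: pow_le_expR.
pose f M x := (H x * (expR (- s * v x) * v x ^+ m * part M x))%:E.
pose f0 x := (H x * (expR (- (s + e) * v x) * v x ^+ m))%:E.
pose g x := `|(C * (H x * expR (c * v x)))%:E|%E.
have ig : mu.-integrable setT g.
  apply: integrable_abse; under eq_fun do rewrite EFinM.
  exact: integrableZl.
have bnd M x : `|expR (- s * v x) * v x ^+ m * part M x| <= C * expR (c * v x).
  rewrite !normrM (ger0_norm (exprn_ge0 m (v0 x))).
  have -> : expR (c * v x) = expR (c / 2 * v x) * expR (c / 2 * v x).
    by rewrite -expRD -mulrDl -splitr.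
  rewrite mulrA ler_pM ?mulr_ge0 ?exprn_ge0 ?normr_ge0//.
  rewrite -[leRHS]mul1r ler_pM ?exprn_ge0//.
have fM M : (\int[mu]_x f M x = 0)%E.
  have E x : f M x = (\sum_(0 <= l < M) (((- e) ^+ l / l`!%:R)%:E *
      (H x * (expR (- s * v x) * v x ^+ (m + l)))%:E))%E.
    rewrite /f /part mulr_sumr mulr_sumr -sumEFin; apply: eq_bigr => l _.
    by rewrite -EFinM exprD; congr EFin; ring.
  have il l : mu.-integrable setT (fun x => (H x * (expR (- s * v x) * v x ^+ l))%:E).
    apply: (@integrable_weight _ (l`!%:R / c ^+ l)).
      exact: measurable_funM.
    move=> x; rewrite normrM (ger0_norm (exprn_ge0 l (v0 x))) -[leRHS]mul1r ler_pM//.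
      exact: exprn_ge0.
    exact: pow_le_expR.
  under eq_integral do rewrite E.
  rewrite integral_sum//; last by move=> l; exact: integrableZl.
  rewrite big1// => l _; rewrite integralZl//.
  have := hs (m + l)%N; rewrite /Rintegral => h.
  have /fineK <- : (\int[mu]_x (H x * (expR (- s * v x) * v x ^+ (m + l)))%:E)%E \is a fin_num.
    exact: integrable_fin_num.
  by rewrite h mule0.
have A1 M : measurable_fun setT (f M).
  apply/measurable_EFinP; apply: measurable_funM => //.
  by apply: measurable_funM => //; exact: measurable_funM.
have A2 : measurable_fun setT f0.
  by apply/measurable_EFinP; apply: measurable_funM => //; exact: measurable_funM.
have A3 : {ae mu, forall x, setT x -> f ^~ x @ \oo --> f0 x}.
  apply: aeW => x _; apply: cvg_EFin; first exact: nearW.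
  apply: cvgM; first exact: cvg_cst.
  have -> : expR (- (s + e) * v x) * v x ^+ m =
      expR (- s * v x) * v x ^+ m * expR (- e * v x).
    by rewrite opprD mulrDl expRD; ring.
  apply: cvgM; first exact: cvg_cst.
  have -> : part^~ x = series (exp_coeff (- e * v x)).
    apply/funext => M; rewrite /part /series /=; apply: eq_bigr => l _.
    by rewrite /exp_coeff /= exprMn mulrAC.
  exact: is_cvg_series_exp_coeff.
have A5 : {ae mu, forall x M, setT x -> (`|f M x| <= g x)%E}.
  apply: aeW => x M _; rewrite /f /g !abse_EFin lee_fin [leLHS]normrM.
  rewrite [leRHS]normrM (ger0_norm C0) (normrM (H x)) (ger0_norm (expR_ge0 (c * v x))).
  by rewrite [leRHS]mulrCA ler_wpM2l.
have [_ _ cv0] := @dominated_convergence _ _ _ mu setT measurableT f f0 g A1 A2 A3 ig A5.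
rewrite /Rintegral; suff -> : (\int[mu]_x f0 x = 0)%E by [].
rewrite (_ : (fun M => _) = fun=> 0%E) in cv0; last by apply/funext => M; exact: fM.
by apply/esym; apply: (cvg_unique _ (cvg_cst 0%E) cv0).
Qed.

(** Analytic continuation by hand: finitely many steps of length at most [c / 2] reach any [s]. *)
Lemma laplace_zero s : 0 <= s -> \int[mu]_x (H x * expR (- s * v x)) = 0.
Proof.
move=> s0; pose N := (Num.trunc (2 * s / c)).+1.
pose e := s / N%:R.
have e0 : 0 <= e by rewrite divr_ge0.
have N0 : (0 : R) < N%:R by rewrite ltr0n.
have ec : e <= c / 2.
  have sc : 0 <= 2 * s / c by rewrite divr_ge0 ?mulr_ge0// ltW.
  have /andP[_ /ltW] := truncn_itv sc; rewrite -/N ler_pdivrMr// => h.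
  by rewrite /e ler_pdivrMr// mulrAC ler_pdivlMr// mulrC (mulrC c).
have P j m : \int[mu]_x (H x * (expR (- (j%:R * e) * v x) * v x ^+ m)) = 0.
  elim: j m => [|j IH] m.
    rewrite -[RHS](moments m); apply: eq_Rintegral => x _.
    by rewrite mul0r oppr0 mul0r expR0 mul1r.
  rewrite -natr1 mulrDl mul1r; apply: laplace_moments_step => //.
    by rewrite mulr_ge0.
  by rewrite e0.
have := P N 0%N; rewrite /e mulrCA mulfV ?mulr1 ?gt_eqF// => h.
by rewrite -[RHS]h; apply: eq_Rintegral => x _; rewrite expr0 mulr1.
Qed.

(** With [q = exp (- s v)] normalized to be 1/2 at [v = V], the functions [(1 - q^N)^(2^N)] are
    polynomials in [q], so they integrate to 0 against [H]. They tend to 1 where [2 q < 1], by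
    Bernoulli, and to 0 where [2 q > 1], being at most [exp (- (2 q)^N)]. The limit is the indicator
    of [v > V] off the level set, which is null. *)
Lemma threshold_zero V : 0 < V -> mu [set x | v x = V] = 0%E ->
  \int[mu]_(x in [set x | V < v x]) H x = 0.
Proof.
move=> V0 muV; pose s := ln 2 / V.
have ln2 : (0 : R) < ln 2 by rewrite ln_gt0// ltr1n.
have s0 : 0 < s by rewrite divr_gt0.
have sV : ln 2 = s * V by rewrite divfK// gt_eqF.
pose q x := expR (- s * v x).
have q01 x : 0 < q x <= 1.
  rewrite expR_gt0 /= expR_le1 mulNr oppr_le0 mulr_ge0//; exact: ltW.
have mq : measurable_fun setT q by apply: measurableT_comp => //; exact: measurable_funM.
pose w (N : nat) x := (1 - q x ^+ N) ^+ (2 ^ N).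
have w01 N x : 0 <= w N x <= 1.
  have /andP[q0 q1] := q01 x; have qN1 : q x ^+ N <= 1 by rewrite exprn_ile1// ltW.
  have qN0 : 0 <= q x ^+ N by rewrite exprn_ge0// ltW.
  by rewrite exprn_ge0 ?subr_ge0//= exprn_ile1 ?subr_ge0// lerBlDr lerDl.
have mw N : measurable_fun setT (w N).
  apply: measurable_funX; apply: measurable_funB => //; exact: measurable_funX.
have e1 x : 1 <= expR (c * v x) by rewrite -expR0 ler_expR mulr_ge0// ltW.
have iw N : (\int[mu]_x (H x * w N x)%:E = 0)%E.
  have E x : (H x * w N x)%:E = (\sum_(0 <= i < (2 ^ N).+1)
      ((-1) ^+ i *+ 'C(2 ^ N, i))%:E * (H x * expR (- (s * (N * i)%:R) * v x))%:E)%E.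
    rewrite /w exprDn mulr_sumr big_mkord -sumEFin; apply: eq_bigr => i _.
    rewrite -EFinM; congr EFin; rewrite expr1n mul1r (exprNn (q x ^+ N)) -exprM.
    rewrite (_ : q x ^+ (N * i) = expR (- (s * (N * i)%:R) * v x)).
      move: ('C(2 ^ N, i)) (expR _) => K e.
      by rewrite mulrnAr mulrnAl mulrCA.
    by rewrite /q -expRM_natl; congr expR; ring.
  have il t : 0 <= t -> mu.-integrable setT (fun x => (H x * expR (- t * v x))%:E).
    move=> t0; apply: (@integrable_weight _ 1).
      by apply: measurableT_comp => //; exact: measurable_funM.
    move=> x; rewrite mul1r ger0_norm ?expR_ge0// ler_expR mulNr.
    by apply: (@le_trans _ _ 0); rewrite ?oppr_le0 mulr_ge0// ltW.
  have sN i : 0 <= s * (N * i)%:R by rewrite mulr_ge0// ltW.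
  under eq_integral do rewrite E.
  rewrite integral_sum//; last by move=> i; apply: integrableZl => //; exact: il.
  rewrite big1// => i _; rewrite integralZl//; last exact: il.
  have := laplace_zero (sN i); rewrite /Rintegral => h.
  have /fineK <- : (\int[mu]_x (H x * expR (- (s * (N * i)%:R) * v x))%:E)%E \is a fin_num.
    by apply: integrable_fin_num => //; exact: il.
  by rewrite h mule0.
pose D := [set x | V < v x].
have mD : measurable D.
  rewrite (_ : D = v @^-1` `]V, +oo[%classic); last first.
    by apply/seteqP; split => x /=; rewrite in_itv/= andbT.
  by rewrite -[X in measurable X]setTI; exact: mv.
pose f0 := (EFin \o H) \_ D.
have mf0 : measurable_fun setT f0.
  apply/(measurable_restrictT _ mD)%classic.
  by apply: measurable_funTS; exact/measurable_EFinP.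
have bernoulli (M : nat) (t : R) : 0 <= t <= 1 -> 1 - M%:R * t <= (1 - t) ^+ M.
  move=> /andP[t0 t1]; elim: M => [|M IH]; first by rewrite mul0r subr0 expr0.
  rewrite exprS; apply: (@le_trans _ _ ((1 - t) * (1 - M%:R * t))).
    have M0 : (0 : R) <= M%:R by [].
    have : 0 <= M%:R * t * t by rewrite !mulr_ge0.
    by rewrite -natr1; lra.
  by rewrite ler_wpM2l// subr_ge0.
pose g x := `|(H x * expR (c * v x))%:E|%E.
have A1 N : measurable_fun setT (fun x => (H x * w N x)%:E).
  by apply/measurable_EFinP; exact: measurable_funM.
have A3 : {ae mu, forall x, setT x -> (fun N => (H x * w N x)%:E) @ \oo --> f0 x}.
  exists [set x | v x = V]; split => //.
      have := mv measurableT (measurable_set1 V).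
      by rewrite setTI.
    move=> x; apply: contra_notP => /eqP vV _.
    move: vV; rewrite neq_lt => /orP[vV|Vv].
      rewrite /f0 patchE memNset; last by rewrite /D /=; apply/negP; rewrite -leNgt ltW.
      rewrite (_ : point = (H x * 0)%:E); last by rewrite mulr0.
      apply: cvg_EFin; first exact: nearW.
      apply: cvgM; first exact: cvg_cst.
      have q2 : 1 < 2 * q x.
        have -> : 2 = expR (ln 2) :> R by rewrite lnK// posrE.
        rewrite sV /q -expRD -expR0 ltr_expR mulNr.
        have : 0 < s * (V - v x) by rewrite mulr_gt0// subr_gt0.
        by rewrite mulrBr.
      have u0 : ((2 * q x)^-1) ^+ N @[N --> \oo] --> (0 : R).
        apply: cvg_expr; rewrite ger0_norm ?invr_ge0; last lra.
        by rewrite invf_lt1//; lra.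
      apply: (squeeze_cvgr _ (cvg_cst (0 : R)) u0); apply: nearW => N.
      have /andP[w0 _] := w01 N x; rewrite w0 /=.
      have h1 : 1 - q x ^+ N <= expR (- q x ^+ N) by have := expR_ge1Dx (- q x ^+ N).
      apply: (@le_trans _ _ (expR (- q x ^+ N) ^+ (2 ^ N))).
        have /andP[q0 q1] := q01 x; have qN1 : q x ^+ N <= 1 by rewrite exprn_ile1// ltW.
        by rewrite lerXn2r ?nnegrE ?subr_ge0 ?expR_ge0.
      rewrite -expRM_natl mulrN natrX -exprMn expRN exprVn.
      have p0 : 0 < (2 * q x) ^+ N by rewrite exprn_gt0//; lra.
      rewrite lef_pV2 ?posrE ?expR_gt0//.
      by have := expR_ge1Dx ((2 * q x) ^+ N); lra.
    rewrite /f0 patchE mem_set//= -[X in _ --> X%:E](mulr1 (H x)).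
    apply: cvg_EFin; first exact: nearW.
    apply: cvgM; first exact: cvg_cst.
    have q2 : 2 * q x < 1.
      have -> : 2 = expR (ln 2) :> R by rewrite lnK// posrE.
      rewrite sV /q -expRD -[ltRHS]expR0 ltr_expR mulNr.
      have : 0 < s * (v x - V) by rewrite mulr_gt0// subr_gt0.
      by rewrite mulrBr subr_gt0 subr_lt0.
    have /andP[q0 q1] := q01 x.
    have u0 : 1 - (2 * q x) ^+ N @[N --> \oo] --> (1 : R).
      rewrite -[X in _ --> X]subr0; apply: cvgB; first exact: cvg_cst.
      by apply: cvg_expr; rewrite ger0_norm// mulr_ge0// ltW.
    apply: (squeeze_cvgr _ u0 (cvg_cst (1 : R))); apply: nearW => N.
    have /andP[_ w1] := w01 N x; rewrite w1 andbT.
    apply: (le_trans _ (bernoulli _ _ _)); first by rewrite natrX exprMn.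
    by rewrite exprn_ge0 ?exprn_ile1// ltW.
have A4 : mu.-integrable setT g by exact: integrable_abse.
have A5 : {ae mu, forall x N, setT x -> (`|(H x * w N x)%:E| <= g x)%E}.
  apply: aeW => x N _; rewrite /g !abse_EFin lee_fin !normrM ler_wpM2l//.
  have /andP[w0 w1] := w01 N x; rewrite !ger0_norm ?expR_ge0//.
  exact: le_trans (e1 x).
have [_ _ cv0] := @dominated_convergence _ _ _ mu setT measurableT
  (fun N x => (H x * w N x)%:E) f0 g A1 mf0 A3 A4 A5.
rewrite (_ : (fun N => _) = fun=> 0%E) in cv0; last by apply/funext => N; exact: iw.
rewrite /Rintegral integral_mkcond -/f0.
have -> : (\int[mu]_x f0 x = 0)%E; last by [].
by apply/esym; apply: (cvg_unique _ (cvg_cst 0%E) cv0).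
Qed.

End MomentProblem.

(** * Closure properties of entire functions, and the criterion for being constant *)

Section EntireConstant.
Context {R : realType}.
Implicit Types (z w : R[i]) (g h : R[i] -> R[i]).
Local Notation nc := (@ComplexField.Normc.normc R).
Local Notation Re := (@complex.Re R).
Local Notation Im := (@complex.Im R).

Lemma poly_bounded (p : {poly R[i]}) (r : R) :
  exists2 M, 0 <= M & forall z, nc z <= r -> nc p.[z] <= M.
Proof.
have [L L0 hL] := poly_lipschitz p r.
case: (ltP r 0) => r0.
  by exists 0 => // z zr; have := nc_ge0 z; lra.
exists (nc p.[0] + L * r) => [|z zr]; first by rewrite addr_ge0 ?mulr_ge0 ?nc_ge0.
have -> : p.[z] = p.[0] + (p.[z] - p.[0]) by ring.
rewrite (le_trans (ncD _ _))// lerD2l (le_trans (hL _ _ zr _)) ?nc0// subr0.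
exact: ler_wpM2l.
Qed.

Lemma papx_bounded g (r : R) : papx g ->
  exists2 M, 0 <= M & forall z, nc z <= r -> nc (g z) <= M.
Proof.
move=> pg; have [p hp] := pg r 1 ltr01; have [M M0 hM] := poly_bounded p r.
exists (1 + M) => [|z zr]; first by rewrite addr_ge0.
have -> : g z = (g z - p.[z]) + p.[z] by ring.
by rewrite (le_trans (ncD _ _))// lerD ?hp ?hM.
Qed.

Lemma papxD g h : papx g -> papx h -> papx (fun z => g z + h z).
Proof.
move=> pg ph r e e0; have e2 : 0 < e / 2 by rewrite divr_gt0.
have [p hp] := pg r _ e2; have [q hq] := ph r _ e2.
exists (p + q) => z zr; rewrite hornerD.
have -> : g z + h z - (p.[z] + q.[z]) = (g z - p.[z]) + (h z - q.[z]) by ring.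
by rewrite (le_trans (ncD _ _))// (splitr e) lerD ?hp ?hq.
Qed.

Lemma papxM g h : papx g -> papx h -> papx (fun z => g z * h z).
Proof.
move=> pg ph r e e0.
have [M M0 hM] := papx_bounded r pg.
have M1 : 0 < M + 1 by rewrite ltr_wpDl.
have [|q hq] := ph r (e / 2 / (M + 1)); first by rewrite !divr_gt0.
have [L L0 hL] := poly_bounded q r.
have L1 : 0 < L + 1 by rewrite ltr_wpDl.
have [|p hp] := pg r (e / 2 / (L + 1)); first by rewrite !divr_gt0.
exists (p * q) => z zr; rewrite hornerM.
have -> : g z * h z - p.[z] * q.[z] = g z * (h z - q.[z]) + (g z - p.[z]) * q.[z].
  by ring.
rewrite (le_trans (ncD _ _))// !ncM (splitr e) lerD//.
  rewrite -[leRHS](divfK (lt0r_neq0 M1)) mulrC ler_pM ?nc_ge0 ?hq//.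
  by rewrite (le_trans (hM _ zr))// lerDl.
rewrite -[leRHS](divfK (lt0r_neq0 L1)) ler_pM ?nc_ge0 ?hp//.
by rewrite (le_trans (hL _ zr))// lerDl.
Qed.

Lemma papx_comp_poly g (q : {poly R[i]}) : papx g -> papx (fun z => g q.[z]).
Proof.
move=> pg r e e0; have [M M0 hM] := poly_bounded q r.
have [p hp] := pg M e e0; exists (p \Po q) => z zr.
by rewrite horner_comp hp// hM.
Qed.

Lemma papx_csum c (D rho : R) : egrowth c D rho -> papx (csum c).
Proof.
move=> hc r e e0; have [D0 r0 _] := hc.
pose B := 2 * D * expR (2 * (rho * r)).
have B0 : 0 <= B by rewrite !mulr_ge0 ?expR_ge0.
pose M := (Num.trunc (B / e)).+1.
have Be : 0 <= B / e by rewrite divr_ge0// ltW.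
have /andP[_ h] := truncn_itv Be.
exists (\poly_(l < M) c l) => z zr.
rewrite horner_poly; have := csum_tail z M hc; rewrite /cpart big_mkord => h1.
apply: (le_trans h1).
apply: (@le_trans _ _ (B * 2^-1 ^+ M)).
  rewrite /B -[leRHS]mulrA ler_wpM2l ?mulr_ge0// [leLHS]mulrC ler_wpM2r ?exprn_ge0//.
  by rewrite ler_expR ler_wpM2l// ler_wpM2l.
rewrite exprVn ler_pdivrMr ?exprn_gt0// mulrC -ler_pdivrMr//.
apply: (le_trans (ltW h)); rewrite -natrX ler_nat.
exact: ltnW (ltn_expl _ _).
Qed.

(** All larger constants are allowed so that the two halves of the real axis can share one. *)
Lemma majorized_logp g (K1 : R) : 0 <= K1 -> papx g ->
  lower_sums_le K1 (fun t => logp (nc (g t%:C))) ->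
  exists2 K0, 0 <= K0 & forall K, K0 <= K ->
    majorized K (fun t => 2 * logp (nc (g t%:C))).
Proof.
move=> K10 pg ls; have [M M0 hM] := papx_bounded 1 pg.
have lb (a b : R) : 0 <= a -> 0 <= b -> logp a <= a.
  move=> a0 _; have := logp_lipschitz a 0; rewrite subr0 (ger0_norm a0).
  have -> : logp (0 : R) = 0 by rewrite /logp ltr10.
  by rewrite subr0 ger0_norm// logp_ge0.
have maj : majorized (2 * (2 * M) + 2 * (2 * K1 + 4)) (fun t => 2 * logp (nc (g t%:C))).
  apply: majorizedP.
  - by rewrite mulr_ge0.
  - by rewrite mulr_ge0.
  - move=> r e e0; have e2 : 0 < e / 2 by rewrite divr_gt0.
    have [d d0 hd] := papx_oscillation r pg e2; exists d => // s t sr tr st.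
    rewrite -mulrBr normrM ger0_norm// mulrC -ler_pdivlMr//.
    rewrite (le_trans (logp_lipschitz _ _))// (le_trans (nc_dist _ _))// hd ?ncR//.
    + by case/andP: sr => s0 sr; rewrite ger0_norm.
    + by case/andP: tr => t0 tr; rewrite ger0_norm.
    + by rewrite -rmorphB ncR.
  - by move=> t _; rewrite mulr_ge0 ?logp_ge0.
  - move=> t /andP[t0 t1]; rewrite ler_wpM2l// (le_trans (@lb _ 0 (nc_ge0 _) _))//.
    by rewrite hM// ncR ger0_norm.
  - move=> d N m d01 m0 hm.
    have := ls d N (fun j => m j / 2) d01; rewrite -(ler_pM2l (ltr0n R 2)) mulr_sumr.
    under eq_bigr do rewrite mulrA [2 * _]mulrC divfK//.
    apply=> [j|j t jN ht]; first by rewrite divr_ge0.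
    by rewrite ler_pdivrMr// mulrC; exact: hm ht.
exists (2 * (2 * M) + 2 * (2 * K1 + 4)); first by lra.
move=> K hK r r0; have [V [c1 c2 c3 c4 c5]] := maj r r0; exists V; split=> // x y y0.
by apply: (le_trans (c5 x y y0)); rewrite ler_pM2r ?invr_gt0.
Qed.

(** Cells of width 1 that start beyond [T] carry the lower value [m]; enough of them exceed [K1]. *)
Lemma lower_sums_const (m K1 T : R) (f : R -> R) : lower_sums_le K1 f -> 0 < m ->
  (forall t, T <= t -> m <= f t) -> (forall t, 1 <= t -> 0 <= f t) -> False.
Proof.
move=> ls m0 hf f0.
pose J := (Num.trunc `|T|).+1; pose L := (Num.trunc (`|K1| / m)).+1.
have hT : T <= J%:R.
  have /andP[_ /ltW h] := truncn_itv (normr_ge0 T).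
  exact: le_trans (ler_norm _) h.
have := ls 1 (J + L)%N (fun j => if (J <= j)%N then m else 0).
rewrite ltr01 lexx => /(_ isT) h.
have : L%:R * m <= K1.
  apply: le_trans (h _ _).
  - rewrite (big_cat_nat _ (n := J)) ?leq_addr//= -[X in X <= _]add0r lerD//.
      by apply: sumr_ge0 => j _; rewrite mulr1; case: ifP => // _; exact: ltW.
    rewrite big_nat; under eq_bigr => j /andP[Jj _] do rewrite Jj mulr1.
    by rewrite -big_nat sumr_const_nat addKn mulr_natl.
  - by move=> j; case: ifP => // _; exact: ltW.
  - move=> j t _; rewrite mulr1 => /andP[jt _]; case: ifP => [Jj|_].
      apply: hf; apply: (le_trans hT); apply: le_trans jt.
      by rewrite -[leLHS]add0r lerD// ler_nat.
    by apply: f0; apply: le_trans jt; rewrite lerDl.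
apply/negP; rewrite -ltNge -ltr_pdivrMr//.
have k0 : 0 <= `|K1| / m by rewrite divr_ge0// ltW.
have /andP[_ h1] := truncn_itv k0; apply: le_lt_trans h1.
by rewrite ler_pM2r ?invr_gt0// ler_norm.
Qed.

(** Polynomial growth makes [g] a polynomial; were it nonconstant, [log+ |g|] would eventually stay
    above 1 on the positive axis, against the bound on its lower sums. *)
Lemma entire_constant g (A B K1 : R) (N : nat) :
  1 <= A -> 0 <= B -> 0 <= K1 -> papx g ->
  (forall z, nc (g z) <= A * (1 + nc z) ^+ N * expR (B * Re z ^+ 2)) ->
  lower_sums_le K1 (fun t => logp (nc (g t%:C))) ->
  lower_sums_le K1 (fun t => logp (nc (g (- t)%:C))) ->
  forall z, g z = g 0.
Proof.
move=> A1 B0 K10 pg gb ls1 ls2.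
have pn : papx (fun z => g (- z)).
  have := papx_comp_poly (- 'X) pg.
  by rewrite (_ : (fun z => g (- 'X).[z]) = fun z => g (- z))//; apply/funext => z; rewrite hornerN hornerX.
have ls2' : lower_sums_le K1 (fun t => logp (nc (g (- t%:C)))).
  by move: ls2; congr (lower_sums_le _ _); apply/funext => t; rewrite rmorphN.
have [Ka Ka0 ha] := majorized_logp K10 pg ls1.
have [Kb Kb0 hb] := majorized_logp K10 pn ls2'.
have K00 : 0 <= Ka + Kb by rewrite addr_ge0.
have hbm : majorized (Ka + Kb) (fun t => 2 * logp (nc (g (- t)%:C))).
  have := hb (Ka + Kb); rewrite lerDr => /(_ Ka0).
  by congr (majorized _ _); apply/funext => t; rewrite rmorphN.
have [|A' hA'] := entire_poly_bound A1 B0 K00 pg gb _ hbm.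
  by apply: ha; rewrite lerDl.
have [q hq] := entire_poly_growth pg hA'.
have [q1|q1] := leqP (size q) 1%N.
  by move=> z; rewrite !hq (size1_polyC q1) !hornerC.
have [T T1 hT] := poly_unbounded q1 (expR 1).
exfalso; apply: (lower_sums_const (T := T) ls1 ltr01) => [t Tt|t _]; last exact: logp_ge0.
have e1 := hT t Tt; rewrite hq /logp.
have lt1 : 1 < nc q.[t%:C].
  by apply: lt_le_trans e1; rewrite -[ltLHS]expR0 ltr_expR.
by rewrite lt1 -[leLHS]expRK ler_ln ?posrE ?expR_gt0//; exact: lt_trans lt1.
Qed.

End EntireConstant.

(** * Agreement of the series with the given [jbessel], and inverses of exponentials *)

Section BesselReal.
Context {R : realType}.
Implicit Types (z w : R[i]) (beta : R).
Local Notation nc := (@ComplexField.Normc.normc R).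
Local Notation Re := (@complex.Re R).
Local Notation Im := (@complex.Im R).

Lemma der_cexp z t :
  der (fun t => Re (cexp (t%:C * z))) t
    (Re z * Re (cexp (t%:C * z)) - Im z * Im (cexp (t%:C * z))) /\
  der (fun t => Im (cexp (t%:C * z))) t
    (Re z * Im (cexp (t%:C * z)) + Im z * Re (cexp (t%:C * z))).
Proof.
have dE : cdiff (fun l => (l`!%:R)^-1) = (fun l => (l`!%:R)^-1 : R[i]).
  by apply/funext => l; rewrite /cdiff factS natrM invfM mulrA mulfV ?mul1r.
have [h1 h2] := der_csum z t (@egrowth_exp R); rewrite dE -/(cexp _) ReM ImM in h1 h2.
by split.
Qed.

Lemma cexp0 : cexp 0 = 1 :> R[i].
Proof. by rewrite /cexp (csum0 (@egrowth_exp R)) fact0 invr1. Qed.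

Lemma der_zero_cst (F : R -> R) : (forall t, der F t 0) -> F 1 = F 0.
Proof.
move=> dF; have cF : {within `[0, 1], continuous F}.
  by apply: continuous_in_subspaceT => x _; exact: der_continuous (dF x).
have [s _] := @MVT R F (fun=> 0) 0 1 ltr01 (fun x _ => dF x) cF.
by rewrite mul0r => /eqP; rewrite subr_eq0 => /eqP.
Qed.

(** The product of [exp (t z)] and [exp (- t z)] has zero derivative in [t]; no general addition
    formula is involved. *)
Lemma cexpN z : cexp z * cexp (- z) = 1.
Proof.
pose a t := Re (cexp (t%:C * z)); pose b t := Im (cexp (t%:C * z)).
pose c t := Re (cexp (t%:C * - z)); pose d t := Im (cexp (t%:C * - z)).
have da t : der a t (Re z * a t - Im z * b t) by case: (der_cexp z t).
have db t : der b t (Re z * b t + Im z * a t) by case: (der_cexp z t).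
have dc t : der c t (- Re z * c t - - Im z * d t).
  by have [h _] := der_cexp (- z) t; rewrite ReN ImN in h.
have dd t : der d t (- Re z * d t + - Im z * c t).
  by have [_ h] := der_cexp (- z) t; rewrite ReN ImN in h.
have e1 : Re (cexp z * cexp (- z)) = a 1 * c 1 - b 1 * d 1.
  by rewrite ReM /a /b /c /d !mul1r.
have e2 : Im (cexp z * cexp (- z)) = a 1 * d 1 + b 1 * c 1.
  by rewrite ImM /a /b /c /d !mul1r.
have v0 : [/\ a 0 = 1, b 0 = 0, c 0 = 1 & d 0 = 0].
  have e0 s : cexp ((0 : R)%:C * s) = 1 := etrans (congr1 (@cexp R) (mul0r s)) cexp0.
  by split; [exact: (congr1 Re (e0 z))|exact: (congr1 Im (e0 z))|
    exact: (congr1 Re (e0 (- z)))|exact: (congr1 Im (e0 (- z)))].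
clearbody a b c d; case: v0 => a0 b0 c0 d0.
have d1 t : der (fun t => a t * c t - b t * d t) t 0.
  apply: derE; first by apply: derB; [exact: derM (da t) (dc t)|exact: derM (db t) (dd t)].
  by move: (a t) (b t) (c t) (d t) (Re z) (Im z); clear => *; ring.
have d2 t : der (fun t => a t * d t + b t * c t) t 0.
  apply: derE; first by apply: derD; [exact: derM (da t) (dd t)|exact: derM (db t) (dc t)].
  by move: (a t) (b t) (c t) (d t) (Re z) (Im z); clear => *; ring.
have := der_zero_cst d1; have := der_zero_cst d2; rewrite a0 b0 c0 d0 => h2 h1.
by apply: complex_ext; rewrite ?e1 ?e2 ?h1 ?h2 /= ?mulr1 ?mulr0 ?mul0r ?subr0 ?addr0.
Qed.

Lemma JC_even beta z : JC beta (- z) = JC beta z.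
Proof.
rewrite /JC /csum.
have E l : (bc beta l)%:C * (- z) ^+ l = (bc beta l)%:C * z ^+ l.
  rewrite exprNn /bc; case: ifPn => ol; first by rewrite rmorph0 !mul0r.
  by rewrite -signr_odd (negbTE ol) expr0 mul1r.
by congr (limn (series _) +i* limn (series _)); apply/funext => l; rewrite E.
Qed.

Lemma cpart_double (c : nat -> R[i]) z M : (forall m, c (2 * m).+1 = 0) ->
  cpart c z (2 * M) = \sum_(0 <= m < M) c (2 * m)%N * z ^+ (2 * m).
Proof.
move=> c0; elim: M => [|M IH]; first by rewrite muln0 /cpart !big_geq.
rewrite mulnS /cpart !big_nat_recr//= -/(cpart c z (2 * M)) IH c0 mul0r addr0.
by [].
Qed.

Lemma bc_double beta m : bc beta (2 * m) = bm beta m.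
Proof. by rewrite /bc mul2n odd_double doubleK. Qed.

Lemma bc_odd beta m : bc beta (2 * m).+1 = 0.
Proof. by rewrite /bc /= mul2n odd_double. Qed.

Lemma bm_neq0 beta m : - 1 < beta -> bm beta m != 0.
Proof.
move=> b1; rewrite /bm; have g0 : 0 < Gamma (beta + 1) by apply: Gamma_gt0; lra.
have gm : 0 < Gamma (beta + m%:R + 1).
  by apply: Gamma_gt0; have : (0 : R) <= m%:R by []; lra.
by rewrite !mulf_neq0 ?invr_neq0 ?mulf_neq0 ?signr_eq0 ?gt_eqF// ?exprn_gt0// ltr0n fact_gt0.
Qed.

(** The partial sums defining [jbessel] are those of even length in the series with zero odd
    coefficients, so the limit in its definition exists. *)
Lemma jbesselE beta (x : R) : - 2^-1 <= beta -> JC beta x%:C = (jbessel beta x)%:C.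
Proof.
move=> b0; have g := egrowth_bc b0.
have G0 : 0 < Gamma (beta + 1) by apply: Gamma_gt0; lra.
pose S N := \sum_(0 <= m < N) ((-1) ^+ m / ((m`!)%:R * Gamma (beta + m%:R + 1)) * (x / 2) ^+ (2 * m)).
have E N : cpart (fun l => (bc beta l)%:C) x%:C (2 * N) = (Gamma (beta + 1) * S N)%:C.
  rewrite cpart_double; last by move=> m; rewrite bc_odd rmorph0.
  rewrite mulr_sumr rmorph_sum; apply: eq_bigr => m _.
  rewrite bc_double -rmorphXn -rmorphM /=; congr (_%:C).
  have gm : 0 < Gamma (beta + m%:R + 1).
    by apply: Gamma_gt0; have : (0 : R) <= m%:R by []; lra.
  have fm : (0 : R) < m`!%:R by rewrite ltr0n fact_gt0.
  rewrite /bm expr_div_n (exprM 2) (_ : 2 ^+ 2 = 4 :> R); last by rewrite expr2; lra.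
  have f4 : (0 : R) < 4 ^+ m by rewrite exprn_gt0.
  move: (4 ^+ m) f4 (x ^+ _) ((-1) ^+ m) (m`!%:R) fm (Gamma _) gm (Gamma _) {G0} => a a0 b e1 e2 e20 e3 e30 e4.
  by field; rewrite !gt_eqF.
have ap (e : R) : 0 < e -> exists M0, forall N, (M0 <= N)%N ->
    `|Re (JC beta x%:C) - Gamma (beta + 1) * S N| <= e /\ `|Im (JC beta x%:C)| <= e.
  move=> e0; have [M0 hM0] := csum_approx x%:C g e0; exists M0 => N hN.
  have := hM0 (2 * N)%N; rewrite E => /(_ (leq_trans hN _)) h.
  have {}h : nc (JC beta x%:C - (Gamma (beta + 1) * S N)%:C) <= e.
    by apply: h; rewrite leq_pmull.
  split.
    by apply: le_trans h; apply: le_trans (nc_Re _); rewrite ReD ReN.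
  by apply: le_trans h; apply: le_trans (nc_Im _); rewrite ImD ImN oppr0 addr0.
apply: complex_ext => /=; last first.
  apply/eqP; rewrite -normr_le0; apply/ler_addgt0Pr => e e0; rewrite add0r.
  by have [M0 /(_ M0 (leqnn _))[]] := ap e e0.
have cv : S N @[N --> \oo] --> Re (JC beta x%:C) / Gamma (beta + 1).
  apply/cvgrPdist_le => e e0.
  have [|M0 hM0] := ap (e * Gamma (beta + 1)); first by rewrite mulr_gt0.
  exists M0 => // N /= hN; have [h _] := hM0 N hN.
  rewrite -(ler_pM2r G0); apply: le_trans h.
  rewrite -[X in _ * X <= _](ger0_norm (ltW G0)) -normrM mulrBl divfK ?gt_eqF//.
  by rewrite [S N * _]mulrC.
rewrite /jbessel -/S (cvg_lim _ cv)//.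
by rewrite mulrC divfK// gt_eqF.
Qed.

Lemma JC_ray_continuous beta z : - 2^-1 <= beta ->
  continuous (fun t : R => Re (JC beta (t%:C * z))) /\
  continuous (fun t : R => Im (JC beta (t%:C * z))).
Proof.
move=> b0; split=> t; have [h1 h2] := der_csum z t (egrowth_bc b0).
  exact: der_continuous h1.
exact: der_continuous h2.
Qed.

End BesselReal.

(** * Integrals of complex-valued functions *)

Section ComplexIntegral.
Context {R : realType} (k : R) (n : nat).
Local Notation nc := (@ComplexField.Normc.normc R).
Local Notation Re := (@complex.Re R).
Local Notation Im := (@complex.Im R).
Local Notation mu := (mu_kn k n).
Implicit Types (h : R -> R[i]).

Lemma measurable_nc h : cmeasurable h -> measurable_fun setT (fun x => nc (h x)).
Proof.
move=> [m1 m2]; under eq_fun do rewrite ncE.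
apply: (measurableT_comp (continuous_measurable_fun (@sqrt_continuous R))).
by apply: measurable_funD; exact: measurable_funX.
Qed.

Lemma cmeasurableD h1 h2 : cmeasurable h1 -> cmeasurable h2 ->
  cmeasurable (fun x => h1 x + h2 x).
Proof.
move=> [a b] [c d]; split.
  by under eq_fun do rewrite ReD; exact: measurable_funD.
by under eq_fun do rewrite ImD; exact: measurable_funD.
Qed.

Lemma cmeasurableM h1 h2 : cmeasurable h1 -> cmeasurable h2 ->
  cmeasurable (fun x => h1 x * h2 x).
Proof.
move=> [a b] [c d]; split.
  by under eq_fun do rewrite ReM; apply: measurable_funB; exact: measurable_funM.
by under eq_fun do rewrite ImM; apply: measurable_funD; exact: measurable_funM.
Qed.

Lemma cmeasurableR (f : R -> R) : measurable_fun setT f -> cmeasurable (fun x => (f x)%:C).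
Proof. by move=> mf; split => //=; exact: measurable_cst. Qed.

Lemma cmeasurableC (c : R[i]) : cmeasurable (fun _ : R => c).
Proof. by split; exact: measurable_cst. Qed.

Definition complex_integral h : R[i] :=
  Rintegral mu setT (fun x => Re (h x)) +i* Rintegral mu setT (fun x => Im (h x)).

Definition cintegrable h := cmeasurable h /\ (\int[mu]_x (nc (h x))%:E < +oo)%E.

Lemma cintegrableW h (M : \bar R) : cmeasurable h -> (M < +oo)%E ->
  (\int[mu]_x (nc (h x))%:E <= M)%E -> cintegrable h.
Proof. by move=> mh My hM; split=> //; exact: le_lt_trans My. Qed.

Lemma cintegrable_Re h : cintegrable h -> mu.-integrable setT (fun x => (Re (h x))%:E).
Proof.
move=> [mh ih]; apply/integrableP; split; first by apply/measurable_EFinP; case: mh.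
apply: le_lt_trans ih; apply: ge0_le_integral => //.
- by apply: measurableT_comp => //; apply/measurable_EFinP; case: mh.
- by apply/measurable_EFinP; exact: measurable_nc.
- by move=> x _; rewrite abse_EFin lee_fin nc_Re.
Qed.

Lemma cintegrable_Im h : cintegrable h -> mu.-integrable setT (fun x => (Im (h x))%:E).
Proof.
move=> [mh ih]; apply/integrableP; split; first by apply/measurable_EFinP; case: mh.
apply: le_lt_trans ih; apply: ge0_le_integral => //.
- by apply: measurableT_comp => //; apply/measurable_EFinP; case: mh.
- by apply/measurable_EFinP; exact: measurable_nc.
- by move=> x _; rewrite abse_EFin lee_fin nc_Im.
Qed.

Lemma cintegrable_bound h (g : R -> R) : cmeasurable h -> measurable_fun setT g ->
  (forall x, nc (h x) <= g x) -> (\int[mu]_x (g x)%:E < +oo)%E -> cintegrable h.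
Proof.
move=> mh mg hg ig; split=> //; apply: le_lt_trans ig; apply: ge0_le_integral => //.
- by move=> x _; rewrite lee_fin nc_ge0.
- by apply/measurable_EFinP; exact: measurable_nc.
- exact/measurable_EFinP.
- by move=> x _; rewrite lee_fin.
Qed.

Lemma cintegrableD h1 h2 : cintegrable h1 -> cintegrable h2 ->
  cintegrable (fun x => h1 x + h2 x).
Proof.
move=> [m1 i1] [m2 i2]; apply: (@cintegrable_bound _ (fun x => nc (h1 x) + nc (h2 x))).
- exact: cmeasurableD.
- by apply: measurable_funD; exact: measurable_nc.
- by move=> x; exact: ncD.
- under eq_integral do rewrite EFinD.
  rewrite ge0_integralD//; first exact: lte_add_pinfty.
  + by move=> x _; rewrite lee_fin nc_ge0.
  + by apply/measurable_EFinP; exact: measurable_nc.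
  + by move=> x _; rewrite lee_fin nc_ge0.
  + by apply/measurable_EFinP; exact: measurable_nc.
Qed.

Lemma cintegrableZ (c : R[i]) h : cintegrable h -> cintegrable (fun x => c * h x).
Proof.
move=> [m1 i1]; apply: (@cintegrable_bound _ (fun x => nc c * nc (h x))).
- by apply: cmeasurableM => //; exact: cmeasurableC.
- by apply: measurable_funM => //; exact: measurable_nc.
- by move=> x; rewrite ncM.
- under eq_integral do rewrite EFinM.
  rewrite ge0_integralZl_EFin ?nc_ge0//.
  + by rewrite lte_mul_pinfty ?lee_fin ?nc_ge0.
  + by move=> x _; rewrite lee_fin nc_ge0.
  + by apply/measurable_EFinP; exact: measurable_nc.
Qed.

Lemma cintD h1 h2 : cintegrable h1 -> cintegrable h2 ->
  complex_integral (fun x => h1 x + h2 x) = complex_integral h1 + complex_integral h2.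
Proof.
move=> i1 i2; apply: complex_ext => /=.
  under eq_Rintegral do rewrite ReD.
  by rewrite RintegralD//; exact: cintegrable_Re.
under eq_Rintegral do rewrite ImD.
by rewrite RintegralD//; exact: cintegrable_Im.
Qed.

Lemma cintZ (c : R[i]) h : cintegrable h -> complex_integral (fun x => c * h x) = c * complex_integral h.
Proof.
move=> ih; have i1 := cintegrable_Re ih; have i2 := cintegrable_Im ih.
have iZ (r : R) (f : R -> R) : mu.-integrable setT (EFin \o f) ->
    mu.-integrable setT (EFin \o (fun x => r * f x)).
  by move=> fi; apply: (eq_integrable _ (fun x => r%:E * (f x)%:E)%E) => //; exact: integrableZl.
apply: complex_ext.
  rewrite ReM /=; under eq_Rintegral do rewrite ReM.
  by rewrite RintegralB//; [rewrite !RintegralZl|exact: iZ|exact: iZ].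
rewrite ImM /=; under eq_Rintegral do rewrite ImM.
by rewrite RintegralD//; [rewrite !RintegralZl|exact: iZ|exact: iZ].
Qed.

Lemma cint0 : complex_integral (fun=> 0) = 0.
Proof. by apply: complex_ext => /=; rewrite /Rintegral integral0. Qed.

Lemma cintegrable_sum (F : nat -> R -> R[i]) M : (forall l, cintegrable (F l)) ->
  cintegrable (fun x => \sum_(0 <= l < M) F l x) /\
  complex_integral (fun x => \sum_(0 <= l < M) F l x) = \sum_(0 <= l < M) complex_integral (F l).
Proof.
move=> iF; elim: M => [|M [IH1 IH2]].
  rewrite big_geq//; under eq_fun do rewrite big_geq//; split; last exact: cint0.
  split; first exact: cmeasurableC.
  by under eq_integral do rewrite nc0; rewrite integral0.
rewrite big_nat_recr//=; under eq_fun do rewrite big_nat_recr//=.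
by split; [exact: cintegrableD|rewrite cintD// IH2].
Qed.

(** The factor 2 comes from estimating real and imaginary parts separately. *)
Lemma nc_cint_le h (M : R) : cmeasurable h ->
  (\int[mu]_x (nc (h x))%:E <= M%:E)%E -> nc (complex_integral h) <= 2 * M.
Proof.
move=> mh hM; have ih : cintegrable h by apply: cintegrableW hM; rewrite ?ltry.
have mnc := measurable_nc mh.
have aux (f : R -> R) : mu.-integrable setT (EFin \o f) ->
    (forall x, `|f x| <= nc (h x)) -> `|Rintegral mu setT f| <= M.
  move=> fi fh; rewrite -lee_fin; apply: le_trans hM.
  apply: (@le_trans _ _ (Rintegral mu setT (fun x => `|f x|))%:E).
    by rewrite lee_fin; exact: le_normr_Rintegral.
  rewrite /Rintegral fineK; last first.
    by apply: integrable_fin_num => //; exact: integrable_norm.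
  apply: ge0_le_integral => //.
  - apply/measurable_EFinP; apply: measurableT_comp => //.
    by apply/measurable_EFinP; case/integrableP: fi.
  - exact/measurable_EFinP.
  - by move=> x _; rewrite lee_fin.
apply: (le_trans (nc_le _)); rewrite mulr_natl mulr2n; apply: lerD.
  by apply: aux => [|x]; [exact: cintegrable_Re|exact: nc_Re].
by apply: aux => [|x]; [exact: cintegrable_Im|exact: nc_Im].
Qed.

End ComplexIntegral.

(** * What the integrability hypothesis on [f] gives *)

Section Growth.
Context {R : realType} (k : R) (n : nat).
Hypotheses (n1 : (1 <= n)%N) (hk : (n%:R - 1) / (2 * n%:R) <= k).
Local Notation nc := (@ComplexField.Normc.normc R).
Local Notation mu := (mu_kn k n).
Local Notation al := (alpha k n).
Local Notation U := (@nroot R n).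

(** For finite [p], [|g| <= 1 + |g|^p]; for [p = +oo], the essential supremum serves as [M]. A
    bounded plus an integrable part is all that is kept of the exponent. *)
Lemma Lp_split p (g : R -> R[i]) : (1 <= p)%E -> inLp k n p g ->
  exists M S (h : R -> R), [/\ 0 <= M, measurable_fun setT h, (forall x, 0 <= h x),
    (\int[mu]_x (h x)%:E <= S%:E)%E & {ae mu, forall x, nc (g x) <= M + h x}].
Proof.
case: p => [r| |] //; rewrite ?lee_fin => r1 [mg].
- have r0 : r != 0 by rewrite gt_eqF// (lt_le_trans ltr01).
  move=> Ly; pose h x := nc (g x) `^ r.
  have E : (\int[mu]_x (h x)%:E < +oo)%E.
    have := poweR_Lnorm mu (fun x => (nc (g x))%:E) r0.
    under eq_integral do rewrite abse_EFin poweR_EFin ger0_norm ?nc_ge0//.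
    by move=> <-; exact: poweR_lty.
  have h0 x : 0 <= h x by exact: powR_ge0.
  have E0 : (0 <= \int[mu]_x (h x)%:E)%E by apply: integral_ge0 => x _; rewrite lee_fin.
  exists 1, (fine (\int[mu]_x (h x)%:E)), h; split=> //.
  + by apply: (measurableT_comp (measurable_powR _)); exact: measurable_nc.
  + by rewrite fineK// ge0_fin_numE.
  + apply: aeW => x; have [l|l] := leP (nc (g x)) 1; first by rewrite (le_trans l)// lerDl.
    apply: (@le_trans _ _ (h x)); last by rewrite lerDr.
    by rewrite -{1}(powRr1 (nc_ge0 (g x))) ler_powR// ltW.
- rewrite unlock; case: ifPn => [m0 Ly|m0 _].
    pose e := ess_sup mu (abse \o (fun x => (nc (g x))%:E)).
    exists `|fine e|, 0, (fun=> 0); split=> //.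
    + by rewrite integral0.
    have := ess_sup_ge mu (abse \o (fun x => (nc (g x))%:E)); apply: filterS => x.
    rewrite /= -/e in Ly *; rewrite addr0 ger0_norm ?nc_ge0//.
    case: (e) Ly => [s _| |] //=; rewrite lee_fin => h.
    exact: le_trans (ler_norm _).
  (* Here the whole space has measure zero, and the almost everywhere claim is void. *)
  exists 0, 0, (fun=> 0); split=> //; first by rewrite integral0.
  exists setT; split=> //; apply/eqP; rewrite eq_le measure_ge0 andbT.
  by rewrite leNgt.
Qed.

(** [p] and [q] are eliminated here: [M] and [S] do not depend on the test weight [G], of which only
    the total mass enters. *)
Lemma weighted_bound p q (a : R) (f : R -> R[i]) : (1 <= p)%E -> (1 <= q)%E ->
  cmeasurable f ->
  inLpLq k n p q (fun x => (expR (n%:R * a * `|x| `^ (2 / n%:R)))%:C * f x) ->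
  exists M S, [/\ 0 <= M, 0 <= S & forall (G : R -> R) (I : R),
    measurable_fun setT G -> (forall x, 0 <= G x <= 1) ->
    (\int[mu]_x (G x)%:E <= I%:E)%E ->
    (\int[mu]_x (nc (f x) * (expR (n%:R * a * U x ^+ 2) * G x))%:E <= (M * I + S)%:E)%E].
Proof.
move=> p1 q1 mf [g1 [g2 [L1 [L2 fE]]]].
have [M1 [S1 [h1 [M10 mh1 h10 ih1 ae1]]]] := Lp_split p1 L1.
have [M2 [S2 [h2 [M20 mh2 h20 ih2 ae2]]]] := Lp_split q1 L2.
have S10 : 0 <= S1.
  by rewrite -lee_fin; apply: le_trans ih1; apply: integral_ge0 => x _; rewrite lee_fin.
have S20 : 0 <= S2.
  by rewrite -lee_fin; apply: le_trans ih2; apply: integral_ge0 => x _; rewrite lee_fin.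
exists (M1 + M2), (S1 + S2); split; rewrite ?addr_ge0// => G I mG G01 iG.
have G0 x : 0 <= G x by case/andP: (G01 x).
have mU := @measurable_U R n.
have me : measurable_fun setT (fun x => expR (n%:R * a * U x ^+ 2)).
  by apply: measurableT_comp => //; apply: measurable_funM => //; exact: measurable_funX.
apply: (@le_trans _ _ (\int[mu]_x ((M1 + M2) * G x + (h1 x + h2 x))%:E)%E).
  apply: ae_ge0_le_integral => //.
  - by move=> x _; rewrite lee_fin !mulr_ge0 ?nc_ge0 ?expR_ge0.
  - apply/measurable_EFinP; apply: measurable_funM; first exact: measurable_nc.
    exact: measurable_funM.
  - by move=> x _; rewrite lee_fin !addr_ge0// mulr_ge0// addr_ge0.
  - apply/measurable_EFinP; apply: measurable_funD; first exact: measurable_funM.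
    exact: measurable_funD.
  - apply: filterS2 ae1 ae2 => x a1 a2 _; rewrite lee_fin mulrA.
    have -> : nc (f x) * expR (n%:R * a * U x ^+ 2) = nc (g1 x + g2 x).
      by rewrite -fE ncM ncR ger0_norm ?expR_ge0// U2 mulrC.
    apply: (@le_trans _ _ ((M1 + M2 + (h1 x + h2 x)) * G x)).
      rewrite ler_wpM2r// (le_trans (ncD _ _))//.
      by rewrite addrACA lerD.
    rewrite mulrDl lerD2l ler_piMr ?addr_ge0//.
    by case/andP: (G01 x).
under eq_integral do rewrite EFinD EFinD.
rewrite ge0_integralD//; last 4 first.
- by move=> x _; rewrite lee_fin mulr_ge0// addr_ge0.
- by apply/measurable_EFinP; exact: measurable_funM.
- by move=> x _; rewrite -EFinD lee_fin addr_ge0.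
- by apply: emeasurable_funD; exact/measurable_EFinP.
rewrite EFinD; apply: leeD.
  under eq_integral do rewrite EFinM.
  rewrite ge0_integralZl_EFin ?addr_ge0//; last 2 first.
  + by move=> x _; rewrite lee_fin.
  + exact/measurable_EFinP.
  by rewrite EFinM lee_wpmul2l// lee_fin addr_ge0.
rewrite ge0_integralD//; last 4 first.
- by move=> x _; rewrite lee_fin.
- exact/measurable_EFinP.
- by move=> x _; rewrite lee_fin.
- exact/measurable_EFinP.
by rewrite EFinD leeD.
Qed.

Lemma gauss_mass (c : R) : 0 < c ->
  (\int[mu]_x (expR (- (c * U x ^+ 2)))%:E = (KG k n (al + 1) * c `^ (- (al + 1)))%:E)%E.
Proof.
move=> c0; have := gauss_moment n1 hk 0 c0.
by rewrite muln0 addr0; under eq_integral do rewrite expr0 mul1r.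
Qed.

(** The growth of the transform stated before transforming. Unlike the hypothesis on [f], it is
    stable under multiplication by [x], up to the polynomial factor. *)
Definition gbound (a A : R) (N : nat) (F : R -> R[i]) := cmeasurable F /\
  forall y, 0 <= y -> (\int[mu]_x (nc (F x) * expR (n%:R * U x * y))%:E <=
    (A * (1 + y) ^+ N * expR (n%:R * y ^+ 2 / (4 * a)))%:E)%E.

Lemma KG_ge0 : 0 <= KG k n (al + 1).
Proof.
rewrite /KG mulr_ge0 ?invr_ge0 ?mulr_ge0 ?powR_ge0// ltW//; exact: GammaA_gt0.
Qed.

(** Completing the square, [n U y = n a U^2 + n y^2 / (4 a) - n a (U - c)^2] with [c = y / (2 a)].
    The last term is the test weight [G] of [weighted_bound], and its mass is polynomial in [y]. *)
Lemma gbound_Lp p q (a : R) (f : R -> R[i]) : (1 <= p)%E -> (1 <= q)%E -> 0 < a ->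
  cmeasurable f ->
  inLpLq k n p q (fun x => (expR (n%:R * a * `|x| `^ (2 / n%:R)))%:C * f x) ->
  exists A N, 1 <= A /\ gbound a A N f.
Proof.
move=> p1 q1 a0 mf hf; have [M [S [M0 S0 hb]]] := weighted_bound p1 q1 mf hf.
have n0 : (0 : R) < n%:R by exact: n_gt0.
have al0 : 0 < al + 1 by exact: alpha1_gt0.
pose N := (Num.trunc (al + 1)).+1.
have alN : al + 1 <= N%:R by have /andP[_ /ltW] := truncn_itv (ltW al0).
pose K := KG k n (al + 1); have K0 : 0 <= K by exact: KG_ge0.
pose P := (n%:R * a / 4) `^ (- (al + 1)).
have P0 : 0 <= P by exact: powR_ge0.
pose Q := ((2 + a^-1) ^+ 2) ^+ N.
have Q0 : 0 <= Q by rewrite !exprn_ge0// addr_ge0// invr_ge0 ltW.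
pose A := 1 + (M * (K * P + expR 1 * K * Q) + S).
have A1 : 1 <= A.
  rewrite lerDl; apply: addr_ge0 => //; apply: mulr_ge0 => //.
  exact: (addr_ge0 (mulr_ge0 K0 P0) (mulr_ge0 (mulr_ge0 (expR_ge0 1) K0) Q0)).
exists A, (2 * N)%N; split=> //; split=> // y y0.
pose c := y / (2 * a); have c0 : 0 <= c by rewrite divr_ge0// mulr_ge0// ltW.
pose G x := expR (- (n%:R * a * (U x - c) ^+ 2)).
have mU := @measurable_U R n.
have mG : measurable_fun setT G.
  apply: measurableT_comp => //; apply: measurable_funN; apply: measurable_funM => //.
  by apply: measurable_funX; exact: measurable_funB.
have na0 : 0 < n%:R * a by rewrite mulr_gt0.
have G01 x : 0 <= G x <= 1.
  by rewrite expR_ge0 expR_le1 oppr_le0 mulr_ge0 ?sqr_ge0// ltW.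
(* Where [U >= 2 c], [(U - c)^2 >= U^2 / 4]. Elsewhere [ga U^2 <= 1], so
   [G <= 1 <= exp (1 - ga U^2)], a Gaussian whose mass is a power of [c + 1]; the 1 keeps it finite
   at [c = 0]. *)
pose ga := ((2 * (c + 1)) ^+ 2)^-1.
have c1 : 0 < (2 * (c + 1)) ^+ 2 by rewrite exprn_gt0// mulr_gt0// ltr_wpDl.
have ga0 : 0 < ga by rewrite invr_gt0.
have me (s : R) : measurable_fun setT (fun x => expR (- (s * U x ^+ 2))).
  apply: measurableT_comp => //; apply: measurable_funN; apply: measurable_funM => //.
  exact: measurable_funX.
have iG : (\int[mu]_x (G x)%:E <= (K * P + expR 1 * (K * ga `^ (- (al + 1))))%:E)%E.
  apply: (@le_trans _ _ (\int[mu]_x (expR (- (n%:R * a / 4 * U x ^+ 2)) +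
       expR 1 * expR (- (ga * U x ^+ 2)))%:E)%E).
    apply: ge0_le_integral => //.
    - by move=> x _; rewrite lee_fin expR_ge0.
    - exact/measurable_EFinP.
    - by apply/measurable_EFinP; apply: measurable_funD => //; exact: measurable_funM.
    move=> x _; rewrite lee_fin; have u0 := U_ge0 n x.
    have [l|l] := leP (2 * c) (U x).
      apply: (@le_trans _ _ (expR (- (n%:R * a / 4 * U x ^+ 2)))); last first.
        by rewrite lerDl mulr_ge0 ?expR_ge0.
      rewrite ler_expR lerN2 -mulrA ler_wpM2l// ?(ltW na0)//.
      have h : 0 <= U x - 2 * c by lra.
      have : 0 <= (U x - 2 * c) * (3 * U x - 2 * c) by rewrite mulr_ge0//; lra.
      by move: (U x) => u; lra.
    apply: (@le_trans _ _ 1); first by case/andP: (G01 x).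
    apply: (@le_trans _ _ (expR 1 * expR (- (ga * U x ^+ 2)))); last first.
      by rewrite lerDr expR_ge0.
    rewrite -expRD -[leLHS]expR0 ler_expR subr_ge0 mulrC ler_pdivrMr// mul1r.
    by rewrite ler_pXn2r// ?nnegrE; lra.
  under eq_integral do rewrite EFinD.
  rewrite ge0_integralD//;
    try (by move=> x _; rewrite lee_fin ?mulr_ge0 ?expR_ge0);
    try exact/measurable_EFinP;
    try (by apply/measurable_EFinP; exact: measurable_funM).
  rewrite gauss_mass; last by rewrite divr_gt0.
  under eq_integral do rewrite EFinM.
  rewrite ge0_integralZl_EFin ?expR_ge0//;
    try (by move=> x _; rewrite lee_fin expR_ge0); try exact/measurable_EFinP.
  by rewrite gauss_mass// -EFinM -EFinD.
have y1 : 1 <= 1 + y by rewrite lerDl.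
have gaQ : ga `^ (- (al + 1)) <= Q * (1 + y) ^+ (2 * N).
  have -> : ga `^ (- (al + 1)) = ((2 * (c + 1)) ^+ 2) `^ (al + 1).
    by rewrite /ga -powR_inv1 ?(ltW c1)// -powRrM mulN1r opprK.
  apply: (@le_trans _ _ (((2 * (c + 1)) ^+ 2) `^ N%:R)).
    by rewrite ler_powR// exprn_ege1//; lra.
  have QE : Q * (1 + y) ^+ (2 * N) = (((2 + a^-1) * (1 + y)) ^+ 2) ^+ N.
    by rewrite /Q exprM -exprMn -exprMn.
  rewrite QE powR_mulrn ?(ltW c1)//.
  have ai0 : 0 < a^-1 by rewrite invr_gt0.
  have cE : c = y * a^-1 / 2 by rewrite /c invfM; lra.
  have h : 2 * (c + 1) <= (2 + a^-1) * (1 + y).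
    have ya0 : 0 <= y * a^-1 by rewrite mulr_ge0// ltW.
    by rewrite cE; move: (a^-1) ai0 ya0; clear -y0 => i i0 yi; lra.
  have r0 : 0 <= 2 * (c + 1) by rewrite mulr_ge0// addr_ge0.
  have r1 := le_trans r0 h.
  by rewrite lerXn2r ?nnegrE ?sqr_ge0// lerXn2r ?nnegrE.
have E x : nc (f x) * expR (n%:R * U x * y) =
    expR (n%:R * y ^+ 2 / (4 * a)) * (nc (f x) * (expR (n%:R * a * U x ^+ 2) * G x)).
  rewrite mulrCA; congr (_ * _); rewrite /G -!expRD; congr expR.
  by rewrite /c; field; rewrite gt_eqF.
under eq_integral do rewrite E EFinM.
rewrite ge0_integralZl_EFin ?expR_ge0//; last 2 first.
- by move=> x _; rewrite lee_fin !mulr_ge0 ?nc_ge0 ?expR_ge0.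
- apply/measurable_EFinP; apply: measurable_funM; first exact: measurable_nc.
  apply: measurable_funM => //.
  by apply: measurableT_comp => //; apply: measurable_funM => //; exact: measurable_funX.
rewrite [X in (_ <= X%:E)%E]mulrC EFinM; apply: lee_wpmul2l; first by rewrite lee_fin expR_ge0.
apply: (le_trans (hb G _ mG G01 iG)); rewrite lee_fin.
have yN : 1 <= (1 + y) ^+ (2 * N) by exact: exprn_ege1.
move: ((1 + y) ^+ _) yN gaQ => Y Y1.
move: (ga `^ _) => g gQ.
have e10 : 0 <= expR 1 * K by rewrite mulr_ge0 ?expR_ge0.
apply: (@le_trans _ _ ((M * (K * P + expR 1 * K * Q) + S) * Y)); last first.
  by rewrite ler_wpM2r ?lerDr//; lra.
have h1 : expR 1 * (K * g) <= expR 1 * K * Q * Y.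
  by rewrite [leLHS]mulrA -[leRHS]mulrA; exact: ler_wpM2l.
have h2 : K * P <= K * P * Y by rewrite ler_peMr// mulr_ge0.
have h3 : S <= S * Y by rewrite ler_peMr.
rewrite [leRHS]mulrDl; apply: lerD => //; rewrite -mulrA; apply: ler_wpM2l => //.
by rewrite mulrDl; exact: lerD.
Qed.

(** [|x| = U^n] is absorbed by [exp (n U / (1 + y))] at the price of [(1 + y)^n]. This shifts [y] to
    [z = y + 1 / (1 + y)], and [z^2 <= y^2 + 3] costs only the constant [E3]; a fixed shift would
    change the Gaussian rate. *)
Lemma gbound_mulx (a A : R) N (F : R -> R[i]) : 0 < a -> 1 <= A -> gbound a A N F ->
  exists A' N', 1 <= A' /\ gbound a A' N' (fun x => x%:C * F x).
Proof.
move=> a0 A1 [mF hF]; have n0 : (0 : R) < n%:R by exact: n_gt0.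
pose E3 := expR (n%:R * 3 / (4 * a)).
have E31 : 1 <= E3.
  by rewrite -[leLHS]expR0 ler_expR divr_ge0 ?mulr_ge0// ltW.
pose D : R := 1 + n`!%:R.
exists (D * (A * 2 ^+ N * E3)), (n + N)%N; split.
  rewrite -[leLHS]mulr1 ler_pM// ?lerDl// -[leLHS]mulr1 ler_pM// -[leLHS]mulr1 ler_pM//.
  by rewrite exprn_ege1// ler1n.
split; first by apply: cmeasurableM => //; apply: cmeasurableR; exact: measurable_id.
move=> y y0; pose z := y + (1 + y)^-1.
have y10 : 0 < 1 + y by rewrite ltr_pwDl.
have yi0 : 0 < (1 + y)^-1 by rewrite invr_gt0.
have yi1 : (1 + y)^-1 <= 1 by rewrite invf_le1// lerDl.
have z0 : 0 <= z by rewrite addr_ge0// ltW.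
have mU := @measurable_U R n.
have me (t : R) : measurable_fun setT (fun x => expR (n%:R * U x * t)).
  by apply: measurableT_comp => //; do 2 apply: measurable_funM => //.
apply: (@le_trans _ _ (\int[mu]_x ((D * (1 + y) ^+ n) * (nc (F x) * expR (n%:R * U x * z)))%:E)%E).
  apply: ge0_le_integral => //.
  - by move=> x _; rewrite lee_fin mulr_ge0 ?nc_ge0 ?expR_ge0.
  - apply/measurable_EFinP; apply: measurable_funM => //; apply: measurable_nc.
    by apply: cmeasurableM => //; apply: cmeasurableR; exact: measurable_id.
  - apply/measurable_EFinP; apply: measurable_funM => //; apply: measurable_funM => //.
    exact: measurable_nc.
  move=> x _; rewrite lee_fin ncM ncR -(Un n1 x) /z mulrDr expRD.
  have e0 : 0 < n%:R / (1 + y) by rewrite divr_gt0.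
  have u0 := U_ge0 n x.
  have h := pow_le_expR n e0 u0.
  have h' : U x ^+ n <= D * (1 + y) ^+ n * expR (n%:R * U x / (1 + y)).
    rewrite [n%:R * U x / _]mulrAC; apply: (le_trans h); rewrite ler_wpM2r ?expR_ge0//.
    rewrite ler_pdivrMr ?exprn_gt0// -mulrA -exprMn mulrCA mulfV ?gt_eqF// mulr1.
    apply: (@le_trans _ _ D); first by rewrite /D lerDr.
    by rewrite ler_peMr ?addr_ge0// exprn_ege1// ler1n.
  apply: (@le_trans _ _ (D * (1 + y) ^+ n * expR (n%:R * U x / (1 + y)) * nc (F x) *
    expR (n%:R * U x * y))).
    by rewrite ler_wpM2r ?expR_ge0// ler_wpM2r ?nc_ge0.
  rewrite le_eqVlt; apply/orP; left; apply/eqP.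
  by move: (expR _) (expR _) (nc _) => e1 e2 e3; ring.
under eq_integral do rewrite EFinM.
have D0 : 0 <= D * (1 + y) ^+ n by rewrite mulr_ge0 ?exprn_ge0 ?addr_ge0.
rewrite ge0_integralZl_EFin//; last 2 first.
- by move=> x _; rewrite lee_fin mulr_ge0 ?nc_ge0 ?expR_ge0.
- by apply/measurable_EFinP; apply: measurable_funM => //; exact: measurable_nc.
apply: (@le_trans _ _ ((D * (1 + y) ^+ n)%:E * (A * (1 + z) ^+ N * expR (n%:R * z ^+ 2 / (4 * a)))%:E)%E).
  by apply: lee_wpmul2l; [rewrite lee_fin|exact: hF].
rewrite -EFinM lee_fin.
have h1 : (1 + z) ^+ N <= 2 ^+ N * (1 + y) ^+ N.
  by rewrite -exprMn lerXn2r ?nnegrE ?mulr_ge0 ?addr_ge0// /z; lra.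
have h2 : expR (n%:R * z ^+ 2 / (4 * a)) <= E3 * expR (n%:R * y ^+ 2 / (4 * a)).
  rewrite /E3 -expRD ler_expR -mulrDl -mulrDr ler_pM2r ?invr_gt0 ?mulr_gt0//.
  rewrite ler_pM2l// /z sqrrD.
  have yy : y / (1 + y) <= 1 by rewrite ler_pdivrMr//; lra.
  have : (1 + y)^-1 ^+ 2 <= 1 by rewrite exprn_ile1// ltW.
  by move: yy; rewrite mulr2n; move: (y / _) (_^-1 ^+ 2) => u v; lra.
rewrite exprD; have A0 : 0 <= A by lra.
apply: (@le_trans _ _ (D * (1 + y) ^+ n * (A * (2 ^+ N * (1 + y) ^+ N) *
   (E3 * expR (n%:R * y ^+ 2 / (4 * a)))))).
  rewrite ler_wpM2l// ler_pM ?expR_ge0//.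
    by rewrite mulr_ge0// exprn_ge0// addr_ge0.
  by rewrite ler_wpM2l.
rewrite le_eqVlt; apply/orP; left; apply/eqP.
by move: (expR _) E3 {E31 h2} ((1 + y) ^+ n) ((1 + y) ^+ N) (2 ^+ N) => *; ring.
Qed.

(** The weight [exp (n a U^2)] is shared out in quarters, each [exp (e U^2)]: two make the test
    weight integrable, one pays for the factor [x], and one remains for the moment problem. *)
Lemma exp_integrable_Lp p q (a : R) (f : R -> R[i]) : (1 <= p)%E -> (1 <= q)%E -> 0 < a ->
  cmeasurable f ->
  inLpLq k n p q (fun x => (expR (n%:R * a * `|x| `^ (2 / n%:R)))%:C * f x) ->
  cintegrable k n (fun x => f x * (expR (n%:R * a / 4 * U x ^+ 2))%:C) /\
  cintegrable k n (fun x => x%:C * f x * (expR (n%:R * a / 4 * U x ^+ 2))%:C).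
Proof.
move=> p1 q1 a0 mf hf; have [M [S [M0 S0 hb]]] := weighted_bound p1 q1 mf hf.
have n0 : (0 : R) < n%:R by exact: n_gt0.
pose e := n%:R * a / 4; have e0 : 0 < e by rewrite divr_gt0 ?mulr_gt0.
have naE : n%:R * a = 4 * e by rewrite /e [4 * _]mulrC divfK.
have mU := @measurable_U R n.
have me (s : R) : measurable_fun setT (fun x => expR (s * U x ^+ 2)).
  by apply: measurableT_comp => //; apply: measurable_funM => //; exact: measurable_funX.
pose G x := expR (- (2 * e * U x ^+ 2)).
have e20 : 0 < 2 * e by rewrite mulr_gt0.
have mG : measurable_fun setT G.
  by rewrite /G; under eq_fun do rewrite -mulNr; exact: me.
have G01 x : 0 <= G x <= 1.
  by rewrite expR_ge0 expR_le1 oppr_le0 mulr_ge0 ?sqr_ge0// ltW.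
have iG : (\int[mu]_x (G x)%:E <= (KG k n (al + 1) * (2 * e) `^ (- (al + 1)))%:E)%E.
  by rewrite gauss_mass.
have := hb G _ mG G01 iG; move: (M * _ + S) => B hB.
have {}hB : (\int[mu]_x (nc (f x) * expR (2 * e * U x ^+ 2))%:E <= B%:E)%E.
  apply: le_trans hB; rewrite le_eqVlt; apply/orP; left; apply/eqP.
  apply: eq_integral => x _; congr (_ * _)%:E; rewrite /G -expRD naE; congr expR.
  by ring.
pose D := 1 + (1 + n`!%:R / e ^+ n).
have D1 : 1 <= D by rewrite lerDl addr_ge0// divr_ge0// exprn_ge0// ltW.
have bnd (h : R -> R[i]) : cmeasurable h ->
    (forall x, nc (h x) <= D * (nc (f x) * expR (2 * e * U x ^+ 2))) -> cintegrable k n h.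
  move=> mh hh; apply: (cintegrable_bound mh _ hh).
    apply: measurable_funM => //; apply: measurable_funM => //; exact: measurable_nc.
  under eq_integral do rewrite EFinM.
  rewrite ge0_integralZl_EFin//; last 3 first.
  - by move=> x _; rewrite lee_fin mulr_ge0 ?nc_ge0 ?expR_ge0.
  - by apply/measurable_EFinP; apply: measurable_funM => //; exact: measurable_nc.
  - by lra.
  rewrite lte_mul_pinfty ?lee_fin//; first by lra.
  exact: le_lt_trans hB (ltry _).
have e1 x : 1 <= expR (e * U x ^+ 2).
  by rewrite -[leLHS]expR0 ler_expR mulr_ge0 ?sqr_ge0// ltW.
have e2 x : expR (2 * e * U x ^+ 2) = expR (e * U x ^+ 2) * expR (e * U x ^+ 2).
  by rewrite -expRD; congr expR; ring.
split; apply: bnd.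
- by apply: cmeasurableM => //; exact: cmeasurableR.
- move=> x; rewrite ncM ncR ger0_norm ?expR_ge0// -/e e2.
  apply: (@le_trans _ _ (nc (f x) * (expR (e * U x ^+ 2) * expR (e * U x ^+ 2)))).
    by rewrite ler_wpM2l ?nc_ge0// ler_peMr ?expR_ge0.
  by rewrite ler_peMl// mulr_ge0 ?nc_ge0// mulr_ge0 ?expR_ge0.
- apply: cmeasurableM; last exact: cmeasurableR.
  by apply: cmeasurableM => //; apply: cmeasurableR; exact: measurable_id.
- move=> x; rewrite !ncM !ncR [`|expR _|]ger0_norm ?expR_ge0// -/e e2.
  have h : `|x| <= D * expR (e * U x ^+ 2).
    rewrite -(Un n1 x); have u0 := U_ge0 n x.
    have hp := pow_le_expR n e0 (sqr_ge0 (U x)).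
    (* Squaring reduces to powers of [U^2], to which the bound by [exp (e U^2)] applies whatever the
       parity of [n]. *)
    have hu : U x ^+ n <= 1 + (U x ^+ 2) ^+ n.
      rewrite -exprM mulnC exprM; move: (U x ^+ n) (exprn_ge0 n u0) => u u0'.
      by have := sqr_ge0 (u - 2^-1); rewrite sqrrB; lra.
    apply: (le_trans hu); rewrite /D mulrDl mul1r lerD ?e1//; last first.
      apply: (le_trans hp); rewrite ler_wpM2r ?expR_ge0// lerDr//.
  rewrite mulrAC; apply: (@le_trans _ _ (D * expR (e * U x ^+ 2) * expR (e * U x ^+ 2) * nc (f x))).
    by rewrite ler_wpM2r ?nc_ge0// ler_wpM2r ?expR_ge0.
  by rewrite le_eqVlt; apply/orP; left; apply/eqP; ring.
Qed.

End Growth.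

(** * Folding the real line onto a half-line *)

Section Reflection.
Context {R : realType}.
Local Notation leb := (@lebesgue_measure R).

Lemma ge0_integral_opp (D : set R) (f : R -> \bar R) : measurable D ->
  measurable_fun setT f -> (forall x, 0 <= f x)%E ->
  (\int[leb]_(x in D) f x = \int[leb]_(x in -%R @^-1` D) f (- x)%R)%E.
Proof.
move=> mD mf f0.
transitivity (\int[pushforward leb (-%R : _ -> measurableTypeR R)]_(y in D) f y)%E.
  by apply: eq_measure_integral => //= A mA AS; exact/esym/lebesgue_measureN.
by rewrite ge0_integral_pushforward//; exact: measurable_funS mf.
Qed.

Lemma integral_opp (D : set R) (f : R -> \bar R) : measurable D ->
  measurable_fun setT f ->
  (\int[leb]_(x in D) f x = \int[leb]_(x in -%R @^-1` D) f (- x)%R)%E.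
Proof.
move=> mD mf; rewrite integralE [RHS]integralE; congr (_ - _)%E.
  rewrite (ge0_integral_opp mD (measurable_funepos mf))//.
  by apply: eq_integral => x _; rewrite !funeposE.
rewrite (ge0_integral_opp mD (measurable_funeneg mf))//.
by apply: eq_integral => x _; rewrite !funenegE.
Qed.

Lemma integrable_opp (f : R -> R) : leb.-integrable setT (EFin \o f) ->
  leb.-integrable setT (EFin \o (fun x => f (- x))).
Proof.
move=> /integrableP[mf fi]; apply/integrableP; split.
  by apply: (measurableT_comp mf); exact: oppr_measurable.
move: fi; rewrite ge0_integral_opp//.
by apply: measurableT_comp => //; exact: mf.
Qed.

(** Lebesgue differentiation: [s] is almost everywhere the derivative of its integral, which
    vanishes identically on the negative half-line. *)
Lemma ae_zero_halfline (s : R -> R) : leb.-integrable setT (EFin \o s) ->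
  (forall y, y < 0 -> Rintegral leb `]-oo, y] s = 0) ->
  {ae leb, forall x, x < 0 -> s x = 0}.
Proof.
move=> si s0.
have li : locally_integrable setT s by apply: open_integrable_locally => //; exact: openT.
have iy (y : R) : leb.-integrable `]-oo, y] (EFin \o s) by exact: integrableS si.
have FF : Filter (nbhs (almost_everywhere leb)) := ae_filter_ringOfSetsType leb.
have := FTC1Ny iy li; apply: filterS => x [_ dx] x0.
rewrite -dx derive1E.
rewrite (@near_eq_derive _ _ _ _ (cst 0)); first by rewrite derive_cst.
by near=> y; apply: s0; near: y; exact: near_lt.
Unshelve. all: by end_near. Qed.

(** Integrals over [|x| > X] see only the symmetrization of [h], so exactly that is shown to
    vanish. *)
Lemma sym_threshold_zero (h : R -> R) : leb.-integrable setT (EFin \o h) ->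
  (forall X, 0 < X -> Rintegral leb [set x | X < `|x|] h = 0) ->
  {ae leb, forall x, x < 0 -> h x + h (- x) = 0}.
Proof.
move=> hi hX; have hi' := integrable_opp hi.
apply: (ae_zero_halfline (s := fun x => h x + h (- x))) => [|y y0].
  exact: (integrableD measurableT hi hi').
have iS (D : set R) : measurable D -> leb.-integrable D (EFin \o h).
  by move=> mD; apply: integrableS hi.
rewrite RintegralD//; [|exact: iS|exact: integrableS hi'].
have -> : Rintegral leb `]-oo, y] (fun x => h (- x)) = Rintegral leb `[- y, +oo[ h.
  rewrite /Rintegral (integral_opp (D := `[- y, +oo[%classic) (f := EFin \o h))//.
    by rewrite opp_preimage_itvbndy opprK.
  by case/integrableP: hi.
rewrite -Rintegral_itv_bndo_bndc; last exact: iS.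
rewrite -Rintegral_itv_obnd_cbnd; last exact: iS.
rewrite -Rintegral_setU//; last 2 first.
- by apply: iS; exact: measurableU.
- apply/disj_setPS => x /= []; rewrite !in_itv/= andbT => h1 h2; lra.
rewrite -[RHS](hX (- y)); last by rewrite oppr_gt0.
congr (Rintegral leb _ h); apply/seteqP; split => x /=; rewrite !in_itv/= ?andbT.
  move=> [xy|xy]; first by rewrite ltr0_norm ?ltrN2//; lra.
  by rewrite gtr0_norm//; lra.
by rewrite lter_normr => /orP[|]; [right|rewrite ltrN2; left].
Qed.

Lemma integral_abs_zero (h : R -> R) : measurable_fun setT h ->
  {ae leb, forall x, x < 0 -> h x = 0 /\ h (- x) = 0} ->
  (\int[leb]_x (`|h x|)%:E = 0)%E.
Proof.
move=> mh ae0.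
have FF : Filter (nbhs (almost_everywhere leb)) := ae_filter_ringOfSetsType leb.
have ma : measurable_fun setT (fun x : R => `|h x|%:E).
  by apply/measurable_EFinP; exact: measurableT_comp.
have ma' : measurable_fun setT (fun x : R => `|h (- x)|%:E).
  by apply: (measurableT_comp ma); exact: oppr_measurable.
have s1 : (\int[leb]_(x in `]-oo, 0%R[) `|h x|%:E = 0)%E.
  rewrite (ge0_ae_eq_integral (g := cst 0%E))//; first by rewrite integral0.
  - exact: measurable_funTS.
  - apply: filterS ae0 => x hx /=; rewrite in_itv/= => x0.
    by have [-> _] := hx x0; rewrite normr0.
have s2 : (\int[leb]_(x in `[0%R, +oo[) `|h x|%:E = 0)%E.
  rewrite ge0_integration_by_substitution0//.
  rewrite -integral_itv_bndo_bndc//; last exact: measurable_funTS.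
  rewrite (ge0_ae_eq_integral (g := cst 0%E))//; first by rewrite integral0.
  - exact: measurable_funTS.
  - apply: filterS ae0 => x hx /=; rewrite in_itv/= => x0.
    by have [_ ->] := hx x0; rewrite normr0.
rewrite -(setUv `]-oo, 0%R[%classic) ge0_integral_setU//=.
- by rewrite setCitvl s1 s2 adde0.
- exact: measurableC.
- exact: measurable_funTS.
- exact/disj_setPCl.
Qed.

End Reflection.

(** * Vanishing moments force vanishing almost everywhere *)

Section MomentUniqueness.
Context {R : realType} (k : R) (n : nat).
Hypotheses (n1 : (1 <= n)%N) (hk : (n%:R - 1) / (2 * n%:R) <= k).
Local Notation leb := (@lebesgue_measure R).
Local Notation mu := (mu_kn k n).
Local Notation U := (@nroot R n).
Local Notation w := (weight_kn k n).

Lemma integral_density (D : set R) (f : R -> R) : measurable D -> measurable_fun setT f ->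
  (\int[mu]_(x in D) (f x)%:E = \int[leb]_(x in D) (f x * w x)%:E)%E.
Proof.
move=> mD mf; have mE : measurable_fun D (EFin \o f).
  by apply: measurable_funTS; exact/measurable_EFinP.
rewrite integralE [RHS]integralE; congr (_ - _)%E.
  rewrite (ge0_integral_density n1 hk)//; last exact: measurable_funepos.
  apply: eq_integral => x _; rewrite !funeposE -!EFin_max -EFinM.
  by rewrite maxr_pMl ?mul0r//; exact: weight_ge0.
rewrite (ge0_integral_density n1 hk)//; last exact: measurable_funeneg.
apply: eq_integral => x _; rewrite !funenegE -!EFinN -!EFin_max -EFinM.
by rewrite maxr_pMl ?mul0r ?mulNr//; exact: weight_ge0.
Qed.

Lemma integrable_density (f : R -> R) : mu.-integrable setT (EFin \o f) ->
  leb.-integrable setT (EFin \o (fun x => f x * w x)).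
Proof.
move=> /integrableP[/measurable_EFinP mf fi]; apply/integrableP; split.
  apply/measurable_EFinP; apply: measurable_funM => //; exact: measurable_weight.
move: fi; rewrite (ge0_integral_density n1 hk)//; last first.
  by apply: measurableT_comp => //; exact/measurable_EFinP.
by under eq_integral do rewrite /= -EFinM -[X in _ * X]ger0_norm ?weight_ge0// -normrM.
Qed.

Lemma integral_odd (f : R -> R) : mu.-integrable setT (EFin \o f) ->
  (forall x, f (- x) = - f x) -> Rintegral mu setT f = 0.
Proof.
move=> fi fo; have /integrableP[/measurable_EFinP mf _] := fi.
have E : Rintegral mu setT f = - Rintegral mu setT f.
  rewrite -[RHS]mulN1r -RintegralZl// /Rintegral !integral_density//; last first.
    exact: measurable_funM.
  rewrite [in LHS]integral_opp//.
    by rewrite preimage_setT; congr fine; apply: eq_integral => x _; rewrite fo mulN1r /weight_kn normrN.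
  by apply/measurable_EFinP; apply: measurable_funM => //; exact: measurable_weight.
by move: E; move: (Rintegral _ _ _) => u E; lra.
Qed.

Lemma mu_level (V : R) : mu [set x | U x ^+ 2 = V] = 0%E.
Proof.
have mU := @measurable_U R n.
have mL : measurable [set x | U x ^+ 2 = V].
  have mU2 : measurable_fun setT (fun x => U x ^+ 2) by exact: measurable_funX.
  by have := mU2 measurableT _ (measurable_set1 V); rewrite setTI.
apply: null_set_integral => //.
  apply: measurable_funTS; apply/measurable_EFinP; apply: measurable_maxr => //.
  exact: measurable_weight.
pose X := Num.sqrt V ^+ n.
apply: (@subset_measure0 _ _ _ leb _ [set X; - X]) => //.
- exact: measurableU.
- move=> x /= xV; have xX : `|x| = X.
    by rewrite -(Un n1 x) /X -xV sqrtr_sqr ger0_norm ?U_ge0.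
  by rewrite -xX; case: (ger0P x) => _; [left|right; rewrite opprK].
- by apply: countable_lebesgue_measure0; exact: finite_set_countable.
Qed.

Lemma U_lt (x y : R) : (U x < U y) = (`|x| < `|y|).
Proof. by rewrite -(Un n1 x) -(Un n1 y) ltr_pXn2r// nnegrE U_ge0. Qed.

(** [U^2] depends on [|x|] only, so the moments of [H] control its even part; those of [x H] control
    its odd part. The two relations between the values at [x] and [-x] force both to vanish. *)
Lemma moments_zero_ae (H : R -> R) (c : R) : 0 < c -> measurable_fun setT H ->
  mu.-integrable setT (fun x => (H x * expR (c * U x ^+ 2))%:E) ->
  mu.-integrable setT (fun x => (x * H x * expR (c * U x ^+ 2))%:E) ->
  (forall m, Rintegral mu setT (fun x => H x * (U x ^+ 2) ^+ m) = 0) ->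
  (forall m, Rintegral mu setT (fun x => x * H x * (U x ^+ 2) ^+ m) = 0) ->
  {ae mu, forall x, H x = 0}.
Proof.
move=> c0 mH i1 i2 m1 m2.
have mU := @measurable_U R n.
have mv : measurable_fun setT (fun x => U x ^+ 2) by exact: measurable_funX.
have v0 x : 0 <= U x ^+ 2 by exact: sqr_ge0.
have key (f : R -> R) : measurable_fun setT f ->
    mu.-integrable setT (fun x => (f x * expR (c * U x ^+ 2))%:E) ->
    (forall m, Rintegral mu setT (fun x => f x * (U x ^+ 2) ^+ m) = 0) ->
    {ae leb, forall x, x < 0 -> f x * w x + f (- x) * w (- x) = 0}.
  move=> mf fi fm.
  have f1 : mu.-integrable setT (EFin \o f).
    have := @integrable_weight _ _ _ mu (fun x => U x ^+ 2) f c mf fi (cst 1) 1.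
    rewrite (_ : (fun x => _) = EFin \o f); last first.
      by apply/funext => x /=; rewrite mulr1.
    apply=> // x; rewrite normr1 mul1r -[leLHS]expR0 ler_expR.
    by rewrite mulr_ge0// ltW.
  apply: (sym_threshold_zero (integrable_density f1)) => X X0.
  have UX0 : 0 < U X ^+ 2 by rewrite exprn_gt0// powR_gt0// normr_gt0 gt_eqF.
  have := threshold_zero mv v0 mf c0 fi fm UX0 (mu_level _).
  have -> : [set x | U X ^+ 2 < U x ^+ 2] = [set x | X < `|x|].
    apply/seteqP; split => x /=; rewrite ltr_pXn2r// ?nnegrE ?U_ge0// U_lt (gtr0_norm X0)//.
  rewrite /Rintegral integral_density//.
  have -> : [set x | X < `|x|] = (fun x : R => `|x|) @^-1` `]X, +oo[%classic.
    by apply/seteqP; split => x /=; rewrite in_itv/= andbT.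
  by rewrite -[X in measurable X]setTI; exact: normr_measurable.
have mw := measurable_weight k n.
have FF : Filter (nbhs (almost_everywhere leb)) := ae_filter_ringOfSetsType leb.
have ae0 : {ae leb, forall x, x < 0 -> H x * w x = 0 /\ H (- x) * w (- x) = 0}.
  have mx : measurable_fun setT (fun x : R => x * H x) by exact: measurable_funM.
  apply: filterS2 (key _ mH i1 m1) (key _ mx i2 m2) => x h1 h2 x0.
  move: (h1 x0) (h2 x0); rewrite -!mulrA mulNr -mulrBr.
  move: (H x * w x) (H (- x) * w (- x)) => u v uv /eqP.
  rewrite mulf_eq0 (lt_eqF x0) /= subr_eq0 => /eqP uE; lra.
have i0 : (\int[mu]_x `|(H x)%:E| = 0)%E.
  rewrite (ge0_integral_density n1 hk)//; last first.
    by apply: measurableT_comp => //; exact/measurable_EFinP.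
  rewrite -[RHS](integral_abs_zero (h := fun x => H x * w x) _ ae0); last exact: measurable_funM.
  by apply: eq_integral => x _; rewrite normrM [`|w x|]ger0_norm// weight_ge0.
have mE : measurable_fun setT (EFin \o H) by exact/measurable_EFinP.
have [h _] := ae_eq_integral_abs mu measurableT mE.
have FM : Filter (nbhs (almost_everywhere mu)) := ae_filter_ringOfSetsType mu.
by apply: filterS (h i0) => x /(_ I) [].
Qed.

End MomentUniqueness.

(** * The transform as a pair of entire Hankel-type transforms *)

Section Transform.
Context {R : realType} (k : R) (n : nat).
Hypotheses (n1 : (1 <= n)%N) (hk : (n%:R - 1) / (2 * n%:R) <= k).
Local Notation nc := (@ComplexField.Normc.normc R).
Local Notation Re := (@complex.Re R).
Local Notation Im := (@complex.Im R).
Local Notation mu := (mu_kn k n).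
Local Notation al := (alpha k n).
Local Notation U := (@nroot R n).
Local Notation cint := (complex_integral k n).
Local Notation cintegrable := (cintegrable k n).
Local Notation gbound := (gbound k n).

Lemma half_pow_small (W e : R) : 0 <= W -> 0 < e ->
  exists M0, forall M, (M0 <= M)%N -> W * 2^-1 ^+ M <= e.
Proof.
move=> W0 e0; exists (Num.trunc (W / e)).+1 => M hM.
have We : 0 <= W / e by rewrite divr_ge0// ltW.
have /andP[_ h] := truncn_itv We.
rewrite exprVn ler_pdivrMr ?exprn_gt0// mulrC -ler_pdivrMr//.
apply: (le_trans (ltW h)); rewrite -natrX ler_nat.
by apply: (leq_trans hM); exact: ltnW (ltn_expl _ _).
Qed.

Lemma cmeasurable_JC beta z : - 2^-1 <= beta ->
  cmeasurable (fun x => JC beta ((n%:R * U x)%:C * z)).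
Proof.
move=> b0; have [c1 c2] := JC_ray_continuous z b0.
have mU : measurable_fun setT (fun x => n%:R * U x).
  by apply: measurable_funM => //; exact: measurable_U.
split.
  exact: (measurableT_comp (continuous_measurable_fun c1) mU).
exact: (measurableT_comp (continuous_measurable_fun c2) mU).
Qed.

Lemma cmeasurable_UX l : cmeasurable (fun x => (U x ^+ l)%:C).
Proof. by apply: cmeasurableR; apply: measurable_funX; exact: measurable_U. Qed.

Lemma gbound_mul a A N F h (c y : R) : gbound a A N F -> cmeasurable h -> 0 <= y ->
  0 <= c -> (forall x, nc (h x) <= c * expR (n%:R * U x * y)) ->
  cintegrable (fun x => F x * h x) /\
  nc (cint (fun x => F x * h x)) <=
    2 * (c * (A * (1 + y) ^+ N * expR (n%:R * y ^+ 2 / (4 * a)))).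
Proof.
move=> [mF hF] mh y0 c0 hh; have mFh := cmeasurableM mF mh.
have mU := @measurable_U R n.
have mF' := measurable_nc mF.
have me : measurable_fun setT (fun x => expR (n%:R * U x * y)).
  by apply: measurableT_comp => //; do 2 apply: measurable_funM => //.
have le : (\int[mu]_x (nc (F x * h x))%:E <=
    (c * (A * (1 + y) ^+ N * expR (n%:R * y ^+ 2 / (4 * a))))%:E)%E.
  apply: (@le_trans _ _ (\int[mu]_x (c * (nc (F x) * expR (n%:R * U x * y)))%:E)%E).
    apply: ge0_le_integral => //.
    - by move=> x _; rewrite lee_fin nc_ge0.
    - by apply/measurable_EFinP; exact: measurable_nc.
    - by apply/measurable_EFinP; apply: measurable_funM => //; exact: measurable_funM.
    - by move=> x _; rewrite lee_fin ncM mulrCA ler_wpM2l ?nc_ge0.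
  under eq_integral do rewrite EFinM.
  rewrite ge0_integralZl_EFin//.
  - by rewrite EFinM; apply: lee_wpmul2l; [rewrite lee_fin|exact: hF].
  - by move=> x _; rewrite lee_fin mulr_ge0 ?nc_ge0 ?expR_ge0.
  - by apply/measurable_EFinP; exact: measurable_funM.
split; first by apply: cintegrableW le; rewrite ?ltry.
exact: nc_cint_le.
Qed.

(** Entire in [z]: for [F = f], [beta = alpha] it extends the even part of the transform, and for
    [F = x f], [beta = alpha + n] the odd part divided by [kap] and [z^n]. [hc] lists its Taylor
    coefficients. *)
Definition HT beta F z := cint (fun x => F x * JC beta ((n%:R * U x)%:C * z)).

Definition hc beta F l : R[i] := (bc beta l * n%:R ^+ l)%:C * cint (fun x => F x * (U x ^+ l)%:C).

Lemma nU_norm x (z : R[i]) : nc ((n%:R * U x)%:C * z) = n%:R * U x * nc z.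
Proof. by rewrite ncM ncR ger0_norm// mulr_ge0 ?U_ge0. Qed.

Lemma nUX x (z : R[i]) l :
  ((n%:R * U x)%:C * z) ^+ l = (n%:R ^+ l)%:C * (U x ^+ l)%:C * z ^+ l.
Proof. by rewrite exprMn -(rmorphXn (real_complex R)) /= exprMn rmorphM. Qed.

Lemma HT_bound a A N F beta z : - 2^-1 <= beta -> gbound a A N F ->
  cintegrable (fun x => F x * JC beta ((n%:R * U x)%:C * z)) /\
  nc (HT beta F z) <= 2 * (A * (1 + `|Im z|) ^+ N * expR (n%:R * `|Im z| ^+ 2 / (4 * a))).
Proof.
move=> b0 gF; rewrite -[X in 2 * X]mul1r; apply: (gbound_mul gF) => //.
  exact: cmeasurable_JC.
move=> x; rewrite mul1r (le_trans (JC_bound _ b0))// ler_expR ImCM normrM.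
by rewrite [`|_ * U x|]ger0_norm// mulr_ge0 ?U_ge0.
Qed.

Lemma gbound_moment a A N F l : gbound a A N F ->
  cintegrable (fun x => F x * (U x ^+ l)%:C).
Proof.
move=> gF; have n0 : (0 : R) < n%:R by rewrite ltr0n.
have c0 : 0 <= l`!%:R / n%:R ^+ l :> R by rewrite divr_ge0 ?exprn_ge0.
have hh x : nc (U x ^+ l)%:C <= l`!%:R / n%:R ^+ l * expR (n%:R * U x * 1).
  rewrite ncR ger0_norm ?exprn_ge0 ?U_ge0// mulr1.
  by apply: pow_le_expR => //; exact: U_ge0.
by have [] := gbound_mul gF (cmeasurable_UX l) ler01 c0 hh.
Qed.

(** The tail of the Bessel series costs [exp (2 n U |z|)], that is the growth bound at [y = 2 |z|],
    in exchange for the rate [2^-M]. *)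
Lemma HT_apx a A N F beta z M : - 2^-1 <= beta -> gbound a A N F ->
  nc (HT beta F z - cpart (hc beta F) z M) <=
  4 * (A * (1 + 2 * nc z) ^+ N * expR (n%:R * (2 * nc z) ^+ 2 / (4 * a))) * 2^-1 ^+ M.
Proof.
move=> b0 gF; pose c l : R[i] := (bc beta l)%:C.
have [iJ _] := HT_bound z b0 gF.
have gb := egrowth_bc b0.
pose term l x := ((bc beta l * n%:R ^+ l)%:C * z ^+ l) * (F x * (U x ^+ l)%:C).
have it l : cintegrable (term l) by apply: cintegrableZ; exact: gbound_moment gF.
have [isum cs] := cintegrable_sum M it.
have tE x : \sum_(0 <= l < M) term l x = F x * cpart c ((n%:R * U x)%:C * z) M.
  rewrite /cpart mulr_sumr; apply: eq_bigr => l _.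
  rewrite /term /c nUX rmorphM /=.
  by move: (F x) (z ^+ l) ((U x ^+ l)%:C) ((n%:R ^+ l)%:C) => *; ring.
have pE : cpart (hc beta F) z M = cint (fun x => \sum_(0 <= l < M) term l x).
  rewrite cs /cpart; apply: eq_bigr => l _; rewrite /hc /term cintZ; last exact: gbound_moment gF.
  by ring.
have dE : HT beta F z - cpart (hc beta F) z M =
    cint (fun x => F x * (JC beta ((n%:R * U x)%:C * z) - cpart c ((n%:R * U x)%:C * z) M)).
  rewrite pE -[- cint _]mulN1r -cintZ// /HT -cintD//; last exact: cintegrableZ.
  by congr (complex_integral _ _ _); apply/funext => x; rewrite tE mulN1r mulrBr.
rewrite dE.
have mJ : cmeasurable (fun x => JC beta ((n%:R * U x)%:C * z) - cpart c ((n%:R * U x)%:C * z) M).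
  apply: cmeasurableD; first exact: cmeasurable_JC.
  under eq_fun do rewrite -mulN1r.
  apply: cmeasurableM; first exact: cmeasurableC.
  rewrite /cpart; elim: M {isum cs tE pE dE} => [|M IH].
    by under eq_fun do rewrite big_geq//; exact: cmeasurableC.
  under eq_fun do rewrite big_nat_recr//=.
  apply: cmeasurableD => //; apply: cmeasurableM; first exact: cmeasurableC.
  under eq_fun do rewrite nUX -mulrA.
  apply: cmeasurableM; first exact: cmeasurableC.
  by apply: cmeasurableM; [exact: cmeasurable_UX|exact: cmeasurableC].
have y0 : 0 <= 2 * nc z by apply: mulr_ge0 => //; exact: nc_ge0.
have c0 : 0 <= 2 * 2^-1 ^+ M :> R by apply: mulr_ge0 => //; exact: exprn_ge0.
have hh x : nc (JC beta ((n%:R * U x)%:C * z) - cpart c ((n%:R * U x)%:C * z) M) <=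
    2 * 2^-1 ^+ M * expR (n%:R * U x * (2 * nc z)).
  apply: (le_trans (csum_tail _ M gb)); rewrite nU_norm mulr1 -[leRHS]mulrA.
  apply: ler_wpM2l => //; apply: ler_wpM2l; first exact: exprn_ge0.
  rewrite ler_expR mul1r le_eqVlt; apply/orP; left; apply/eqP.
  by move: (U x) (nc z) => u v; ring.
have [_ h] := gbound_mul gF mJ y0 c0 hh.
apply: (le_trans h).
rewrite le_eqVlt; apply/orP; left; apply/eqP.
by move: (2^-1 ^+ M) (expR _) => e1 e2; ring.
Qed.

Definition HTerr (a A : R) N (r : R) := 4 * (A * (1 + 2 * r) ^+ N * expR (n%:R * (2 * r) ^+ 2 / (4 * a))).

Lemma HTerr_ge0 a A N r : 0 <= A -> 0 <= r -> 0 <= HTerr a A N r.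
Proof.
move=> A0 r0; apply: mulr_ge0 => //; apply: mulr_ge0; last exact: expR_ge0.
by apply: mulr_ge0 => //; apply: exprn_ge0; apply: addr_ge0 => //; exact: mulr_ge0.
Qed.

Lemma HTerr_le a A N r s : 0 < a -> 0 <= A -> 0 <= r <= s -> HTerr a A N r <= HTerr a A N s.
Proof.
move=> a0 A0 /andP[r0 rs]; have s0 := le_trans r0 rs.
rewrite ler_wpM2l// ler_pM ?expR_ge0//.
- by rewrite mulr_ge0// exprn_ge0// addr_ge0// mulr_ge0.
- by rewrite ler_wpM2l// lerXn2r ?nnegrE ?addr_ge0 ?mulr_ge0// lerD2l ler_wpM2l.
- rewrite ler_expR ler_wpM2r ?invr_ge0 ?mulr_ge0 ?(ltW a0)// ler_wpM2l//.
  by rewrite lerXn2r ?nnegrE ?mulr_ge0// ler_wpM2l.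
Qed.

Lemma papx_HT a A N F beta : 0 < a -> 0 <= A -> - 2^-1 <= beta -> gbound a A N F ->
  papx (HT beta F).
Proof.
move=> a0 A0 b0 gF r e e0; case: (ltP r 0) => r0.
  by exists 0 => z zr; have := nc_ge0 z; lra.
have [M0 hM0] := half_pow_small (HTerr_ge0 a N A0 r0) e0.
exists (\poly_(l < M0) hc beta F l) => z zr.
have := HT_apx z M0 b0 gF; rewrite /cpart big_mkord horner_poly => h.
apply: (le_trans h); apply: le_trans (hM0 _ (leqnn _)).
rewrite ler_wpM2r ?exprn_ge0//; apply: HTerr_le => //.
by rewrite nc_ge0.
Qed.

(** Taylor coefficients are recovered from values on the unit circle: the Cauchy estimate, applied
    to the difference of partial sums, is at most a constant times [2^-M] for every large [M]. *)
Lemma hc_unique a A N F a' A' N' F' beta (lam : R[i]) : 0 < a -> 0 <= A -> 0 < a' -> 0 <= A' ->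
  - 2^-1 <= beta -> gbound a A N F -> gbound a' A' N' F' ->
  (forall z, nc z = 1 -> HT beta F z = lam * HT beta F' z) ->
  forall l, hc beta F l = lam * hc beta F' l.
Proof.
move=> a0 A0 a'0 A'0 b0 gF gF' hz l.
pose W := HTerr a A N 1 + nc lam * HTerr a' A' N' 1.
have W0 : 0 <= W by rewrite addr_ge0 ?mulr_ge0 ?nc_ge0 ?HTerr_ge0.
apply/eqP; rewrite -subr_eq0; apply/eqP/nc_eq0/eqP; rewrite eq_le nc_ge0 andbT.
apply/ler_addgt0Pr => e e0; rewrite add0r.
have [M0 hM0] := half_pow_small W0 e0; pose M := maxn M0 l.+1.
apply: le_trans (hM0 M (leq_maxl _ _)).
pose p := \poly_(l < M) (hc beta F l - lam * hc beta F' l).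
have := @poly_coef_bound _ p 1 (W * 2^-1 ^+ M) ltr01 _ l.
rewrite expr1n mulr1 coef_poly leq_maxr; apply=> z z1.
have h1 := HT_apx z M b0 gF; have h2 := HT_apx z M b0 gF'.
have -> : p.[z] = lam * (HT beta F' z - cpart (hc beta F') z M) - (HT beta F z - cpart (hc beta F) z M).
  rewrite (hz z z1) horner_poly /cpart !big_mkord.
  under eq_bigr do rewrite mulrBl.
  rewrite sumrB mulrBr mulr_sumr.
  by under [in RHS]eq_bigr do rewrite mulrA; ring.
rewrite z1 in h1 h2; apply: (le_trans (ncB _ _)).
rewrite ncM /W mulrDl addrC; apply: lerD => //.
by rewrite -mulrA; apply: ler_wpM2l; [exact: nc_ge0|].
Qed.

Lemma HT_even beta F z : HT beta F (- z) = HT beta F z.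
Proof.
have E : (fun x => F x * JC beta ((n%:R * U x)%:C * - z)) =
    (fun x => F x * JC beta ((n%:R * U x)%:C * z)).
  by apply/funext => x; rewrite mulrN JC_even.
exact: (congr1 cint E).
Qed.

Definition kap : R[i] := (- 'i) ^+ n *
  ((n%:R / 2) ^+ n * Gamma (al + 1) / Gamma (al + n%:R + 1))%:C.

Lemma aln_ge : - 2^-1 <= al + n%:R.
Proof. by have := alpha_ge n1 hk; have : (0 : R) <= n%:R by []; lra. Qed.

Lemma kap_neq0 : kap != 0.
Proof.
have n0 : (0 : R) < n%:R by rewrite ltr0n.
rewrite /kap mulf_neq0//.
  by rewrite expf_neq0// oppr_eq0; apply/eqP => /(congr1 Im) /= /eqP; rewrite oner_eq0.
have g0 := GammaA_gt0 n1 hk.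
have g1 : 0 < Gamma (al + n%:R + 1) by apply: Gamma_gt0; have := aln_ge; lra.
apply/eqP => /(congr1 Re) /= /eqP; apply/negP.
by rewrite gt_eqF// divr_gt0// mulr_gt0// exprn_gt0// divr_gt0.
Qed.

Local Opaque jbessel JC Gamma.

Lemma FknE a A N a' A' N' f (l : R) : gbound a A N f ->
  gbound a' A' N' (fun x => x%:C * f x) ->
  Fkn k n f l = HT al f (`|l| `^ n%:R^-1)%:C +
    kap * l%:C * HT (al + n%:R) (fun x => x%:C * f x) (`|l| `^ n%:R^-1)%:C.
Proof.
move=> g1 g2; pose t := `|l| `^ n%:R^-1.
have b1 := alpha_ge n1 hk; have b2 := aln_ge.
have [i1 _] := HT_bound t%:C b1 g1; have [i2 _] := HT_bound t%:C b2 g2.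
transitivity (cint (fun x => f x * Bkn k n x l)) => //.
have D := cintD i1 (cintegrableZ (kap * l%:C) i2); rewrite (cintZ _ i2) in D.
refine (etrans _ D); congr (complex_integral _ _ _); apply/funext => x.
have tE : n%:R * `|l * x| `^ n%:R^-1 = n%:R * U x * t.
  by rewrite normrM powRM// /nroot /t mulrAC mulrA.
have tC : (n%:R * U x * t)%:C = (n%:R * U x)%:C * t%:C by exact: rmorphM.
have J1 := etrans (congr1 (JC al) (esym tC)) (jbesselE (n%:R * U x * t) b1).
have J2 := etrans (congr1 (JC (al + n%:R)) (esym tC)) (jbesselE (n%:R * U x * t) b2).
rewrite /Bkn tE J1 J2 (rmorphM (real_complex R) l x) /kap.
have rg (j1 j2 e1 e2 e3 e4 e5 : R[i]) :
  e1 * (j1 + e4 * e5 * (e3 * e2) * j2) = e1 * j1 + e4 * e5 * e3 * (e2 * e1 * j2) by ring.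
exact: rg.
Qed.

End Transform.

(** * Gaussians and their transforms *)

Section Gaussian.
Context {R : realType} (k : R) (n : nat).
Hypotheses (n1 : (1 <= n)%N) (hk : (n%:R - 1) / (2 * n%:R) <= k).
Local Notation nc := (@ComplexField.Normc.normc R).
Local Notation Re := (@complex.Re R).
Local Notation Im := (@complex.Im R).
Local Notation mu := (mu_kn k n).
Local Notation al := (alpha k n).
Local Notation U := (@nroot R n).
Local Notation cint := (complex_integral k n).
Local Notation cintegrable := (cintegrable k n).
Local Notation gbound := (gbound k n).

Definition gs (lam : R[i]) (c : R) x : R[i] := lam * (expR (- (c * U x ^+ 2)))%:C.

Lemma cmeasurable_gs lam c : cmeasurable (gs lam c).
Proof.
apply: cmeasurableM; first exact: cmeasurableC.
apply: cmeasurableR; apply: measurableT_comp => //; apply: measurable_funN.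
by apply: measurable_funM => //; apply: measurable_funX; exact: measurable_U.
Qed.

Lemma nc_gs lam c x : nc (gs lam c x) = nc lam * expR (- (c * U x ^+ 2)).
Proof. by rewrite ncM ncR ger0_norm ?expR_ge0. Qed.

Lemma Lp_gauss p lam c : (1 <= p)%E -> 0 < c -> inLp k n p (gs lam c).
Proof.
move=> p1 c0; split; first exact: cmeasurable_gs.
case: p p1 => [r| |] //; rewrite ?lee_fin => r1; rewrite unlock.
- have r0 : 0 < r by exact: lt_le_trans r1.
  apply: poweR_lty.
  have E x : (`|(nc (gs lam c x))%:E| `^ r)%E = ((nc lam `^ r)%:E * (expR (- (r * c * U x ^+ 2)))%:E)%E.
    rewrite abse_EFin poweR_EFin ger0_norm ?nc_ge0// nc_gs powRM ?nc_ge0 ?expR_ge0// EFinM.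
    by congr (_ * _)%E; rewrite -expRM mulNr; congr (expR (- _))%:E; ring.
  under eq_integral do rewrite E.
  have rc0 : 0 < r * c by rewrite mulr_gt0.
  rewrite ge0_integralZl_EFin ?powR_ge0//.
  + by rewrite (gauss_mass n1 hk rc0) -EFinM ltry.
  + apply/measurable_EFinP; apply: measurableT_comp => //; apply: measurable_funN.
    by apply: measurable_funM => //; apply: measurable_funX; exact: measurable_U.
- case: ifPn => // _; apply: (@le_lt_trans _ _ (nc lam)%:E); last exact: ltry.
  apply/ess_supP; apply: aeW => x /=; rewrite lee_fin ger0_norm ?nc_ge0// nc_gs.
  rewrite ler_piMr ?nc_ge0// expR_le1 oppr_le0 mulr_ge0 ?sqr_ge0// ltW//.
Qed.

Lemma gs_mul lam (a c : R) x :
  (expR (n%:R * a * `|x| `^ (2 / n%:R)))%:C * gs lam (n%:R * c) x = gs lam (n%:R * (c - a)) x.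
Proof.
rewrite /gs mulrCA; congr (_ * _); rewrite U2 -rmorphM /= -expRD; congr ((expR _)%:C).
by ring.
Qed.

Lemma gauss_LpLq p q lam (a c : R) : (1 <= p)%E -> (1 <= q)%E -> a < c ->
  inLpLq k n p q (fun x => (expR (n%:R * a * `|x| `^ (2 / n%:R)))%:C * gs lam (n%:R * c) x).
Proof.
move=> p1 q1 ac; exists (gs lam (n%:R * (c - a))), (gs 0 (n%:R * (c - a))).
have c0 : 0 < n%:R * (c - a) by rewrite mulr_gt0 ?subr_gt0// ltr0n.
split; first exact: Lp_gauss.
split; first exact: Lp_gauss.
by move=> x; rewrite gs_mul /gs mul0r addr0.
Qed.

(** Any rate strictly below [c] would do in place of [c / 2]; only some growth bound is wanted, so
    that the power series of the transform can be used. *)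
Lemma gbound_gauss lam c : 0 < c ->
  exists A N, 1 <= A /\ gbound (c / 2) A N (gs lam (n%:R * c)).
Proof.
move=> c0; have c2 : 0 < c / 2 by rewrite divr_gt0.
apply: (@gbound_Lp _ k n n1 hk +oo%E +oo%E); rewrite ?leey//.
  exact: cmeasurable_gs.
by apply: gauss_LpLq; rewrite ?leey//; lra.
Qed.

Lemma gauss_exp_integrable lam c : 0 < c ->
  cintegrable (fun x => gs lam (n%:R * c) x * (expR (n%:R * (c / 2) / 4 * U x ^+ 2))%:C) /\
  cintegrable (fun x => x%:C * gs lam (n%:R * c) x * (expR (n%:R * (c / 2) / 4 * U x ^+ 2))%:C).
Proof.
move=> c0; have c2 : 0 < c / 2 by rewrite divr_gt0.
apply: (@exp_integrable_Lp _ k n n1 hk +oo%E +oo%E); rewrite ?leey//.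
  exact: cmeasurable_gs.
by apply: gauss_LpLq; rewrite ?leey//; lra.
Qed.

Lemma cint_odd (h : R -> R[i]) : cintegrable h -> (forall x, h (- x) = - h x) -> cint h = 0.
Proof.
move=> ih ho; apply: complex_ext => /=.
  by apply: integral_odd => //; [exact: cintegrable_Re|move=> x; rewrite ho ReN].
by apply: integral_odd => //; [exact: cintegrable_Im|move=> x; rewrite ho ImN].
Qed.

Lemma U_opp x : U (- x) = U x.
Proof. by rewrite /nroot normrN. Qed.

Lemma gs_odd_moment lam c l : 0 < c ->
  cint (fun x => x%:C * gs lam (n%:R * c) x * (U x ^+ l)%:C) = 0.
Proof.
move=> c0; have [A [N [A1 gb]]] := gbound_gauss lam c0.
have c2 : 0 < c / 2 by rewrite divr_gt0.
have [A' [N' [A'1 gb']]] := gbound_mulx n1 c2 A1 gb.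
apply: cint_odd; first exact: (gbound_moment n1 l gb').
by move=> x; rewrite /gs U_opp rmorphN /= !mulNr.
Qed.

Lemma HT_gauss_odd beta lam c z : - 2^-1 <= beta -> 0 < c ->
  HT k n beta (fun x => x%:C * gs lam (n%:R * c) x) z = 0.
Proof.
move=> b0 c0; have [A [N [A1 gb]]] := gbound_gauss lam c0.
have c2 : 0 < c / 2 by rewrite divr_gt0.
have [A' [N' [A'1 gb']]] := gbound_mulx n1 c2 A1 gb.
have [ih _] := HT_bound z b0 gb'.
apply: (cint_odd ih) => x.
have E : (- x)%:C * gs lam (n%:R * c) (- x) = - (x%:C * gs lam (n%:R * c) x).
  by rewrite /gs U_opp rmorphN /= mulNr.
by rewrite E U_opp mulNr.
Qed.

Lemma cint_real (g : R -> R) : cint (fun x => (g x)%:C) = (Rintegral mu setT g)%:C.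
Proof. by apply: complex_ext => //=; rewrite /Rintegral integral0. Qed.

(** The Gamma factor of the moment cancels the one in the Bessel coefficient, which leaves the
    exponential series in [- n / (4 c)]. *)
Lemma hc_gauss c m : 0 < c ->
  hc k n al (gs 1 (n%:R * c)) (2 * m) =
  ((2 * c) `^ (- (al + 1)) * ((- (n%:R / (4 * c))) ^+ m / m`!%:R))%:C.
Proof.
move=> c0; have n0 : (0 : R) < n%:R by rewrite ltr0n.
have nc0 : 0 < n%:R * c by rewrite mulr_gt0.
have b1 := alpha_ge n1 hk; have g0 := GammaA_gt0 n1 hk.
rewrite /hc.
have -> : cint (fun x => gs 1 (n%:R * c) x * (U x ^+ (2 * m))%:C) =
    (KG k n (al + 1 + m%:R) * (n%:R * c) `^ (- (al + 1 + m%:R)))%:C.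
  have -> : (fun x => gs 1 (n%:R * c) x * (U x ^+ (2 * m))%:C) =
      (fun x => (U x ^+ (2 * m) * expR (- (n%:R * c * U x ^+ 2)))%:C).
    by apply/funext => x; rewrite /gs mul1r mulrC [in RHS]rmorphM.
  by rewrite cint_real /Rintegral (gauss_moment n1 hk m nc0).
rewrite -(rmorphM (real_complex R)) /=; congr (real_complex R _).
rewrite bc_double /bm /KG opprD [(n%:R * c) `^ (_ - _)]powRD; last by rewrite (gt_eqF nc0) implybT.
have gm : 0 < Gamma (al + m%:R + 1).
  by apply: Gamma_gt0; have : (0 : R) <= m%:R by []; lra.
have -> : al + 1 + m%:R = al + m%:R + 1 by ring.
have -> : (n%:R * c) `^ (- m%:R) = (n%:R ^+ m * c ^+ m)^-1.
  by rewrite powRN powR_mulrn ?(ltW nc0)// exprMn.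
have -> : (n%:R / 2) `^ (al + 1) = (n%:R * c) `^ (al + 1) * (2 * c) `^ (- (al + 1)).
  have c20 : 0 < 2 * c by rewrite mulr_gt0.
  rewrite powRN; apply: (mulIf (lt0r_neq0 (powR_gt0 (al + 1) c20))).
  rewrite divfK ?gt_eqF ?powR_gt0// -powRM ?divr_ge0// ?(ltW c20)//.
  by congr (_ `^ _); field.
rewrite [(n%:R * c) `^ (- _)]powRN [(- (n%:R / _)) ^+ m]exprNn expr_div_n exprMn.
have fm : (0 : R) < m`!%:R by rewrite ltr0n fact_gt0.
have p1 : 0 < (n%:R * c) `^ (al + 1) by rewrite powR_gt0.
have p3 : (0 : R) < n%:R ^+ m by rewrite exprn_gt0.
have p4 : 0 < c ^+ m by rewrite exprn_gt0.
have p5 : (0 : R) < 4 ^+ m by rewrite exprn_gt0.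
rewrite mul2n -addnn exprD.
move: ((n%:R * c) `^ _) p1 ((2 * c) `^ _) => q1 q10 q2.
move: (n%:R ^+ m) p3 (c ^+ m) p4 (4 ^+ m) p5 (m`!%:R) fm => q3 q30 q4 q40 q5 q50 q6 q60.
move: ((-1) ^+ m) (Gamma (al + 1)) g0 (Gamma _) gm => q7 q8 q80 q9 q90; clear -q10 q30 q40 q50 q60 q80 q90.
by field; rewrite !gt_eqF.
Qed.

Lemma HT_gauss lam c z : 0 < c ->
  HT k n al (gs lam (n%:R * c)) z =
  lam * (((2 * c) `^ (- (al + 1)))%:C * cexp (- (n%:R / (4 * c))%:C * z ^+ 2)).
Proof.
move=> c0; have b1 := alpha_ge n1 hk.
have [A [N [A1 gb]]] := gbound_gauss 1 c0.
have A0 : 0 <= A by lra.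
have -> : HT k n al (gs lam (n%:R * c)) z = lam * HT k n al (gs 1 (n%:R * c)) z.
  have [ih _] := HT_bound z b1 gb; have E := cintZ lam ih.
  apply: (etrans _ E); congr (complex_integral _ _ _); apply/funext => x.
  by rewrite /gs mul1r mulrA.
congr (_ * _); pose G := (2 * c) `^ (- (al + 1)); pose w := - (n%:R / (4 * c))%:C * z ^+ 2.
have he := egrowthZ G%:C (@egrowth_exp R).
rewrite -/G -/w /cexp -(csumZ _ _ (@egrowth_exp R)).
apply: (csum_unique he) => e e0.
have [M0 hM0] := half_pow_small (@HTerr_ge0 R n (c / 2) A N (nc z) A0 (nc_ge0 z)) e0.
exists M0 => M hM.
have -> : cpart (fun l => G%:C * (l`!%:R)^-1) w M = cpart (hc k n al (gs 1 (n%:R * c))) z (2 * M).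
  rewrite cpart_double; last by move=> m; rewrite /hc bc_odd mul0r rmorph0 mul0r.
  rewrite /cpart; apply: eq_bigr => m _; rewrite hc_gauss// -/G /w.
  rewrite exprMn -exprM -rmorphN -(rmorphXn (real_complex R)) /= !rmorphM /= fmorphV rmorph_nat.
  by move: (G%:C) (_%:C) (_^-1) => e1 e2 e3; ring.
apply: (le_trans (HT_apx n1 z (2 * M)%N b1 gb)); apply: (hM0 (2 * M)%N).
by rewrite (leq_trans hM)// leq_pmull.
Qed.

End Gaussian.

(** * From the integral against [mu] to lower sums in the variable [t] *)

Section LowerSums.
Context {R : realType} (k : R) (n : nat).
Hypotheses (n1 : (1 <= n)%N) (hk : (n%:R - 1) / (2 * n%:R) <= k).
Local Notation nc := (@ComplexField.Normc.normc R).
Local Notation Re := (@complex.Re R).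
Local Notation Im := (@complex.Im R).
Local Notation leb := (@lebesgue_measure R).
Local Notation mu := (mu_kn k n).
Local Notation al := (alpha k n).
Local Notation U := (@nroot R n).

(** With [sg = 1] or [-1], the interval on the positive or on the negative side. *)
Definition shell (sg a b : R) := [set x : R | a <= sg * x < b].

Lemma measurable_shell sg a b : measurable (shell sg a b).
Proof.
have mf : measurable_fun setT (fun x : R => sg * x) by exact: measurable_funM.
have := mf measurableT _ (measurable_itv `[a, b[); rewrite setTI.
by congr measurable; apply/seteqP; split => x /=; rewrite in_itv.
Qed.

Lemma leb_shell sg a b : `|sg| = 1 -> a <= b -> leb (shell sg a b) = (b - a)%:E.
Proof.
have h0 : a <= b -> leb `[a, b[%classic = (b - a)%:E.
  by move=> ab; rewrite lebesgue_measure_itv /= lte_fin; case: ltgtP ab => // ->; rewrite subrr.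
have [sg0|sg0] := ger0P sg => sg1 ab.
  rewrite -(h0 ab); congr (leb _); apply/seteqP; split => x /=;
    by rewrite in_itv/= /shell /= sg1 mul1r.
rewrite -(h0 ab) -[RHS](@lebesgue_measureN R `[a, b[%classic)//; congr (leb _).
by apply/seteqP; split => x /=; rewrite in_itv/= /shell /= -(opprK sg) sg1 mulN1r.
Qed.

(** Near [|x| = s^n] the product is of order [s^(2 alpha + 1)], whose exponent is nonnegative by the
    hypothesis on [k]. *)
Lemma weight_lower : exists2 c, 0 < c & forall s x : R, 1 <= s -> s ^+ n <= `|x| <= (2 * s) ^+ n ->
  c <= weight_kn k n x * s ^+ n.-1.
Proof.
have n0 : (0 : R) < n%:R by rewrite ltr0n.
(* The exponent [e] may have either sign: if positive, [|x| >= s^n] is used, otherwise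
   [|x| <= (2 s)^n], which costs the factor recorded in [q]. *)
pose e := 2 * k + 2 / n%:R - 2; pose q := Num.min 1 (2 `^ (n%:R * e)).
have q0 : 0 < q by rewrite lt_min ltr01 powR_gt0.
pose cw := (2 * Gamma (al + 1))^-1 * (n%:R / 2) `^ al.
have cw0 : 0 < cw.
  by rewrite mulr_gt0 ?powR_gt0 ?divr_gt0// invr_gt0 mulr_gt0// GammaA_gt0.
exists (cw * q); first by rewrite mulr_gt0.
move=> s x s1 /andP[sx xs]; have s0 : 0 < s by exact: lt_le_trans s1.
have sn0 : 0 < s ^+ n by rewrite exprn_gt0.
have x0 : 0 < `|x| by exact: lt_le_trans sx.
have powE (u : R) : 0 <= u -> (u ^+ n) `^ e = u `^ (n%:R * e).
  by move=> u0; rewrite -powR_mulrn// -powRrM.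
have lw : q * s `^ (n%:R * e) <= `|x| `^ e.
  have [e0|/ltW e0] := leP 0 e.
    apply: (@le_trans _ _ (s `^ (n%:R * e))).
      by rewrite ler_piMl ?powR_ge0// ge_min lexx.
    rewrite -powE ?(ltW s0)//; apply: ge0_ler_powR => //; rewrite nnegrE ltW//.
  apply: (@le_trans _ _ ((2 * s) `^ (n%:R * e))).
    by rewrite powRM ?(ltW s0)// ler_wpM2r ?powR_ge0// ge_min lexx orbT.
  have s20 : 0 < (2 * s) ^+ n by rewrite exprn_gt0// mulr_gt0.
  rewrite -powE ?mulr_ge0 ?(ltW s0)// -(opprK e) !(powRN _ (- e)).
  rewrite lef_pV2 ?posrE ?powR_gt0//.
  by apply: ge0_ler_powR; rewrite ?nnegrE ?oppr_ge0// ltW.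
have pe : 1 <= s `^ (n%:R * e) * s ^+ n.-1.
  rewrite -powR_mulrn ?(ltW s0)// -powRD; last by rewrite (gt_eqF s0) implybT.
  rewrite -[leLHS](powRr0 s) ler_powR// /e.
  have -> : n.-1%:R = n%:R - 1%:R :> R by rewrite -subn1 natrB.
  have := hk; rewrite ler_pdivrMr ?mulr_gt0// => h.
  have -> : n%:R * (2 * k + 2 / n%:R - 2) + (n%:R - 1%:R) = k * (2 * n%:R) - (n%:R - 1).
    by field; rewrite gt_eqF.
  by rewrite subr_ge0.
have -> : weight_kn k n x = cw * `|x| `^ e by [].
clearbody cw; rewrite -mulrA ler_wpM2l ?(ltW cw0)//.
rewrite -[leLHS]mulr1; apply: (@le_trans _ _ (q * s `^ (n%:R * e) * s ^+ n.-1)).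
  by rewrite -mulrA ler_wpM2l// ltW.
by rewrite ler_wpM2r// exprn_ge0// ltW.
Qed.

(** [t^n - s^n >= (t - s) s^(n-1)], and [weight_lower] compensates the power of [s]. The condition
    [t <= s + 1 <= 2 s] keeps the shell within its range. *)
Lemma mu_shell : exists2 c, 0 < c & forall sg s t, `|sg| = 1 -> 1 <= s -> s <= t <= s + 1 ->
  ((c * (t - s))%:E <= mu (shell sg (s ^+ n) (t ^+ n)))%E.
Proof.
have [c c0 hc] := weight_lower; exists c => // sg s t sg1 s1 /andP[st ts].
have s0 : 0 < s by exact: lt_le_trans s1.
have t0 : 0 < t by exact: lt_le_trans st.
have sn0 : 0 < s ^+ n.-1 by rewrite exprn_gt0.
have stn : s ^+ n <= t ^+ n by rewrite lerXn2r// nnegrE ltW.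
have ms := measurable_shell sg (s ^+ n) (t ^+ n).
apply: (@le_trans _ _ (\int[leb]_(x in shell sg (s ^+ n) (t ^+ n)) (cst (c / s ^+ n.-1)%:E) x)%E).
  rewrite integral_cst// [X in (_ <= _ * X)%E](leb_shell sg1 stn) -EFinM lee_fin.
  rewrite -[leRHS]mulrA ler_wpM2l ?(ltW c0)// mulrC ler_pdivlMr//.
  move: n1; case: n => [//|m] _ /=.
  rewrite subrXX mulrC mulrC ler_wpM2l ?subr_ge0//.
  rewrite big_ord_recl/= subn0 expr0 mulr1.
  apply: (@le_trans _ _ (t ^+ m)); first by rewrite lerXn2r// nnegrE ltW.
  by rewrite lerDl sumr_ge0// => i _; rewrite mulr_ge0 ?exprn_ge0 ?(ltW s0) ?(ltW t0).
apply: ge0_le_integral => //.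
- by move=> x _; rewrite lee_fin divr_ge0 ?(ltW c0) ?(ltW sn0).
- apply: measurable_funTS; apply/measurable_EFinP; apply: measurable_maxr => //.
  exact: measurable_weight.
move=> x /= /andP[h1 h2]; rewrite lee_fin max_weight// ler_pdivrMr//.
have xE : sg * x = `|x|.
  have -> : sg * x = `|sg * x|.
    by rewrite ger0_norm// (le_trans _ h1)// exprn_ge0// ltW.
  by rewrite normrM sg1 mul1r.
have t2 : t <= 2 * s by lra.
have s2 : 0 <= 2 * s by lra.
apply: hc => //; rewrite -xE h1 /= (le_trans (ltW h2))// lerXn2r// nnegrE//.
exact: ltW.
Qed.

(** The cells of the grid in [t] correspond to disjoint shells in [x], each of measure at least
    [c d]; the sum is bounded by the integral, shell by shell. *)
Lemma lower_sums_integral : exists2 c, 0 < c & forall (L : R -> R) (K sg : R),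
  measurable_fun setT L -> (forall x, 0 <= L x) -> (\int[mu]_x (L x)%:E <= K%:E)%E ->
  `|sg| = 1 -> lower_sums_le (K / c) (fun t => L (sg * t ^+ n)).
Proof.
have [c c0 hc] := mu_shell; exists c => // L K sg mL L0 iL sg1 d M m /andP[d0 d1] m0 hm.
pose T (j : nat) : R := 1 + j%:R * d.
have T1 j : 1 <= T j by rewrite lerDl mulr_ge0// ltW.
have TS j : T j.+1 = T j + d by rewrite /T -natr1; ring.
have T0 j : 0 <= T j by exact: le_trans (T1 j).
have mLE D : measurable_fun D (EFin \o L).
  by apply: measurable_funTS; exact/measurable_EFinP.
rewrite ler_pdivlMr//.
suff h j : (j <= M)%N ->
    (((\sum_(0 <= i < j) m i * d) * c)%R%:E <=
    \int[mu]_(x in shell sg 1 (T j ^+ n)%R) (L x)%:E)%E.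
  rewrite -lee_fin; apply: (le_trans (h M (leqnn _))); apply: le_trans iL.
  by apply: (ge0_subset_integral mu (measurable_shell _ _ _) measurableT (mLE _)) => // x _; rewrite lee_fin.
elim: j => [_|j IH jM].
  by rewrite big_geq// mul0r; apply: integral_ge0 => x _; rewrite lee_fin.
have -> : shell sg 1 (T j.+1 ^+ n) = shell sg 1 (T j ^+ n) `|` shell sg (T j ^+ n) (T j.+1 ^+ n).
  have a1 : 1 <= T j ^+ n by exact: exprn_ege1.
  have a2 : T j ^+ n <= T j.+1 ^+ n by rewrite lerXn2r ?nnegrE// TS lerDl ltW.
  apply/seteqP; split => x /=; rewrite /shell /=.
    move=> /andP[h1 h2]; case: (ltP (sg * x) (T j ^+ n)) => h3; [left|right];
      by rewrite ?h1 ?h2 ?h3.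
  by move=> [|] /andP[h1 h2]; apply/andP; split => //; lra.
rewrite (ge0_integral_setU mu (measurable_shell _ _ _) (measurable_shell _ _ _) (mLE _)); last 2 first.
- by move=> x _; rewrite lee_fin.
- apply/disj_setPS => x /= []; rewrite /shell /= => /andP[_ h1] /andP[h2 _]; lra.
rewrite big_nat_recr//= mulrDl EFinD; apply: leeD; first exact: IH (ltnW jM).
apply: (@le_trans _ _ (\int[mu]_(x in shell sg (T j ^+ n) (T j.+1 ^+ n)) (cst (m j)%:E) x)%E).
  rewrite integral_cst; last exact: measurable_shell.
  rewrite -mulrA EFinM; apply: lee_wpmul2l; first by rewrite lee_fin.
  have e : T j.+1 - T j = d by rewrite TS addrAC subrr add0r.
  have tt : T j <= T j.+1 <= T j + 1 by rewrite TS lerDl (ltW d0) lerD2l.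
  by have := hc sg _ _ sg1 (T1 j) tt; rewrite e [c * d]mulrC.
apply: ge0_le_integral => //; try exact: measurable_shell; try exact: mLE;
  try (by move=> x _; rewrite /= lee_fin).
move=> x /= /andP[h1 h2]; rewrite lee_fin.
have xE : sg * x = `|x|.
  have -> : sg * x = `|sg * x|.
    by rewrite ger0_norm// (le_trans _ h1)// exprn_ge0.
  by rewrite normrM sg1 mul1r.
have sx : sg * U x ^+ n = x.
  rewrite (Un n1) -xE mulrA -expr2 -[sg ^+ 2]ger0_norm ?sqr_ge0// normrX sg1.
  by rewrite expr1n mul1r.
have := hm j (U x) jM; rewrite sx; apply.
rewrite xE -(Un n1 x) in h1 h2; have u0 := U_ge0 n x.
rewrite -(ler_pXn2r (n := n)) ?nnegrE//; last exact: T0.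
by rewrite h1 -(ler_pXn2r (n := n)) ?nnegrE ?(ltW h2)//; exact: (T0 j.+1).
Qed.

Lemma papx_continuous (g : R[i] -> R[i]) : papx g ->
  continuous (fun t : R => Re (g t%:C)) /\ continuous (fun t : R => Im (g t%:C)).
Proof.
move=> pg.
have key (t e : R) : 0 < e -> \forall s \near t, nc (g t%:C - g s%:C) <= e.
  move=> e0; have [d d0 hd] := papx_oscillation (`|t| + 1) pg e0.
  have m0 : 0 < Num.min d 1 by rewrite lt_min d0 ltr01.
  near=> s.
  have ts : `|t - s| <= Num.min d 1 by near: s; exact: cvgr_dist_le.
  move: ts; rewrite le_min => /andP[ts1 ts2].
  apply: hd; rewrite ?ncR ?lerDl// -?rmorphB ?ncR//.
  have := ler_normD t (s - t); rewrite addrCA subrr addr0 distrC; lra.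
split=> t; apply/cvgrPdist_le => e e0; apply: filterS (key t e e0) => s h.
  by apply: le_trans h; apply: le_trans (nc_Re _); rewrite ReD ReN.
by apply: le_trans h; apply: le_trans (nc_Im _); rewrite ImD ImN.
Unshelve. all: by end_near. Qed.

Lemma cmeasurable_papx (g : R[i] -> R[i]) : papx g -> cmeasurable (fun x => g (U x)%:C).
Proof.
move=> /papx_continuous[c1 c2]; have mU := @measurable_U R n; split.
  exact: (measurableT_comp (continuous_measurable_fun c1) mU).
exact: (measurableT_comp (continuous_measurable_fun c2) mU).
Qed.

Lemma measurable_logp (f : R -> R) : measurable_fun setT f ->
  measurable_fun setT (fun x => logp (f x)).
Proof.
move=> mf; have c : continuous (@logp R).
  move=> t; apply/cvgrPdist_le => e e0; near=> s.
  by apply: (le_trans (logp_lipschitz _ _)); near: s; exact: cvgr_dist_le.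
exact: (measurableT_comp (continuous_measurable_fun c) mf).
Unshelve. all: by end_near. Qed.

Lemma logp_le (a b : R) : a <= b -> logp a <= logp b.
Proof.
move=> ab; rewrite /logp; case: ifPn => [a1|_]; last exact: logp_ge0.
have b1 := lt_le_trans a1 ab; rewrite b1 ler_ln ?posrE//; exact: lt_trans ltr01 _.
Qed.

Lemma logp_le_id (a : R) : 0 <= a -> logp a <= a.
Proof.
move=> a0; have := logp_lipschitz a 0; rewrite subr0 (ger0_norm a0).
have -> : logp (0 : R) = 0 by rewrite /logp ltr10.
by rewrite subr0 ger0_norm// logp_ge0.
Qed.

End LowerSums.

(** * The transform of [f] is a Gaussian *)

Section Miyachi.
Context {R : realType} (k : R) (n : nat).
Hypotheses (n1 : (1 <= n)%N) (hk : (n%:R - 1) / (2 * n%:R) <= k).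
Local Notation nc := (@ComplexField.Normc.normc R).
Local Notation Re := (@complex.Re R).
Local Notation Im := (@complex.Im R).
Local Notation mu := (mu_kn k n).
Local Notation al := (alpha k n).
Local Notation U := (@nroot R n).
Local Notation cint := (complex_integral k n).
Local Notation cintegrable := (cintegrable k n).
Local Notation gbound := (gbound k n).
Local Opaque HT.

Lemma papxC (c : R[i]) : papx (fun=> c).
Proof. by move=> r e e0; exists c%:P => z _; rewrite hornerC subrr nc0 ltW. Qed.

Lemma papxXn m : papx (fun z : R[i] => z ^+ m).
Proof. by move=> r e e0; exists 'X^m => z _; rewrite hornerXn subrr nc0 ltW. Qed.

Lemma papx_gauss (B : R[i]) : papx (fun z => cexp (B * z ^+ 2)).
Proof.
move=> r e e0; have [p hp] := papx_comp_poly (B *: 'X^2) (papx_csum (@egrowth_exp R)) r e0.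
by exists p => z zr; have := hp z zr; rewrite hornerZ hornerXn.
Qed.

Section Parts.
Variables (f : R -> R[i]) (a A A' : R) (N N' : nat).
Hypotheses (a0 : 0 < a) (A1 : 1 <= A) (A'1 : 1 <= A').
Hypothesis gf : gbound a A N f.
Hypothesis gxf : gbound a A' N' (fun x => x%:C * f x).

Let E := HT k n al f.
Let O := HT k n (al + n%:R) (fun x => x%:C * f x).
Let B := n%:R / (4 * a).
Let b1 : - 2^-1 <= al := alpha_ge n1 hk.
Let b2 : - 2^-1 <= al + n%:R := aln_ge n1 hk.
Let A0 : 0 <= A := le_trans ler01 A1.
Let A'0 : 0 <= A' := le_trans ler01 A'1.

(** For [s = 1] and [s = -1] this is the normalized transform of [f] at [t^n] and at [- t^n] when
    [z = t >= 0]. *)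
Definition gfun (C s : R) z : R[i] :=
  (C^-1)%:C * cexp (B%:C * z ^+ 2) * (E z + s%:C * kap k n * z ^+ n * O z).

Lemma papx_gfun C s : papx (gfun C s).
Proof.
have pE : papx E := papx_HT n1 a0 A0 b1 gf.
have pO : papx O := papx_HT n1 a0 A'0 b2 gxf.
apply: papxM; first by apply: papxM; [exact: papxC|exact: papx_gauss].
apply: papxD => //; apply: papxM => //.
by apply: papxM; [exact: papxC|exact: papxXn].
Qed.

(** Since [Re (z^2) = (Re z)^2 - (Im z)^2], the exponential factor cancels exactly the growth in
    [Im z] from [HT_bound]; [z^n] only raises the polynomial degree. *)
Lemma gfun_growth C s : 0 < C -> `|s| = 1 -> exists2 D, 1 <= D & forall z,
  nc (gfun C s z) <= D * (1 + nc z) ^+ (N + (n + N')) * expR (B * Re z ^+ 2).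
Proof.
move=> C0 s1; pose kp := nc (kap k n).
have kp0 : 0 <= kp by exact: nc_ge0.
have Ci0 : 0 < C^-1 by rewrite invr_gt0.
pose D := C^-1 * (2 * A + kp * (2 * A')).
have D0 : 0 <= D.
  by apply: mulr_ge0; [exact: ltW|apply: addr_ge0; [|apply: mulr_ge0 => //]; apply: mulr_ge0].
exists (1 + D); first by rewrite lerDl.
move=> z; pose r := nc z; have r0 : 0 <= r := nc_ge0 z.
pose y := `|Im z|; have y0 : 0 <= y := normr_ge0 _.
have yr : y <= r by exact: nc_Im.
have [_ h1] := HT_bound z b1 gf; have [_ h2] := HT_bound z b2 gxf.
rewrite -/E -/y in h1; rewrite -/O -/y in h2.
have eE : n%:R * y ^+ 2 / (4 * a) = B * y ^+ 2 by rewrite mulrAC.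
rewrite eE in h1 h2.
have e1 : nc (cexp (B%:C * z ^+ 2)) <= expR (B * Re z ^+ 2 - B * y ^+ 2).
  apply: (le_trans (nc_cexp _)); rewrite ler_expR ReCM expr2 ReM.
  by rewrite /y real_normK ?num_real// -!expr2 mulrBr.
have p1 : 1 <= 1 + r by rewrite lerDl.
have q1 : (1 + y) ^+ N <= (1 + r) ^+ (N + (n + N')).
  apply: (@le_trans _ _ ((1 + r) ^+ N)).
    by apply: lerXn2r; rewrite ?nnegrE ?addr_ge0// lerD2l.
  by rewrite ler_weXn2l// leq_addr.
have q2 : r ^+ n * (1 + y) ^+ N' <= (1 + r) ^+ (N + (n + N')).
  apply: (@le_trans _ _ ((1 + r) ^+ (n + N'))).
    rewrite exprD; apply: ler_pM; rewrite ?exprn_ge0 ?addr_ge0//.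
      by apply: lerXn2r; rewrite ?nnegrE ?addr_ge0// lerDr.
    by apply: lerXn2r; rewrite ?nnegrE ?addr_ge0// lerD2l.
  by rewrite ler_weXn2l// leq_addl.
move: ((1 + y) ^+ N) q1 h1 => Y1 q1 h1; move: ((1 + y) ^+ N') q2 h2 => Y2 q2 h2.
pose P := (1 + r) ^+ (N + (n + N')); rewrite -/r -/P in q1 q2 *.
have P0 : 0 <= P by rewrite exprn_ge0// addr_ge0.
pose ey := expR (B * y ^+ 2); rewrite -/ey in h1 h2.
have ey0 : 0 < ey by exact: expR_gt0.
have hs : nc (E z + s%:C * kap k n * z ^+ n * O z) <= (2 * A + kp * (2 * A')) * P * ey.
  apply: (le_trans (ncD _ _)).
  have l1 : nc (E z) <= 2 * A * P * ey.
    apply: (le_trans h1); rewrite !mulrA ler_wpM2r ?(ltW ey0)//.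
    by apply: ler_wpM2l => //; exact: mulr_ge0.
  have l2 : nc (s%:C * kap k n * z ^+ n * O z) <= kp * (2 * A') * P * ey.
    rewrite (ncM (s%:C * kap k n * z ^+ n)) (ncM (s%:C * kap k n)) (ncM s%:C) ncX ncR s1 mul1r.
    rewrite -/kp -/r.
    apply: (@le_trans _ _ (kp * r ^+ n * (2 * (A' * Y2 * ey)))).
      by apply: ler_wpM2l => //; rewrite mulr_ge0 ?exprn_ge0.
    apply: (@le_trans _ _ (kp * (2 * A') * (r ^+ n * Y2) * ey)).
      by rewrite le_eqVlt; apply/orP; left; apply/eqP; ring.
    rewrite ler_wpM2r ?(ltW ey0)//; apply: ler_wpM2l => //.
    by apply: mulr_ge0 => //; exact: mulr_ge0.
  by have := lerD l1 l2; rewrite -!mulrDl.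
rewrite /gfun !ncM ncR (ger0_norm (ltW Ci0)).
set ex := expR (B * Re z ^+ 2).
have exE : expR (B * Re z ^+ 2 - B * y ^+ 2) * ey = ex.
  by rewrite -expRD subrK.
apply: (@le_trans _ _ (C^-1 * expR (B * Re z ^+ 2 - B * y ^+ 2) *
    ((2 * A + kp * (2 * A')) * P * ey))).
  apply: ler_pM => //; rewrite ?nc_ge0//.
    by apply: mulr_ge0; [exact: ltW|exact: nc_ge0].
  by rewrite ler_pM2l.
apply: (@le_trans _ _ (D * P * ex)).
  by rewrite le_eqVlt; apply/orP; left; apply/eqP; rewrite -exE /D; ring.
by rewrite ler_wpM2r ?expR_ge0// ler_wpM2r// lerDr.
Qed.

Lemma Fkn_pow (s t : R) : `|s| = 1 -> 0 <= t ->
  Fkn k n f (s * t ^+ n) = E t%:C + s%:C * kap k n * t%:C ^+ n * O t%:C.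
Proof.
move=> s1 t0; rewrite (FknE n1 hk _ gf gxf) -/E -/O.
have -> : `|s * t ^+ n| `^ n%:R^-1 = t.
  rewrite normrM s1 mul1r ger0_norm ?exprn_ge0// -powR_mulrn// -powRrM.
  by rewrite mulfV ?powRr1// pnatr_eq0 -lt0n.
rewrite (rmorphM (real_complex R) s (t ^+ n)) (rmorphXn (real_complex R) n t).
by rewrite -/(E _) -/(O _); move: (E _) (O _) (kap k n) => e o kp; ring.
Qed.

(** Both transforms are even, so on the negative axis [gfun] is again a [gfun] on the positive axis,
    possibly with the other sign; the log hypothesis therefore controls it there too. *)
Lemma gfun_opp C s t : gfun C s (- t) = gfun C (s * (-1) ^+ n) t.
Proof.
rewrite /gfun sqrrN /E /O !HT_even -/E -/O (exprNn t n).
rewrite (rmorphM (real_complex R) s ((-1) ^+ n)) (rmorphXn (real_complex R) n (-1)) (rmorphN1 (real_complex R)).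
by move: (E _) (O _) (kap k n) (cexp _) ((-1) ^+ n) (t ^+ n) => e o kp c s1 tn; ring.
Qed.

Lemma cmeasurable_Fkn : cmeasurable (Fkn k n f).
Proof.
have -> : Fkn k n f = fun x => E (U x)%:C + kap k n * x%:C * O (U x)%:C.
  by apply/funext => x; rewrite (FknE n1 hk _ gf gxf).
have pE : papx E := papx_HT n1 a0 A0 b1 gf.
have pO : papx O := papx_HT n1 a0 A'0 b2 gxf.
apply: cmeasurableD; first exact: cmeasurable_papx.
apply: cmeasurableM; last exact: cmeasurable_papx.
apply: cmeasurableM; first exact: cmeasurableC.
by apply: cmeasurableR; exact: measurable_id.
Qed.

Definition Lfun (b C x : R) : R :=
  logp (expR (n%:R * b * `|x| `^ (2 / n%:R)) * nc (Fkn k n f x) / C).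

Lemma Lfun_lower_sums b C : (\int[mu]_x (Lfun b C x)%:E < +oo)%E ->
  exists2 K1, 0 <= K1 &
  forall sg, `|sg| = 1 -> lower_sums_le K1 (fun t => Lfun b C (sg * t ^+ n)).
Proof.
move=> iL; have [c c0 hc] := lower_sums_integral n1 hk.
have L0 x : 0 <= Lfun b C x by exact: logp_ge0.
have i0 : (0 <= \int[mu]_x (Lfun b C x)%:E)%E by apply: integral_ge0 => x _; rewrite lee_fin.
pose K := fine (\int[mu]_x (Lfun b C x)%:E).
have KE : (\int[mu]_x (Lfun b C x)%:E)%E = K%:E by rewrite fineK// ge0_fin_numE.
have K0 : 0 <= K by exact: fine_ge0.
exists (K / c); first by rewrite divr_ge0// ltW.
move=> sg sg1; apply: hc => //; last by rewrite KE.
apply: measurable_logp; apply: measurable_funM => //; apply: measurable_funM.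
  apply: measurableT_comp => //; apply: measurable_funM => //.
  under eq_fun do rewrite U2.
  by apply: measurable_funX; exact: measurable_U.
by apply: measurable_nc; exact: cmeasurable_Fkn.
Qed.

Lemma U_pow (s t : R) : `|s| = 1 -> 0 <= t -> `|s * t ^+ n| `^ (2 / n%:R) = t ^+ 2.
Proof.
move=> s1 t0; rewrite U2; congr (_ ^+ 2); rewrite /nroot normrM s1 mul1r ger0_norm ?exprn_ge0//.
by rewrite -powR_mulrn// -powRrM mulfV ?powRr1// pnatr_eq0 -lt0n.
Qed.

(** [1/4 <= a b] gives [B <= n b], hence [log+ |gfun|] lies below the integrand of the log
    hypothesis on both half-axes. [gfun] is then constant, and its value at 0 involves only [E 0] as
    [n >= 1]. *)
Lemma transform_gaussian b C : 0 < C -> 1 / 4 <= a * b ->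
  (\int[mu]_x (Lfun b C x)%:E < +oo)%E ->
  forall s z, `|s| = 1 ->
  E z + s%:C * kap k n * z ^+ n * O z = E 0 * cexp (- B%:C * z ^+ 2).
Proof.
move=> C0 ab iL; have [K1 K10 ls] := Lfun_lower_sums iL.
have n0 : (0 : R) < n%:R by rewrite ltr0n.
have B0 : 0 < B by rewrite divr_gt0// mulr_gt0.
have Bb : B <= n%:R * b.
  by rewrite /B ler_pdivrMr ?mulr_gt0// -mulrA ler_peMr ?(ltW n0)//; lra.
have cmp s (t : R) : `|s| = 1 -> 0 <= t -> logp (nc (gfun C s t%:C)) <= Lfun b C (s * t ^+ n).
  move=> s1 t0; apply: logp_le; rewrite (Fkn_pow s1 t0) (U_pow s1 t0) /gfun.
  set w := E _ + _; rewrite (ncM ((C^-1)%:C * _) w) (ncM (C^-1)%:C) ncR.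
  have -> : B%:C * t%:C ^+ 2 = (B * t ^+ 2)%:C.
    by rewrite (rmorphM (real_complex R) B (t ^+ 2)) (rmorphXn (real_complex R) 2 t).
  rewrite cexp_real ncR.
  rewrite ger0_norm ?invr_ge0 ?(ltW C0)// [`|expR _|]ger0_norm ?expR_ge0//.
  have w0 := nc_ge0 w; have Ci0 : 0 <= C^-1 by rewrite invr_ge0 ltW.
  have ee : expR (B * t ^+ 2) <= expR (n%:R * b * t ^+ 2).
    by rewrite ler_expR ler_wpM2r ?sqr_ge0.
  move: (nc w) w0 (C^-1) Ci0 (expR _) (expR _) ee => u u0 c c0' e1 e2 ee.
  by rewrite -[leLHS]mulrA [leLHS]mulrC ler_wpM2r// ler_wpM2r.
have lsg s : `|s| = 1 -> lower_sums_le K1 (fun t => logp (nc (gfun C s t%:C))).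
  move=> s1 d M m d01 m0 hm; apply: (ls s s1 d M m d01 m0) => j t jM ht.
  apply: (le_trans (hm j t jM ht)); apply: cmp => //.
  case/andP: d01 => /ltW d0 _; case/andP: ht => ht _.
  by apply: le_trans ht; rewrite addr_ge0// mulr_ge0.
have gc s z : `|s| = 1 -> gfun C s z = gfun C s 0.
  move=> s1; have [D D1 hD] := gfun_growth C0 s1.
  apply: (entire_constant D1 (ltW B0) K10 (papx_gfun C s) hD (lsg s s1)).
  have s2 : `|s * (-1) ^+ n| = 1 by rewrite normrM normrX normrN1 expr1n mulr1.
  have -> : (fun t : R => logp (nc (gfun C s (- t)%:C))) =
      fun t => logp (nc (gfun C (s * (-1) ^+ n) t%:C)).
    by apply/funext => t; rewrite -gfun_opp (rmorphN (real_complex R) t).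
  exact: lsg.
have alg1 (c e kk o : R[i]) : c * 1 * (e + kk * 0 * o) = c * e.
  by rewrite mulr1 mulr0 mul0r addr0.
have alg2 (c e1 e2 w e0 : R[i]) : c != 0 -> e1 * e2 = 1 -> c * e1 * w = c * e0 -> w = e0 * e2.
  by move=> cn ee; rewrite -mulrA => /(mulfI cn) <-; rewrite mulrAC ee mul1r.
have zn : (0 : R[i]) ^+ n = 0 by rewrite expr0n -(prednK n1).
have z2 : (0 : R[i]) ^+ 2 = 0 by rewrite expr0n.
have c00 := @cexp0 R.
have g0 s : gfun C s 0 = (C^-1)%:C * E 0.
  by rewrite /gfun zn z2 (mulr0 B%:C) c00; exact: alg1.
have Cn : (C^-1)%:C != 0 by apply/eqP => /(congr1 Re) /= /eqP; rewrite invr_eq0 gt_eqF.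
move=> s z s1; have ee := cexpN (B%:C * z ^+ 2); rewrite -(mulNr B%:C) in ee.
exact: (alg2 _ _ _ _ _ Cn ee (etrans (gc s z s1) (g0 s))).
Qed.

End Parts.
End Miyachi.

(** * Identification of [f], the bound on the constant, and the examples *)

Section Conclusion.
Context {R : realType} (k : R) (n : nat).
Hypotheses (n1 : (1 <= n)%N) (hk : (n%:R - 1) / (2 * n%:R) <= k).
Local Notation nc := (@ComplexField.Normc.normc R).
Local Notation Re := (@complex.Re R).
Local Notation Im := (@complex.Im R).
Local Notation mu := (mu_kn k n).
Local Notation al := (alpha k n).
Local Notation U := (@nroot R n).
Local Notation cint := (complex_integral k n).
Local Notation cintegrable := (cintegrable k n).
Local Notation gbound := (gbound k n).
Local Opaque HT.

Lemma ReMC (x : R) (z : R[i]) : Re (z * x%:C) = Re z * x.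
Proof. by rewrite mulrC ReCM mulrC. Qed.
Lemma ImMC (x : R) (z : R[i]) : Im (z * x%:C) = Im z * x.
Proof. by rewrite mulrC ImCM mulrC. Qed.

Lemma complex_moments_zero_ae (d : R -> R[i]) (c : R) : 0 < c -> cmeasurable d ->
  cintegrable (fun x => d x * (expR (c * U x ^+ 2))%:C) ->
  cintegrable (fun x => x%:C * d x * (expR (c * U x ^+ 2))%:C) ->
  (forall m, cint (fun x => d x * (U x ^+ (2 * m))%:C) = 0) ->
  (forall m, cint (fun x => x%:C * d x * (U x ^+ (2 * m))%:C) = 0) ->
  {ae mu, forall x, d x = 0}.
Proof.
move=> c0 [mR mI] i1 i2 m1 m2.
have FM : Filter (nbhs (almost_everywhere mu)) := ae_filter_ringOfSetsType mu.
have aeR : {ae mu, forall x, Re (d x) = 0}.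
  apply: (moments_zero_ae n1 hk c0 mR).
  - by have := cintegrable_Re i1; under eq_fun do rewrite ReMC.
  - by have := cintegrable_Re i2; under eq_fun do rewrite ReMC ReCM.
  - move=> m; have := congr1 Re (m1 m); rewrite /complex_integral /= => h; rewrite -[RHS]h.
    by apply: eq_Rintegral => x _; rewrite ReMC exprM.
  - move=> m; have := congr1 Re (m2 m); rewrite /complex_integral /= => h; rewrite -[RHS]h.
    by apply: eq_Rintegral => x _; rewrite ReMC ReCM exprM.
have aeI : {ae mu, forall x, Im (d x) = 0}.
  apply: (moments_zero_ae n1 hk c0 mI).
  - by have := cintegrable_Im i1; under eq_fun do rewrite ImMC.
  - by have := cintegrable_Im i2; under eq_fun do rewrite ImMC ImCM.
  - move=> m; have := congr1 Im (m1 m); rewrite /complex_integral /= => h; rewrite -[RHS]h.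
    by apply: eq_Rintegral => x _; rewrite ImMC exprM.
  - move=> m; have := congr1 Im (m2 m); rewrite /complex_integral /= => h; rewrite -[RHS]h.
    by apply: eq_Rintegral => x _; rewrite ImMC ImCM exprM.
by apply: filterS2 aeR aeI => x hR hI; exact: complex_ext.
Qed.

Lemma moment_of_hc beta F F' m : - 2^-1 <= beta ->
  hc k n beta F (2 * m) = hc k n beta F' (2 * m) ->
  cint (fun x => F x * (U x ^+ (2 * m))%:C) = cint (fun x => F' x * (U x ^+ (2 * m))%:C).
Proof.
move=> b0; rewrite /hc bc_double => h.
have c0 : (bm beta m * n%:R ^+ (2 * m))%:C != 0.
  apply/eqP => /(congr1 Re) /= /eqP; apply/negP; rewrite mulf_neq0 ?bm_neq0//; first by lra.
  by rewrite expf_neq0// pnatr_eq0 -lt0n.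
exact: (mulfI c0 h).
Qed.

Lemma cintegrable_exp_le (h : R -> R[i]) (c c' : R) : c <= c' -> cmeasurable h ->
  cintegrable (fun x => h x * (expR (c' * U x ^+ 2))%:C) ->
  cintegrable (fun x => h x * (expR (c * U x ^+ 2))%:C).
Proof.
move=> cc mh [mh' ih]; apply: (cintegrable_bound _ (measurable_nc mh') _ ih).
  apply: cmeasurableM => //; apply: cmeasurableR; apply: measurableT_comp => //.
  by apply: measurable_funM => //; apply: measurable_funX; exact: measurable_U.
move=> x; rewrite !ncM !ncR !ger0_norm ?expR_ge0// ler_wpM2l ?nc_ge0// ler_expR.
by rewrite ler_wpM2r ?sqr_ge0.
Qed.

(** Half the sum and half the difference of the identities for [s = 1] and [s = -1] separate the two
    transforms: the even one is that of the Gaussian [G], the odd one vanishes. So [f - G] has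
    vanishing moments of both kinds, and uniqueness applies. *)
Lemma ae_gaussian p q (f : R -> R[i]) a A A' N N' c0 : (1 <= p)%E -> (1 <= q)%E ->
  0 < a -> 1 <= A -> 1 <= A' -> gbound a A N f -> gbound a A' N' (fun x => x%:C * f x) ->
  inLpLq k n p q (fun x => (expR (n%:R * a * `|x| `^ (2 / n%:R)))%:C * f x) ->
  (forall s z, `|s| = 1 -> HT k n al f z +
     s%:C * kap k n * z ^+ n * HT k n (al + n%:R) (fun x => x%:C * f x) z =
     c0 * cexp (- (n%:R / (4 * a))%:C * z ^+ 2)) ->
  {ae mu, forall x, f x = gs n (c0 * ((2 * a) `^ (al + 1))%:C) (n%:R * a) x}.
Proof.
move=> p1 q1 a0 A1 A'1 gf gxf hf hz.
have n0 : (0 : R) < n%:R by rewrite ltr0n.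
have b1 := alpha_ge n1 hk; have b2 := aln_ge n1 hk.
have A0 : 0 <= A by lra.
have A'0 : 0 <= A' by lra.
have [mf _] := gf; have [mxf _] := gxf.
have a20 : 0 < a / 2 by rewrite divr_gt0.
pose lam := c0 * ((2 * a) `^ (al + 1))%:C; rewrite -/lam.
pose G := gs n lam (n%:R * a).
have [B [M [B1 gG]]] := gbound_gauss n1 hk lam a0; rewrite -/G in gG.
have [B' [M' [B'1 gxG]]] := gbound_mulx n1 a20 B1 gG.
have B0 : 0 <= B by lra.
have [mG _] := gG; have [mxG _] := gxG.
have two : (2 : R[i]) != 0 by rewrite pnatr_eq0.
have alg1 (e w x : R[i]) : e + 1 * w = x -> e + (-1) * w = x -> e = x /\ w = 0.
  move=> h1 h2; have w0 : w = 0.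
    apply: (mulfI two); rewrite mulr0.
    have -> : 2 * w = (e + 1 * w) - (e + (-1) * w) by ring.
    by rewrite h1 h2 subrr.
  by split=> //; rewrite -h1 w0 mulr0 addr0.
have hEO z : HT k n al f z = c0 * cexp (- (n%:R / (4 * a))%:C * z ^+ 2) /\
    kap k n * z ^+ n * HT k n (al + n%:R) (fun x => x%:C * f x) z = 0.
  apply: alg1.
    have := hz 1 z (normr1 _); rewrite (rmorph1 (real_complex R)) => <-.
    by congr (_ + _); rewrite !mulrA.
  have sN : `|(-1 : R)| = 1 by rewrite normrN1.
  have := hz (-1) z sN; rewrite (rmorphN1 (real_complex R)) => <-.
  by congr (_ + _); rewrite !mulrA.
have HG z : HT k n al G z = c0 * cexp (- (n%:R / (4 * a))%:C * z ^+ 2).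
  rewrite (HT_gauss n1 hk lam z a0) /lam -mulrA; congr (_ * _).
  rewrite mulrA -(rmorphM (real_complex R)) powRN mulfV ?mul1r//.
  by rewrite gt_eqF// powR_gt0// mulr_gt0.
have mom m : cint (fun x => f x * (U x ^+ (2 * m))%:C) = cint (fun x => G x * (U x ^+ (2 * m))%:C).
  apply: (moment_of_hc b1); rewrite -[RHS]mul1r.
  apply: (hc_unique n1 a0 A0 a20 B0 b1 gf gG) => z _.
  by rewrite mul1r HG; case: (hEO z).
have momx m : cint (fun x => x%:C * f x * (U x ^+ (2 * m))%:C) = 0.
  (* Only the unit circle is needed, where [z^n] can be divided out; writing 0 as [0 * HT] lets
     [hc_unique] apply with [lam = 0]. *)
  have hz0 z : nc z = 1 -> HT k n (al + n%:R) (fun x => x%:C * f x) z =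
      0 * HT k n (al + n%:R) (fun x => x%:C * f x) z.
    move=> z1; rewrite mul0r; have [_ h] := hEO z.
    have z0 : z != 0 by apply/eqP => z0; move: z1; rewrite z0 nc0 => /eqP; rewrite eq_sym oner_eq0.
    have c1 : kap k n * z ^+ n != 0 by rewrite mulf_neq0 ?expf_neq0// kap_neq0.
    by apply: (mulfI c1); rewrite mulr0.
  have := hc_unique n1 a0 A'0 a0 A'0 b2 gxf gxf hz0 (2 * m)%N; rewrite mul0r => h.
  have c1 : (bm (al + n%:R) m * n%:R ^+ (2 * m))%:C != 0.
    apply/eqP => /(congr1 Re) /= /eqP; apply/negP; rewrite mulf_neq0 ?bm_neq0//; first by lra.
    by rewrite expf_neq0// gt_eqF.
  by apply: (mulfI c1); rewrite mulr0 -[RHS]h /hc bc_double.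
pose d x := f x + (-1) * G x.
have md : cmeasurable d by apply: cmeasurableD => //; apply: cmeasurableM => //; exact: cmeasurableC.
(* The smaller of the two exponential rates available, the one for [G]; the rate known for [f] is
   twice as large. *)
pose c := n%:R * (a / 2) / 4.
have c_gt0 : 0 < c by rewrite divr_gt0// mulr_gt0.
have cc : c <= n%:R * a / 4 by rewrite /c ler_pM2r ?invr_gt0// ler_pM2l//; lra.
have [if1 if2] := exp_integrable_Lp n1 hk p1 q1 a0 mf hf.
have [iG1 iG2] := gauss_exp_integrable n1 hk lam a0; rewrite -/G -/c in iG1 iG2.
have dE (h1 h2 : R -> R[i]) (e : R -> R[i]) : cintegrable (fun x => h1 x * e x) ->
    cintegrable (fun x => h2 x * e x) ->
    cintegrable (fun x => (h1 x + (-1) * h2 x) * e x) /\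
    cint (fun x => (h1 x + (-1) * h2 x) * e x) =
    cint (fun x => h1 x * e x) - cint (fun x => h2 x * e x).
  move=> j1 j2; have E : (fun x => (h1 x + (-1) * h2 x) * e x) =
      fun x => h1 x * e x + (-1) * (h2 x * e x).
    by apply/funext => x; rewrite mulrDl -mulrA.
  rewrite E; split; first by apply: cintegrableD => //; exact: cintegrableZ.
  by rewrite cintD ?cintZ ?mulN1r//; exact: cintegrableZ.
have xdE : (fun x => x%:C * d x) = fun x => x%:C * f x + (-1) * (x%:C * G x).
  by apply/funext => x; rewrite /d mulrDr mulrCA.
have xdE' (e : R -> R[i]) : (fun x => x%:C * d x * e x) =
    fun x => (x%:C * f x + (-1) * (x%:C * G x)) * e x.
  by apply/funext => x; rewrite /d mulrDr [x%:C * (_ * _)]mulrCA.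
have d0 : {ae mu, forall x, d x = 0}.
  apply: (complex_moments_zero_ae c_gt0 md).
  - by have [h _] := dE f G (fun x => (expR (c * U x ^+ 2))%:C) (cintegrable_exp_le cc mf if1) iG1; exact: h.
  - rewrite (xdE' (fun x => (expR (c * U x ^+ 2))%:C)).
    by have [h _] := dE _ _ (fun x => (expR (c * U x ^+ 2))%:C) (cintegrable_exp_le cc mxf if2) iG2; exact: h.
  - move=> m; have [_ ->] := dE _ _ _ (gbound_moment n1 (2 * m)%N gf) (gbound_moment n1 (2 * m)%N gG).
    by rewrite mom subrr.
  - move=> m; rewrite (xdE' (fun x => (U x ^+ (2 * m))%:C)).
    have [_ ->] := dE _ _ _ (gbound_moment n1 (2 * m)%N gxf) (gbound_moment n1 (2 * m)%N gxG).
    by rewrite momx (gs_odd_moment n1 hk) ?subrr.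
have FM : Filter (nbhs (almost_everywhere mu)) := ae_filter_ringOfSetsType mu.
apply: filterS d0 => x; rewrite /d mulN1r => /eqP; rewrite subr_eq0 => /eqP.
by [].
Qed.

(** With the transform known, the log integrand at [t^n] is [log+ (exp ((n b - B) t^2) |c0| / C)].
    If [a b > 1/4] its lower sums diverge unless [c0 = 0]; if [a b = 1/4] it is constant, so
    [|c0| <= C]. *)
Lemma miyachi_uniqueness a b C p q (f : R -> R[i]) : 0 < a -> 0 < b -> 0 < C ->
  (1 <= p)%E -> (1 <= q)%E -> hyp53 k n a b C p q f ->
  (1 / 4 < a * b -> {ae mu, forall x, f x = 0}) /\
  (a * b = 1 / 4 -> exists lam : R[i],
     nc lam <= (2 * a) `^ (al + 1) * C /\
     {ae mu, forall x, f x = lam * (expR (- (n%:R * a * `|x| `^ (2 / n%:R))))%:C}).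
Proof.
move=> a0 b0 C0 p1 q1 [mf hf iL].
have n0 : (0 : R) < n%:R by rewrite ltr0n.
have [A [N [A1 gf]]] := gbound_Lp n1 hk p1 q1 a0 mf hf.
have [A' [N' [A'1 gxf]]] := gbound_mulx n1 a0 A1 gf.
pose c0 := HT k n al f 0; pose B := n%:R / (4 * a).
have tg ab := transform_gaussian n1 hk a0 A1 A'1 gf gxf C0 (b := b) ab iL.
have [K1 K10 ls] := Lfun_lower_sums n1 hk a0 A1 A'1 gf gxf iL.
have FM : Filter (nbhs (almost_everywhere mu)) := ae_filter_ringOfSetsType mu.
have Lt (t : R) : 1 / 4 <= a * b -> 0 <= t ->
    Lfun k n f b C (1 * t ^+ n) = logp (expR ((n%:R * b - B) * t ^+ 2) * (nc c0 / C)).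
  move=> ab t0; rewrite /Lfun (U_pow n1 (normr1 _) t0) (Fkn_pow n1 hk gf gxf (normr1 _) t0).
  rewrite (tg ab 1 t%:C (normr1 _)) -/c0 -/B (ncM c0).
  have -> : - B%:C * t%:C ^+ 2 = (- (B * t ^+ 2))%:C.
    rewrite (rmorphN (real_complex R)) (rmorphM (real_complex R) B (t ^+ 2)).
    by rewrite (rmorphXn (real_complex R) 2 t) mulNr.
  rewrite cexp_real ncR ger0_norm ?expR_ge0//; congr logp.
  have -> : (n%:R * b - B) * t ^+ 2 = n%:R * b * t ^+ 2 + (- (B * t ^+ 2)) by ring.
  by rewrite expRD; move: (expR _) (expR _) (nc c0) (C^-1) => e1 e2 e3 e4; ring.
have BE : n%:R * b - B = n%:R / a * (a * b - 1 / 4).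
  by rewrite /B; field; rewrite gt_eqF.
split=> [ab|ab].
- have ab' := ltW ab.
  have eta0 : 0 < n%:R * b - B by rewrite BE mulr_gt0 ?divr_gt0// subr_gt0.
  have c00 : c0 = 0.
    apply: nc_eq0; apply/eqP; rewrite eq_le nc_ge0 andbT leNgt; apply/negP => cp.
    have r0 : 0 < nc c0 / C by rewrite divr_gt0.
    pose eta := n%:R * b - B; pose l := ln (nc c0 / C).
    (* Beyond this [T], [eta t^2 >= eta t >= 1 + |l|], so the logarithm is at least 1. *)
    apply: (lower_sums_const (T := 1 + (1 + `|l|) / eta) (ls 1 (normr1 _)) ltr01); last first.
      by move=> t _; exact: logp_ge0.
    move=> t Tt; have e0 : 0 < eta by [].
    have u0 : 0 <= (1 + `|l|) / eta by rewrite divr_ge0 ?(ltW e0)// addr_ge0.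
    have t1 : 1 <= t by lra.
    rewrite Lt//; last by lra.
    have e1 : 1 < expR 1 :> R by rewrite -[ltLHS]expR0 ltr_expR.
    apply: (@le_trans _ _ (logp (expR 1))); first by rewrite /logp e1 expRK.
    have rE : nc c0 / C = expR l by rewrite /l lnK ?posrE.
    apply: logp_le; rewrite rE -expRD ler_expR -/eta.
    have h1 : 1 + `|l| <= eta * t.
      by rewrite mulrC -ler_pdivrMr//; lra.
    have h2 : eta * t <= eta * t ^+ 2 by rewrite ler_pM2l// expr2 ler_peMr//; lra.
    have := ler_norm (- l); rewrite normrN; lra.
  have := ae_gaussian p1 q1 a0 A1 A'1 gf gxf hf (tg ab'); rewrite -/c0 c00.
  by apply: filterS => x ->; rewrite /gs !mul0r.
- have ab' : 1 / 4 <= a * b by rewrite ab.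
  exists (c0 * ((2 * a) `^ (al + 1))%:C); split.
    rewrite ncM ncR ger0_norm ?powR_ge0// mulrC ler_wpM2l ?powR_ge0//.
    rewrite leNgt; apply/negP => Cc.
    have r1 : 1 < nc c0 / C by rewrite ltr_pdivlMr// mul1r.
    have m0 : 0 < logp (nc c0 / C) by rewrite /logp r1 ln_gt0.
    apply: (lower_sums_const (T := 0) (ls 1 (normr1 _)) m0) => [t t0|t _]; last exact: logp_ge0.
    by rewrite Lt// BE ab subrr mulr0 mul0r expR0 mul1r.
  have := ae_gaussian p1 q1 a0 A1 A'1 gf gxf hf (tg ab').
  by apply: filterS => x ->; rewrite /gs U2.
Qed.

(** Without this the negated almost everywhere statements of the examples could fail. *)
Lemma mu_setT_gt0 : (0 < mu setT)%E.
Proof.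
have [c c0 hc] := mu_shell n1 hk.
have := hc 1 1 (1 + 1) (normr1 _) (lexx _); rewrite lerDl ler01 lexx addrK mulr1.
move=> /(_ isT) h1; apply: lt_le_trans (le_trans h1 _); first by rewrite lte_fin.
by apply: le_measure; rewrite ?inE//; exact: measurable_shell.
Qed.

Lemma not_ae_false (P : R -> Prop) : (forall x, ~ P x) -> ~ {ae mu, forall x, P x}.
Proof.
move=> nP [Z [mZ Z0 PZ]].
have ZT : Z = setT by apply/seteqP; split=> // x _; apply: PZ; exact: nP.
by have := mu_setT_gt0; rewrite -ZT Z0 ltxx.
Qed.

(** [a < c] puts the weighted Gaussian in every space; [b c < 1/4] makes the weighted transform
    decay like a Gaussian, and [log+ u <= u] makes the log integral finite. *)
Lemma hyp53_gauss a b C p q lam c : 0 < a -> 0 < b -> 0 < C -> (1 <= p)%E -> (1 <= q)%E ->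
  a < c -> b * c < 1 / 4 -> hyp53 k n a b C p q (gs n lam (n%:R * c)).
Proof.
move=> a0 b0 C0 p1 q1 ac bc.
have n0 : (0 : R) < n%:R by rewrite ltr0n.
have c0 : 0 < c by exact: lt_trans ac.
split; [exact: cmeasurable_gs|exact: gauss_LpLq|].
have [A [N [A1 gf]]] := gbound_gauss n1 hk lam c0.
have c20 : 0 < c / 2 by rewrite divr_gt0.
have [A' [N' [A'1 gxf]]] := gbound_mulx n1 c20 A1 gf.
pose D := nc lam * (2 * c) `^ (- (al + 1)).
have D0 : 0 <= D by rewrite mulr_ge0 ?nc_ge0 ?powR_ge0.
have FE x : nc (Fkn k n (gs n lam (n%:R * c)) x) = D * expR (- (n%:R / (4 * c) * U x ^+ 2)).
  rewrite (FknE n1 hk x gf gxf) (HT_gauss_odd n1 hk lam _ (aln_ge n1 hk) c0) mulr0 addr0.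
  rewrite (HT_gauss n1 hk lam _ c0) (ncM lam) (ncM (_%:C)) ncR ger0_norm ?powR_ge0//.
  have -> : - (n%:R / (4 * c))%:C * (`|x| `^ n%:R^-1)%:C ^+ 2 = (- (n%:R / (4 * c) * U x ^+ 2))%:C.
    rewrite (rmorphN (real_complex R)) (rmorphM (real_complex R) (n%:R / (4 * c)) (U x ^+ 2)).
    by rewrite (rmorphXn (real_complex R) 2 (U x)) mulNr.
  by rewrite cexp_real ncR [`|expR _|]ger0_norm ?expR_ge0// mulrA.
pose eta := n%:R / (4 * c) - n%:R * b.
have eta0 : 0 < eta.
  rewrite subr_gt0 ltr_pdivlMr ?mulr_gt0// -mulrA gtr_pMr//; lra.
have mE (s : R) : measurable_fun setT (fun x => expR (s * U x ^+ 2)).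
  apply: measurableT_comp => //; apply: measurable_funM => //.
  by apply: measurable_funX; exact: measurable_U.
have E x : expR (n%:R * b * `|x| `^ (2 / n%:R)) * nc (Fkn k n (gs n lam (n%:R * c)) x) / C =
    D / C * expR (- eta * U x ^+ 2).
  rewrite FE U2.
  have -> : - eta * U x ^+ 2 = n%:R * b * U x ^+ 2 + - (n%:R / (4 * c) * U x ^+ 2).
    by rewrite /eta; ring.
  by rewrite expRD; move: (expR _) (expR _) (C^-1) => e1 e2 e3; ring.
under eq_integral do rewrite E.
apply: (@le_lt_trans _ _ (\int[mu]_x ((D / C)%:E * (expR (- (eta * U x ^+ 2)))%:E))%E).
  apply: ge0_le_integral => //.
  - by move=> x _; rewrite lee_fin logp_ge0.
  - apply/measurable_EFinP; apply: measurable_logp; exact: measurable_funM.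
  - apply: emeasurable_funM => //; apply/measurable_EFinP.
    by under eq_fun do rewrite -mulNr; exact: mE.
  - move=> x _; rewrite -EFinM lee_fin mulNr; apply: logp_le_id.
    by rewrite mulr_ge0 ?expR_ge0// divr_ge0// ltW.
rewrite ge0_integralZl_EFin//; try (by move=> x _; rewrite lee_fin expR_ge0).
- by rewrite (gauss_mass n1 hk eta0) -EFinM ltry.
- by apply/measurable_EFinP; under eq_fun do rewrite -mulNr; exact: mE.
- by rewrite divr_ge0// ltW.
Qed.

Lemma miyachi_examples a b C p q : 0 < a -> 0 < b -> 0 < C -> (1 <= p)%E -> (1 <= q)%E ->
  a * b < 1 / 4 -> exists f1 f2 : R -> R[i],
  [/\ hyp53 k n a b C p q f1, hyp53 k n a b C p q f2,
      ~ {ae mu, forall x, f1 x = 0}, ~ {ae mu, forall x, f2 x = 0} &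
      ~ {ae mu, forall x, f1 x = f2 x}].
Proof.
(* The midpoint of the interval from [a] to [1 / (4 b)], nonempty because [a b < 1/4]. *)
move=> a0 b0 C0 p1 q1 ab; pose c := (a + 1 / 4 / b) / 2.
have ab' : a < 1 / 4 / b by rewrite ltr_pdivlMr.
have ac : a < c by rewrite /c; lra.
have bc : b * c < 1 / 4 by rewrite mulrC -ltr_pdivlMr// /c; lra.
have e0 x : (expR (- (n%:R * c * U x ^+ 2)))%:C != 0.
  by apply/eqP => /(congr1 Re) /= /eqP; rewrite gt_eqF// expR_gt0.
exists (gs n 1 (n%:R * c)), (gs n 2 (n%:R * c)); split.
- exact: hyp53_gauss.
- exact: hyp53_gauss.
- by apply: not_ae_false => x /eqP; apply/negP; rewrite /gs mul1r.
- by apply: not_ae_false => x /eqP; apply/negP; rewrite /gs mulf_neq0// pnatr_eq0.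
- apply: not_ae_false => x; rewrite /gs => /(mulIf (e0 x)) /eqP; apply/negP.
  have -> : (2 : R[i]) = 1 + 1 by ring.
  by rewrite eq_sym -subr_eq0 addrK oner_eq0.
Qed.

End Conclusion.

Theorem theorem5p3 (R : realType) (n : nat) (k a b C : R) (p q : \bar R) :
  (1 <= n)%N ->
  (n%:R - 1) / (2 * n%:R) <= k ->
  0 < a -> 0 < b -> 0 < C ->
  (1 <= p)%E -> (1 <= q)%E ->
  (forall f : R -> R[i], hyp53 k n a b C p q f ->
     (1 / 4 < a * b -> {ae mu_kn k n, forall x, f x = 0}) /\
     (a * b = 1 / 4 ->
        exists lam : R[i],
          ComplexField.Normc.normc lam <= (2 * a) `^ (alpha k n + 1) * C /\
          {ae mu_kn k n, forall x,
             f x = lam * (expR (- (n%:R * a * `|x| `^ (2 / n%:R))))%:C}))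
  /\
  (a * b < 1 / 4 ->
     exists f1 f2 : R -> R[i],
       [/\ hyp53 k n a b C p q f1, hyp53 k n a b C p q f2,
           ~ {ae mu_kn k n, forall x, f1 x = 0},
           ~ {ae mu_kn k n, forall x, f2 x = 0} &
           ~ {ae mu_kn k n, forall x, f1 x = f2 x}]).
Proof.
move=> n1 hk a0 b0 C0 p1 q1; split=> [f hf|ab].
  exact: (miyachi_uniqueness n1 hk a0 b0 C0 p1 q1 hf).
exact: (miyachi_examples n1 hk a0 b0 C0 p1 q1 ab).
Qed.
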